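(* Let $e\in\mathfrak g$ be nilpotent, $\{e,h,f\}$ an $\mathfrak{sl}_2$-triple containing it, $\mathfrak g=\bigoplus_{i\in\mathbb Z}\mathfrak g_i$ the grading by eigenvalues of $\operatorname{ad}h$, and $\mathfrak k=\mathfrak z(e,h,f)$. The following are equivalent: (i) $e$ is a member of a rectangular principal nilpotent pair; (ii) $e$ is even (i.e. $\mathfrak g_i=0$ for all odd $i$), and every regular nilpotent element of $\mathfrak k$ is a regular element of $\mathfrak g_0$ (i.e. its centralizer in $\mathfrak g_0$ has dimension $\operatorname{rk}\mathfrak g_0=\operatorname{rk}\mathfrak g$). Moreover, if (ii) holds and $e'$ is any regular nilpotent element of $\mathfrak k$, then $(e,e')$ is a principal nilpotent pair.
   Context: Let $\mathfrak g$ be a complex semisimple Lie algebra with adjoint group $G$; $\mathfrak z(\cdot)$ denotes (simultaneous) centralizers in $\mathfrak g$. A principal nilpotent pair is a pair $(e_1,e_2)\in\mathfrak g\oplus\mathfrak g$ with $[e_1,e_2]=0$, $\dim\mathfrak z(e_1,e_2)=\operatorname{rk}\mathfrak g$, and such that for every $(t_1,t_2)\in(\mathbb C^* )^2$ there is $g\in G$ with $\operatorname{Ad}g(e_i)=t_ie_i$. An $\mathfrak{sl}_2$-triple $\{e,h,f\}$ satisfies $[h,e]=2e$, $[h,f]=-2f$, $[e,f]=h$. A principal nilpotent pair $(e_1,e_2)$ is rectangular if there exist $\mathfrak{sl}_2$-triples $\{e_1,h_1,f_1\}$ and $\{e_2,h_2,f_2\}$ such that every element of the first commutes with every element of the second.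 A regular nilpotent element of the reductive algebra $\mathfrak k$ means a principal nilpotent element of $[\mathfrak k,\mathfrak k]$. *)

(* Defs.v *)
From HB Require Import structures.
From mathcomp Require Import all_boot all_order all_algebra.
From mathcomp Require Import complex.
From mathcomp Require Import reals.
Set Implicit Arguments. Unset Strict Implicit. Unset Printing Implicit Defensive.
Import Order.TTheory GRing.Theory Num.Theory.
Local Open Scope ring_scope.

Section LieDefs.
Variables (F : fieldType) (V : vectType F) (br : V -> V -> V).

Definition lie_algebra : Prop :=
  [/\ (forall (a : F) (x y z : V), br (a *: x + y) z = a *: br x z + br y z),
      (forall (a : F) (x y z : V), br z (a *: x + y) = a *: br z x + br z y),
      (forall x : V, br x x = 0) &
      (forall x y z : V, br x (br y z) + br y (br z x) + br z (br x y) = 0)].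

Definition ad (x : V) : 'End(V) := linfun (br x).

Definition zc (x : V) : {vspace V} := lker (ad x).

(* [S, S] : the subspace spanned by brackets of elements of S
   (by bilinearity, spanned by brackets of basis vectors). *)
Definition derived (S : {vspace V}) : {vspace V} :=
  <<[seq br x y | x <- vbasis S, y <- vbasis S]>>%VS.

Definition ideal (I : {vspace V}) : Prop :=
  forall x y, y \in I -> br x y \in I.

Definition solvable_sub (I : {vspace V}) : Prop :=
  exists n, iter n derived I = 0%VS.

Definition semisimple : Prop :=
  forall I, ideal I -> solvable_sub I -> I = 0%VS.

Definition ad_nilpotent_on (S : {vspace V}) (x : V) : Prop :=
  exists n, forall y, y \in S -> iter n (br x) y = 0.

Definition ad_nilpotent (x : V) : Prop := ad_nilpotent_on fullv x.

Definition lie_rank_is (S : {vspace V}) (r : nat) : Prop :=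
  (exists2 y, y \in S & \dim (S :&: zc y) = r) /\
  (forall y, y \in S -> (r <= \dim (S :&: zc y))%N).

Definition principal_nilpotent_in (S : {vspace V}) (x : V) : Prop :=
  [/\ x \in S, ad_nilpotent_on S x & lie_rank_is S (\dim (S :&: zc x))].

(* exp (ad x) for ad-nilpotent x; the series is truncated at dim V, beyond
   which all powers of a nilpotent endomorphism vanish. *)
Definition expad (x : V) (y : V) : V :=
  \sum_(k < (\dim (fullv : {vspace V})).+1) (k`!%:R)^-1 *: iter k (br x) y.

Inductive adjoint_group : (V -> V) -> Prop :=
| ag_id : adjoint_group id
| ag_exp (x : V) (g : V -> V) :
    ad_nilpotent x -> adjoint_group g -> adjoint_group (expad x \o g).

Definition sl2_triple (e h f : V) : Prop :=
  [/\ br h e = 2%:R *: e, br h f = - (2%:R *: f) & br e f = h].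

Definition principal_nilpotent_pair (e1 e2 : V) : Prop :=
  [/\ br e1 e2 = 0,
      lie_rank_is fullv (\dim (zc e1 :&: zc e2)) &
      forall t1 t2 : F, t1 != 0 -> t2 != 0 ->
        exists2 g, adjoint_group g & g e1 = t1 *: e1 /\ g e2 = t2 *: e2].

Definition rectangular_ppn (e1 e2 : V) : Prop :=
  principal_nilpotent_pair e1 e2 /\
  exists h1 f1 h2 f2, [/\ sl2_triple e1 h1 f1, sl2_triple e2 h2 f2 &
    forall a b, a \in [:: e1; h1; f1] -> b \in [:: e2; h2; f2] -> br a b = 0].

Definition grade (h : V) (i : int) : {vspace V} :=
  lker (ad h - (i%:~R : F) *: \1)%VF.

Definition even_nilpotent (h : V) : Prop :=
  forall i : int, odd `|i|%N -> grade h i = 0%VS.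

End LieDefs.

(* Main.v *)
Require Import Defs.
From HB Require Import structures.
From mathcomp Require Import all_boot all_order all_algebra.
From mathcomp Require Import complex.
From mathcomp Require Import reals.
From mathcomp Require Import ring zify.
Import Order.TTheory GRing.Theory Num.Theory.
Local Open Scope ring_scope.
Set Implicit Arguments. Unset Strict Implicit. Unset Printing Implicit Defensive.

(* Semisimplicity enters only through the nondegeneracy of the Killing form.  If (e, e2) is
   rectangular, the triples {e, h, f} and {e2, h2, f2} can be taken to commute, so that e2 is a
   nilpotent element of k.  Decomposing z(e2) under the first triple and g_0 under the second,
     rk g = dim z(e, e2) = dim g_{0,0} + dim g_{0,1} + dim (z(e2) /\ g_1),
   where g_{i,j} is the joint eigenspace of (h, h2); since g_{0,0} is the centralizer of h + N h2
   for some N, its dimension is at least rk g.  Hence the other terms vanish: g_1 = 0, so e is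
   even, and g_{0,0} is commutative, so {e2, h2, f2} is a principal triple of k.  All principal
   triples of k are conjugate, hence every principal nilpotent e' of k has
   dim z_{g_0}(e') = rk g.  Conversely, if e is even then dim z(e, e') = dim z_{g_0}(e') for e' in
   k, and the tori of the two commuting triples rescale e and e' independently.  That k has a
   principal nilpotent element is shown by summing the root vectors of a system of simple roots. *)

(** The obstacle is that [k] is only reductive: its own Killing form is useless on its center. So
    the structure theory is developed for a subalgebra [S] on which the Killing form of the whole
    algebra stays nondegenerate ([ndg S]), a condition inherited by centralizers of triples, by
    derived algebras and by zero weight spaces. Nilpotency comes from Cartan's criterion, with
    complex conjugation turning the relevant trace into a sum of squared moduli. The theory of sl2
    rests on one commutation formula for e^(k+1) f instead of complete reducibility. Conjugacy of
    principal triples avoids Weyl chambers: orthogonality arguments make the neutral elements h1 and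
    h2 commute, then reflections decrease the natural number [kap (h1 - h2) (h1 - h2)] until h1 =
    h2. Finally, a Cartan subalgebra is handled through a single integral element: for large N the
    eigenspaces of N y + h are joint eigenspaces of y and h, so roots become integers. *)

Import passmx.

(** * Endomorphisms: trace, polynomial calculus, generalized eigenspaces *)

Section Endo.
Variables (C : numClosedFieldType) (V : vectType C).
Implicit Types (f g : 'End(V)) (p q : {poly C}) (v w : V) (a b : C) (W : {vspace V}).

Definition endomx f : 'M[C]_(\dim {:V}) := mxof (vbasis {:V}) (vbasis {:V}) f.
Let rV : V -> 'rV_(\dim {:V}) := rVof (vbasis {:V}).

Let rV_inj : injective rV.
Proof. exact: can_inj (rVofK (vbasisP _)). Qed.

Let rV_app f v : rV (f v) = rV v *m endomx f.
Proof. exact: (rVof_app _ (vbasisP _)). Qed.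

Definition etr f : C := \tr (endomx f).

Lemma etrD f g : etr (f + g) = etr f + etr g.
Proof. by rewrite /etr /endomx linearD mxtraceD. Qed.

Lemma etrZ a f : etr (a *: f) = a * etr f.
Proof. by rewrite /etr /endomx linearZ mxtraceZ. Qed.

Lemma etrC f g : etr (f \o g)%VF = etr (g \o f)%VF.
Proof. by rewrite /etr /endomx !(mxof_comp _ _ (vbasisP {:V})) mxtrace_mulC. Qed.

Definition pact f p : 'End(V) :=
  \sum_(i < size p) p`_i *: iter i (fun g => f \o g)%VF \1%VF.

Lemma pactE f p v : pact f p v = \sum_(i < size p) p`_i *: iter i f v.
Proof.
rewrite sum_lfunE; apply: eq_bigr => i _; rewrite scale_lfunE; congr (_ *: _).
by elim: (nat_of_ord i) => [|k IHk] /=; rewrite ?id_lfunE // comp_lfunE IHk.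
Qed.

Lemma pact_wide f p v n : (size p <= n)%N -> pact f p v = \sum_(i < n) p`_i *: iter i f v.
Proof.
move=> le_pn; rewrite pactE (big_ord_widen _ (fun i => p`_i *: iter i f v) le_pn) big_mkcond.
by apply: eq_bigr => i _; case: ltnP => // /(nth_default 0) ->; rewrite scale0r.
Qed.

Lemma pactD f p q v : pact f (p + q) v = pact f p v + pact f q v.
Proof.
have ln : (size p <= maxn (size p) (size q))%N by rewrite leq_maxl.
have rn : (size q <= maxn (size p) (size q))%N by rewrite leq_maxr.
rewrite (pact_wide f v ln) (pact_wide f v rn) (pact_wide f v (size_polyD _ _)) -big_split /=.
by apply: eq_bigr => i _; rewrite coefD scalerDl.
Qed.

Lemma pactZ f a p v : pact f (a *: p) v = a *: pact f p v.
Proof.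
rewrite (pact_wide f v (size_scale_leq _ _)) pactE scaler_sumr.
by apply: eq_bigr => i _; rewrite coefZ scalerA.
Qed.

Lemma pactC f a v : pact f a%:P v = a *: v.
Proof. by rewrite (pact_wide f v (size_polyC_leq1 _)) big_ord1 coefC. Qed.

Lemma pactMX f p v : pact f (p * 'X) v = f (pact f p v).
Proof.
have sz : (size (p * 'X)%R <= (size p).+1)%N by apply: leq_trans (size_polyMleq _ _) _; rewrite size_polyX addn2.
rewrite (pact_wide f v sz) pactE big_ord_recl coefMX eqxx scale0r add0r linear_sum.
by apply: eq_bigr => i _; rewrite coefMX linearZ.
Qed.

Lemma pactM f p q v : pact f (p * q) v = pact f p (pact f q v).
Proof.
elim/poly_ind: p => [|p c IHp]; first by rewrite mul0r -polyC0 !pactC !scale0r.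
by rewrite mulrDl -mulrA -['X * q]commr_polyX mulrA !pactD !pactMX IHp mul_polyC pactZ pactC.
Qed.

Lemma pactX f v : pact f 'X v = f v.
Proof. by rewrite -['X]mul1r pactMX -polyC1 pactC scale1r. Qed.

Lemma pactN f p v : pact f (- p) v = - pact f p v.
Proof. by rewrite -scaleN1r pactZ scaleN1r. Qed.

Lemma pactXsubC f a v : pact f ('X - a%:P) v = f v - a *: v.
Proof. by rewrite pactD pactN pactX pactC. Qed.

Lemma pactXn f n v : pact f 'X^n v = iter n f v.
Proof.
elim: n => [|n IHn] /=; first by rewrite expr0 -polyC1 pactC scale1r.
by rewrite exprSr pactMX IHn.
Qed.

Lemma pact_eigen f p a v : f v = a *: v -> pact f p v = p.[a] *: v.
Proof.
move=> fv; elim/poly_ind: p => [|p c IHp]; first by rewrite -polyC0 pactC hornerC.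
by rewrite pactD pactMX IHp pactC linearZ /= fv scalerA -scalerDl !hornerE.
Qed.

Lemma pact_stable f p W : (forall v, v \in W -> f v \in W) ->
  forall v, v \in W -> pact f p v \in W.
Proof.
move=> fW v Wv; rewrite pactE memv_suml // => i _; apply: memvZ.
by elim: (nat_of_ord i) => //= k; apply: fW.
Qed.

Lemma pact_comm f g p v : (forall v, f (g v) = g (f v)) -> pact f p (g v) = g (pact f p v).
Proof.
move=> fg; rewrite !pactE linear_sum; apply: eq_bigr => i _; rewrite linearZ; congr (_ *: _).
by elim: (nat_of_ord i) => //= k ->.
Qed.

Definition chp f : {poly C} := char_poly (endomx f).

Lemma Cayley_Hamilton_lin n (A : 'M[C]_n) :
  \sum_(i < size (char_poly A)) (char_poly A)`_i *: iter i (mulmx A) 1%:M = 0.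
Proof.
case: n A => [|n] A; first by apply/matrixP => - [].
rewrite -[RHS](Cayley_Hamilton A) [in RHS](_ : char_poly A = \sum_(i < size (char_poly A)) (char_poly A)`_i *: 'X^i).
  rewrite linear_sum; apply: eq_bigr => i _; rewrite linearZ rmorphXn /= horner_mx_X.
  by congr (_ *: _); elim: (nat_of_ord i) => //= k ->; rewrite exprS.
by rewrite -poly_def coefK.
Qed.

Lemma pact_chp f v : pact f (chp f) v = 0.
Proof.
have rV_sum I r (P : pred I) F : rV (\sum_(i <- r | P i) F i) = \sum_(i <- r | P i) rV (F i).
  exact: (linear_sum (rVof (vbasis {:V}))).
have rVZ a w : rV (a *: w) = a *: rV w by rewrite /rV linearZ.
have rV0 : rV 0 = 0 by rewrite /rV linear0.
apply: rV_inj; rewrite pactE rV_sum rV0 /chp.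
rewrite -[RHS](mulmx0 _ (rV v)) -[in RHS](Cayley_Hamilton_lin (endomx f)).
rewrite mulmx_sumr; apply: eq_bigr => i _; rewrite rVZ -scalemxAr; congr (_ *: _).
elim: (nat_of_ord i) => [|k IHk] /=; first by rewrite mulmx1.
rewrite rV_app IHk -!mulmxA; congr (_ *m _).
by elim: k {IHk} => [|k IHk] /=; rewrite ?mul1mx ?mulmx1 // -mulmxA IHk.
Qed.

Definition roots_chp f : seq C := sval (closed_field_poly_normal (chp f)).

Lemma chp_roots f : chp f = \prod_(a <- roots_chp f) ('X - a%:P).
Proof.
rewrite /roots_chp; case: closed_field_poly_normal => s /= {1}->.
by rewrite (monicP (char_poly_monic _)) scale1r.
Qed.

Lemma eigenvalueE f a : eigenvalue (endomx f) a <->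
  exists2 v, v != 0 & f v = a *: v.
Proof.
have rVZ w : rV (a *: w) = a *: rV w by rewrite /rV linearZ.
have rV_eq0 w : (rV w == 0) = (w == 0) by rewrite (rVof_eq0 (vbasisP _)).
split=> [/eigenvalueP[u uf u0]|[v v0 fv]].
  have uK : rV (vecof (vbasis {:V}) u) = u by rewrite /rV (vecofK (vbasisP _)).
  exists (vecof (vbasis {:V}) u); first by rewrite -rV_eq0 uK.
  by apply: rV_inj; rewrite rV_app rVZ uK.
apply/eigenvalueP; exists (rV v); first by rewrite -rV_app fv rVZ.
by rewrite rV_eq0.
Qed.

Lemma mem_roots_chp f a : a \in roots_chp f <-> exists2 v, v != 0 & f v = a *: v.
Proof. by rewrite -eigenvalueE eigenvalue_root_char -/(chp f) chp_roots root_prod_XsubC. Qed.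

Lemma size_roots_chp f : size (roots_chp f) = \dim {:V}.
Proof.
by apply: succn_inj; rewrite -(size_prod_XsubC _ id) -chp_roots size_char_poly.
Qed.

(** On the empty list the index [(size s).-1] truncates to 0 and reads the leading coefficient,
    hence the value 1. *)
Lemma sum_roots_prod (s : seq C) :
  (\prod_(a <- s) ('X - a%:P))`_(size s).-1 = if s is [::] then 1 else - \sum_(a <- s) a.
Proof.
elim: s => [|a s IHs]; first by rewrite big_nil coef1.
rewrite !big_cons /= mulrBl coefB mul_polyC coefZ coefXM.
have lc : (\prod_(b <- s) ('X - b%:P))`_(size s) = 1.
  have /monicP := monic_prod_XsubC s predT id; rewrite lead_coefE.
  by rewrite size_prod_XsubC.
rewrite lc mulr1; case: s IHs lc => [|b s] /= IHs lc; first by rewrite big_nil addr0 sub0r.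
by rewrite IHs opprD addrC.
Qed.

Lemma etr_sum f : etr f = \sum_(a <- roots_chp f) a.
Proof.
case: (posnP (\dim {:V})) => [V0|V0].
  have /size0nil -> : size (roots_chp f) = 0%N by rewrite size_roots_chp.
  by rewrite big_nil /etr /mxtrace big1 // => - [m ltm] _; exfalso; move: ltm; rewrite V0.
have := sum_roots_prod (roots_chp f); rewrite -chp_roots size_roots_chp.
rewrite char_poly_trace // -/(etr f).
by case: (roots_chp f) (size_roots_chp f) V0 => [<- //|b s _ _ /oppr_inj].
Qed.

Lemma etr_eq0 f : (forall a v, v != 0 -> f v = a *: v -> a = 0) -> etr f = 0.
Proof.
move=> f0; rewrite etr_sum big_seq big1 // => a /mem_roots_chp[v v0 fv].
exact: f0 v0 fv.
Qed.

Lemma etr_ge0 f : (forall a v, v != 0 -> f v = a *: v -> 0 <= a) -> 0 <= etr f.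
Proof.
move=> f0; rewrite etr_sum big_seq sumr_ge0 // => a /mem_roots_chp[v v0 fv].
exact: f0 v0 fv.
Qed.

(** A sum of nonnegative numbers vanishes only termwise. This drives Cartan's criterion and all
    definiteness arguments below. *)
Lemma etr_ge0_eq0 f : (forall a v, v != 0 -> f v = a *: v -> 0 <= a) -> etr f = 0 ->
  forall a v, v != 0 -> f v = a *: v -> a = 0.
Proof.
move=> f0 tr0 a v v0 fv; have s_ge0 b : b \in roots_chp f -> 0 <= b.
  by move=> /mem_roots_chp[w w0 fw]; apply: f0 w0 fw.
have sa : a \in roots_chp f by apply/mem_roots_chp; exists v.
move: tr0; rewrite etr_sum big_seq => /eqP; rewrite psumr_eq0 //.
by move=> /allP/(_ a sa); rewrite sa => /eqP.
Qed.

Lemma etr_nat f : (forall a v, v != 0 -> f v = a *: v -> exists m : nat, a = m%:R) ->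
  exists m : nat, etr f = m%:R.
Proof.
move=> fN; rewrite etr_sum.
have {fN}: forall a, a \in roots_chp f -> exists m : nat, a = m%:R.
  by move=> a /mem_roots_chp[v v0 fv]; apply: fN v0 fv.
elim: (roots_chp f) => [|a s IHs] sN; first by exists 0%N; rewrite big_nil.
have [m am] := sN a (mem_head _ _).
have [|k sk] := IHs; first by move=> b sb; apply: sN; rewrite inE sb orbT.
by exists (m + k)%N; rewrite big_cons am sk natrD.
Qed.

(** Apply the linear factors of the characteristic polynomial one by one to a nonzero vector of [W]:
    the last nonzero value is an eigenvector for the next factor. *)
Lemma eigen_in f W : (forall v, v \in W -> f v \in W) -> W != 0%VS ->
  exists a v, [/\ v \in W, v != 0 & f v = a *: v].
Proof.
move=> fW W0; have: vpick W != 0 by rewrite vpick0.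
have := memv_pick W; move: (vpick W) => w Ww w0.
have: pact f (\prod_(a <- roots_chp f) ('X - a%:P)) w = 0 by rewrite -chp_roots pact_chp.
elim: (roots_chp f) w Ww w0 => [|a s IHs] w Ww w0.
  by rewrite big_nil -polyC1 pactC scale1r => /eqP; rewrite (negPf w0).
rewrite big_cons mulrC pactM pactXsubC.
have [/eqP|fw0] := eqVneq (f w - a *: w) 0; last by apply: IHs; rewrite ?memvB ?memvZ ?fW.
by rewrite subr_eq0 => /eqP fw _; exists a, w.
Qed.

(* [geig] and [gproj] are projections of opaque witnesses because unfolding them makes
   failing unifications explode. *)
Fact geig_exists f a :
  {W : {vspace V} | forall v, (v \in W) = (pact f (('X - a%:P) ^+ \dim {:V}) v == 0)}.
Proof. by exists (lker (pact f (('X - a%:P) ^+ \dim {:V}))) => v; rewrite memv_ker. Qed.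

Definition geig f a : {vspace V} := sval (geig_exists f a).

Lemma mem_geig f a v : (v \in geig f a) = (pact f (('X - a%:P) ^+ \dim {:V}) v == 0).
Proof. exact: (svalP (geig_exists f a)). Qed.

Lemma eigen_geig f a v : f v = a *: v -> v \in geig f a.
Proof.
move=> fv; rewrite mem_geig (pact_eigen _ fv) horner_exp !hornerE subrr.
have [/eqP|] := posnP (\dim {:V}); last by case: (\dim _) => // n _; rewrite expr0n scale0r.
by rewrite dimv_eq0 => /eqP V0; have := memvf v; rewrite V0 memv0 => /eqP ->; rewrite scaler0.
Qed.

Lemma geig_stable f a v : v \in geig f a -> f v \in geig f a.
Proof. by rewrite !mem_geig => /eqP fv; rewrite pact_comm // fv linear0. Qed.

Definition spec f : seq C := undup (roots_chp f).

(** Kills every generalized eigenspace except that of [a]. If [a] is not an eigenvalue no factor is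
    omitted, so that [gproj f a] is then zero. *)
Definition Qpoly f a : {poly C} := \prod_(b <- spec f | b != a) ('X - b%:P) ^+ \dim {:V}.

Lemma coprime_Qpoly f a : coprimep (('X - a%:P) ^+ \dim {:V}) (Qpoly f a).
Proof.
apply: (big_ind (fun p => coprimep _ p)); first exact: coprimep1.
  by move=> p q cp cq; rewrite coprimepMr cp cq.
move=> b ba; rewrite coprimep_expl // coprimep_expr //.
by rewrite coprimep_XsubC root_XsubC.
Qed.

Lemma bezout_Qpoly f a : exists u : {poly C} * {poly C},
  u.1 * ('X - a%:P) ^+ \dim {:V} + u.2 * Qpoly f a == 1.
Proof.
have /Bezout_coprimepP[[u1 u2] /= /eqpP[[c1 c2] /= /andP[c10 c20]]] := coprime_Qpoly f a.
rewrite scalerDr => E; exists ((c1 / c2) *: u1, (c1 / c2) *: u2) => /=.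
by rewrite -!scalerAl -scalerDr mulrC -scalerA scalerDr E scalerA mulVf // scale1r.
Qed.

Definition bez f a := xchoose (bezout_Qpoly f a).

Lemma bezE f a : (bez f a).1 * ('X - a%:P) ^+ \dim {:V} + (bez f a).2 * Qpoly f a = 1.
Proof. exact/eqP/(xchooseP (bezout_Qpoly f a)). Qed.

Fact gproj_exists f a : {g : 'End(V) | g = pact f ((bez f a).2 * Qpoly f a)}.
Proof. by eexists. Qed.

Definition gproj f a : 'End(V) := sval (gproj_exists f a).

Lemma gprojE f a : gproj f a = pact f ((bez f a).2 * Qpoly f a).
Proof. exact: (svalP (gproj_exists f a)). Qed.

Lemma gproj_id f a v : v \in geig f a -> gproj f a v = v.
Proof.
rewrite mem_geig => /eqP av; rewrite -[RHS]scale1r -(pactC f) polyC1 -(bezE f a).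
by rewrite pactD pactM av linear0 add0r gprojE.
Qed.

Lemma pact_all f v : pact f (\prod_(b <- spec f) ('X - b%:P) ^+ \dim {:V}) v = 0.
Proof.
rewrite prodrXl -(size_roots_chp f).
have /dvdpP[q ->] : chp f %| (\prod_(b <- spec f) ('X - b%:P)) ^+ size (roots_chp f).
  rewrite chp_roots.
  have : {subset roots_chp f <= spec f} by move=> a; rewrite mem_undup.
  elim: (roots_chp f) => [|a s IHs] ss; first by rewrite big_nil dvd1p.
  rewrite big_cons /= exprS dvdp_mul ?IHs //.
    by rewrite dvdp_XsubCl root_prod_XsubC ss ?mem_head.
  by move=> b sb; rewrite ss // inE sb orbT.
by rewrite pactM pact_chp linear0.
Qed.

Lemma Qpoly_notin f a : a \notin spec f ->
  Qpoly f a = \prod_(b <- spec f) ('X - b%:P) ^+ \dim {:V}.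
Proof.
move=> sa; rewrite /Qpoly big_mkcond; apply: eq_big_seq => b sb /=.
by case: eqVneq => // ba; move: sa; rewrite -ba sb.
Qed.

Lemma Qpoly_in f a : a \in spec f ->
  Qpoly f a * ('X - a%:P) ^+ \dim {:V} = \prod_(b <- spec f) ('X - b%:P) ^+ \dim {:V}.
Proof. by move=> sa; rewrite [RHS](bigD1_seq a) ?undup_uniq //= mulrC. Qed.

Lemma geig_notin f a v : a \notin spec f -> v \in geig f a -> v = 0.
Proof. by move=> sa va; rewrite -(gproj_id va) gprojE pactM Qpoly_notin // pact_all linear0. Qed.

Lemma memv_gproj f a v : gproj f a v \in geig f a.
Proof.
have [sa|sa] := boolP (a \in spec f); last first.
  by rewrite gprojE pactM Qpoly_notin // pact_all linear0 mem0v.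
by rewrite mem_geig gprojE -pactM mulrCA [_ * Qpoly _ _]mulrC Qpoly_in // pactM pact_all linear0.
Qed.

Lemma gproj_diff f a b v : a != b -> v \in geig f b -> gproj f a v = 0.
Proof.
move=> ab vb; have [sb|sb] := boolP (b \in spec f); last by rewrite (geig_notin sb vb) linear0.
rewrite gprojE pactM /Qpoly big_mkcond (bigD1_seq b) ?undup_uniq //= eq_sym ab mulrC pactM.
by move: vb; rewrite mem_geig => /eqP ->; rewrite !linear0.
Qed.

Lemma gproj_stable f a W : (forall v, v \in W -> f v \in W) ->
  forall v, v \in W -> gproj f a v \in W.
Proof. by rewrite gprojE; apply: pact_stable. Qed.

Lemma gproj_comm f g a v : (forall v, f (g v) = g (f v)) -> gproj f a (g v) = g (gproj f a v).
Proof. by rewrite gprojE; apply: pact_comm. Qed.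

(** The difference [u] has all projections zero, so by the Bezout identity each first Bezout term
    fixes [u]; so does their product, which contains a polynomial annihilating [f]. *)
Lemma gproj_sum f v : v = \sum_(a <- spec f) gproj f a v.
Proof.
apply/eqP; rewrite -subr_eq0; apply/eqP; set u := (X in X = 0).
have u0 a : a \in spec f -> gproj f a u = 0.
  move=> sa; rewrite linearB linear_sum (bigD1_seq a) ?undup_uniq //= (gproj_id (memv_gproj f a v)).
  by rewrite opprD addrA subrr sub0r big1 ?oppr0 // => b ba; rewrite (gproj_diff _ (memv_gproj f b v)) // eq_sym.
have uE a : a \in spec f -> pact f ((bez f a).1 * ('X - a%:P) ^+ \dim {:V}) u = u.
  move=> sa; rewrite -[RHS]scale1r -(pactC f) polyC1 -(bezE f a) pactD.
  by rewrite -gprojE u0 ?addr0.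
suff: pact f (\prod_(a <- spec f) ((bez f a).1 * ('X - a%:P) ^+ \dim {:V})) u = u.
  by rewrite big_split /= pactM pact_all linear0.
rewrite big_seq; elim/big_rec: _ => [|a p sa IHp]; first by rewrite -polyC1 pactC scale1r.
by rewrite pactM IHp uE.
Qed.

Lemma gproj_neq0 f v : v != 0 -> exists a, gproj f a v != 0.
Proof.
move=> v0; have [/hasP[a _ av]|] := boolP (has (fun a => gproj f a v != 0) (spec f)).
  by exists a.
rewrite -all_predC => /allP f0; move: v0; rewrite (gproj_sum f v) big_seq big1 ?eqxx //.
by move=> a /f0 /=; rewrite negbK => /eqP.
Qed.

Lemma geig_eigen f a b v : v \in geig f a -> v != 0 -> f v = b *: v -> b = a.
Proof.
move=> va v0 /eigen_geig vb; apply/eqP; apply: contraNT v0 => ba.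
by rewrite -(gproj_id vb) (gproj_diff ba va).
Qed.

(** For an arbitrary exponent: a nonzero component in [geig f b] with b different from a would lead
    to an eigenvector of eigenvalue b killed by a power of f - a. *)
Lemma geigP f a m v : pact f (('X - a%:P) ^+ m) v = 0 -> v \in geig f a.
Proof.
move=> va; rewrite (gproj_sum f v) big_seq memv_suml // => b _.
have [->|ba] := eqVneq b a; first exact: memv_gproj.
suff -> : gproj f b v = 0 by rewrite mem0v.
apply/eqP/negPn/negP => ub; move: (memv_gproj f b v) => ubb.
pose U := (geig f b :&: lker (pact f (('X - a%:P) ^+ m)))%VS.
have fU w : w \in U -> f w \in U.
  move=> /memv_capP[wb wa]; apply/memv_capP; split; first exact: geig_stable.
  by move: wa; rewrite !memv_ker => /eqP wa; rewrite pact_comm // wa linear0.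
have Uu : gproj f b v \in U.
  rewrite memv_cap ubb memv_ker (pact_comm _ (g := gproj f b)) ?va ?linear0 ?eqxx // => w.
  by rewrite gproj_comm.
have [|c [w [/memv_capP[wb wa] w0 fw]]] := eigen_in fU.
  by apply: contraNneq ub => U0; move: Uu; rewrite U0 memv0.
have cb := geig_eigen wb w0 fw; subst c.
move: wa; rewrite memv_ker (pact_eigen _ fw) horner_exp !hornerE scaler_eq0 (negPf w0) orbF.
by rewrite expf_eq0 subr_eq0 (negPf ba) andbF.
Qed.

Lemma mem_geig0 f v : (v \in geig f 0) = (iter (\dim {:V}) f v == 0).
Proof. by rewrite mem_geig subr0 pactXn. Qed.

Lemma geig0P f m v : iter m f v = 0 -> v \in geig f 0.
Proof. by move=> fv; apply: (@geigP _ _ m); rewrite subr0 pactXn. Qed.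

Lemma gproj_in f W (P : C -> Prop) :
  (forall v, v \in W -> f v \in W) -> (forall a v, v \in W -> v != 0 -> f v = a *: v -> P a) ->
  forall v a, v \in W -> ~ P a -> gproj f a v = 0.
Proof.
move=> fW WP v a Wv nPa; apply/eqP/negPn/negP => ua.
have fU w : w \in (geig f a :&: W)%VS -> f w \in (geig f a :&: W)%VS.
  by move=> /memv_capP[wa wW]; rewrite memv_cap geig_stable ?fW.
have [|b [w [/memv_capP[wa wW] w0 fw]]] := eigen_in fU.
  apply: contraNneq ua => U0; rewrite -memv0 -U0 memv_cap memv_gproj.
  exact: gproj_stable.
by apply: nPa; rewrite -(geig_eigen wa w0 fw); apply: WP w0 fw.
Qed.

Lemma nilpotent_in f W :
  (forall v, v \in W -> f v \in W) -> (forall a v, v \in W -> v != 0 -> f v = a *: v -> a = 0) ->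
  forall v, v \in W -> iter (\dim {:V}) f v = 0.
Proof.
move=> fW W0 v Wv; apply/eqP; rewrite -mem_geig0 (gproj_sum f v) big_seq memv_suml // => a _.
have [->|/eqP a0] := eqVneq a 0; first exact: memv_gproj.
by rewrite (gproj_in fW W0 Wv a0) mem0v.
Qed.

Lemma nilpotent_eigen f m a v : v != 0 -> f v = a *: v -> iter m f v = 0 -> a = 0.
Proof.
move=> v0 fv; have -> : iter m f v = a ^+ m *: v.
  by elim: m => [|m IHm] /=; rewrite ?scale1r // IHm linearZ /= fv scalerA exprSr.
by move/eqP; rewrite scaler_eq0 (negPf v0) orbF expf_eq0 => /andP[_ /eqP].
Qed.

End Endo.

Existing Class lie_algebra.

(** * Elementary bracket identities *)

Section LieAlgebra.
Variables (C : numClosedFieldType) (V : vectType C) (br : V -> V -> V).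
Context {Lie : lie_algebra br}.
Implicit Types (x y z u v w : V) (a b c : C) (S U W A B K M N : {vspace V}).

Lemma brP a x y z : br (a *: x + y) z = a *: br x z + br y z.
Proof. by case: Lie. Qed.
Lemma brPr a x y z : br z (a *: x + y) = a *: br z x + br z y.
Proof. by case: Lie. Qed.
Lemma brxx x : br x x = 0.
Proof. by case: Lie. Qed.

Lemma br0r x : br x 0 = 0.
Proof. by have := brPr (-1) x x x; rewrite !scaleN1r addNr addNr. Qed.
Lemma br0l x : br 0 x = 0.
Proof. by have := brP (-1) x x x; rewrite !scaleN1r addNr addNr. Qed.
Lemma brDl x y z : br (x + y) z = br x z + br y z.
Proof. by rewrite -[x in LHS]scale1r brP scale1r. Qed.
Lemma brDr x y z : br z (x + y) = br z x + br z y.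
Proof. by rewrite -[x in LHS]scale1r brPr scale1r. Qed.
Lemma brZl a x z : br (a *: x) z = a *: br x z.
Proof. by rewrite -[a *: x]addr0 brP br0l addr0. Qed.
Lemma brZr a x z : br z (a *: x) = a *: br z x.
Proof. by rewrite -[a *: x]addr0 brPr br0r addr0. Qed.
Lemma brNl x z : br (- x) z = - br x z.
Proof. by rewrite -scaleN1r brZl scaleN1r. Qed.
Lemma brNr x z : br z (- x) = - br z x.
Proof. by rewrite -scaleN1r brZr scaleN1r. Qed.
Lemma brBl x y z : br (x - y) z = br x z - br y z.
Proof. by rewrite brDl brNl. Qed.
Lemma brBr x y z : br z (x - y) = br z x - br z y.
Proof. by rewrite brDr brNr. Qed.
Lemma br_suml I (r : seq I) (P : pred I) F z :
  br (\sum_(i <- r | P i) F i) z = \sum_(i <- r | P i) br (F i) z.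
Proof. by elim/big_rec2: _ => [|i _ y _ <-]; rewrite ?br0l ?brDl. Qed.
Lemma br_sumr I (r : seq I) (P : pred I) F z :
  br z (\sum_(i <- r | P i) F i) = \sum_(i <- r | P i) br z (F i).
Proof. by elim/big_rec2: _ => [|i _ y _ <-]; rewrite ?br0r ?brDr. Qed.
Lemma brC x y : br x y = - br y x.
Proof.
apply/eqP; rewrite -addr_eq0; apply/eqP; have := brxx (x + y).
by rewrite brDl !brDr !brxx addr0 add0r.
Qed.
Lemma brA x y z : br x (br y z) = br (br x y) z + br y (br x z).
Proof.
case: Lie => _ _ _ /(_ x y z) J; apply/eqP; rewrite -subr_eq0 -J.
by rewrite opprD [br z (br x y)]brC [br z x]brC brNr addrAC addrA addrAC.
Qed.
Lemma brAl x y z : br (br x y) z = br x (br y z) - br y (br x z).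
Proof. by rewrite brA addrK. Qed.

Fact br_semilinear x : semilinear (br x).
Proof. by split=> [a y|y z]; rewrite ?brZr ?brDr. Qed.
Lemma adE x y : ad br x y = br x y.
Proof.
pose L : {linear V -> V} := HB.pack (br x) (GRing.isSemilinear.Build C V V _ (br x) (br_semilinear x)).
exact: (lfunE L).
Qed.
Lemma iter_ad n x y : iter n (ad br x) y = iter n (br x) y.
Proof. by elim: n => //= n ->; rewrite adE. Qed.

Lemma mem_zc x y : (y \in zc br x) = (br x y == 0).
Proof. by rewrite memv_ker adE. Qed.
Lemma mem_zcC x y : (y \in zc br x) = (br y x == 0).
Proof. by rewrite mem_zc brC oppr_eq0. Qed.

(** * The Killing form *)

Definition kap x y := etr (ad br x \o ad br y)%VF.

Lemma adP a x y : ad br (a *: x + y) = a *: ad br x + ad br y.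
Proof. by apply/lfunP => v; rewrite add_lfunE scale_lfunE !adE brP. Qed.
Lemma ad_br x y : ad br (br x y) = (ad br x \o ad br y)%VF - (ad br y \o ad br x)%VF.
Proof. by apply/lfunP => v; rewrite add_lfunE opp_lfunE !comp_lfunE !adE brAl. Qed.

Lemma kapC x y : kap x y = kap y x.
Proof. exact: etrC. Qed.
Lemma kapP a x y z : kap (a *: x + y) z = a * kap x z + kap y z.
Proof. by rewrite /kap adP comp_lfunDl -comp_lfunZl etrD etrZ. Qed.
Lemma kapDl x y z : kap (x + y) z = kap x z + kap y z.
Proof. by rewrite -[x in LHS]scale1r kapP mul1r. Qed.
Lemma kap0l z : kap 0 z = 0.
Proof. by have := kapP (-1) 0 0 z; rewrite scaler0 addr0 mulN1r addNr. Qed.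
Lemma kapZl a x z : kap (a *: x) z = a * kap x z.
Proof. by rewrite -[a *: x]addr0 kapP kap0l addr0. Qed.
Lemma kapNl x z : kap (- x) z = - kap x z.
Proof. by rewrite -scaleN1r kapZl mulN1r. Qed.
Lemma kap0r z : kap z 0 = 0. Proof. by rewrite kapC kap0l. Qed.
Lemma kapDr x y z : kap z (x + y) = kap z x + kap z y.
Proof. by rewrite !(kapC z) kapDl. Qed.
Lemma kapZr a x z : kap z (a *: x) = a * kap z x.
Proof. by rewrite !(kapC z) kapZl. Qed.
Lemma kapNr x z : kap z (- x) = - kap z x.
Proof. by rewrite !(kapC z) kapNl. Qed.
Lemma kapBl x y z : kap (x - y) z = kap x z - kap y z.
Proof. by rewrite kapDl kapNl. Qed.
Lemma kapBr x y z : kap z (x - y) = kap z x - kap z y.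
Proof. by rewrite kapDr kapNr. Qed.
Lemma kap_suml I (r : seq I) (P : pred I) F z :
  kap (\sum_(i <- r | P i) F i) z = \sum_(i <- r | P i) kap (F i) z.
Proof. by elim/big_rec2: _ => [|i _ y _ <-]; rewrite ?kap0l ?kapDl. Qed.
Lemma kap_sumr I (r : seq I) (P : pred I) F z :
  kap z (\sum_(i <- r | P i) F i) = \sum_(i <- r | P i) kap z (F i).
Proof. by elim/big_rec2: _ => [|i _ y _ <-]; rewrite ?kap0r ?kapDr. Qed.
Lemma etrB (f g : 'End(V)) : etr (f - g) = etr f - etr g.
Proof. by rewrite -scaleN1r etrD etrZ mulN1r. Qed.
Lemma kap_inv x y z : kap (br x y) z = kap x (br y z).
Proof.
rewrite /kap !ad_br comp_lfunDl comp_lfunDr comp_lfunNl comp_lfunNr !etrB.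
by rewrite !comp_lfunA; congr (_ - _); rewrite -!comp_lfunA etrC comp_lfunA.
Qed.

Definition adnil x := forall a v, v != 0 -> br x v = a *: v -> a = 0.

Lemma adnilP x : adnil x <-> ad_nilpotent br x.
Proof.
split=> [nx|[n nx] a v v0 xv].
  exists (\dim {:V}) => y _; rewrite -iter_ad.
  apply: (nilpotent_in (W := fullv)) => [v _|a v _ v0|]; rewrite ?memvf // adE; exact: nx.
apply: (@nilpotent_eigen _ _ (ad br x) n a v v0); first by rewrite adE.
by rewrite iter_ad nx ?memvf.
Qed.

Lemma nilp_iter x v : adnil x -> iter (\dim {:V}) (br x) v = 0.
Proof.
move=> nx; rewrite -iter_ad.
apply: (nilpotent_in (W := fullv)) => [w _|a w _ w0|]; rewrite ?memvf // adE; exact: nx.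
Qed.

(** If v is an eigenvector of ad x ad y for a, commutation gives (ad x)^n (ad y)^n v = a^n v, and
    the left side vanishes for n = dim V. *)
Lemma kap_nilp x y : br x y = 0 -> adnil x -> kap x y = 0.
Proof.
move=> xy nx; apply: etr_eq0 => a v v0; rewrite comp_lfunE !adE => fv.
have cm w : br x (br y w) = br y (br x w) by rewrite brA xy br0l add0r.
have E n : iter n (br x) (iter n (br y) v) = a ^+ n *: v.
  elim: n => [|n IHn]; first by rewrite scale1r.
  rewrite iterSr [iter n.+1 (br y) v]iterSr.
  have -> : iter n (br x) (br x (iter n (br y) (br y v))) = iter n (br x) (iter n (br y) (br x (br y v))).
    congr (iter n _ _); elim: n {IHn} => [|n IHn] //=; by rewrite cm IHn.
  rewrite fv.
  have -> : iter n (br y) (a *: v) = a *: iter n (br y) v.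
    by elim: n {IHn} => //= n ->; rewrite brZr.
  have -> : iter n (br x) (a *: iter n (br y) v) = a *: iter n (br x) (iter n (br y) v).
    by move: (iter n (br y) v) => w; elim: n {IHn} => //= n ->; rewrite brZr.
  by rewrite IHn scalerA exprS.
have /eqP := E (\dim {:V}); rewrite nilp_iter // eq_sym scaler_eq0 (negPf v0) orbF.
by rewrite expf_eq0 => /andP[_ /eqP].
Qed.

(** * Generalized eigenspaces of ad *)

Definition G x a : {vspace V} := geig (ad br x) a.
Definition pr x a : 'End(V) := gproj (ad br x) a.

Lemma memv_pr x a v : pr x a v \in G x a. Proof. exact: memv_gproj. Qed.
Lemma pr_id x a v : v \in G x a -> pr x a v = v. Proof. exact: gproj_id. Qed.
Lemma pr_diff x a b v : a != b -> v \in G x b -> pr x a v = 0. Proof. exact: gproj_diff. Qed.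
Lemma pr_sum x v : v = \sum_(a <- spec (ad br x)) pr x a v. Proof. exact: gproj_sum. Qed.
Lemma pr_stable x a W : (forall v, v \in W -> br x v \in W) -> forall v, v \in W -> pr x a v \in W.
Proof. by move=> xW v Wv; apply: gproj_stable => // u Wu; rewrite adE xW. Qed.
Lemma pr_comm x y a v : br x y = 0 -> pr x a (br y v) = br y (pr x a v).
Proof.
move=> xy; rewrite -!adE; apply: gproj_comm => w.
by rewrite !adE brA xy br0l add0r.
Qed.
Lemma eigG x a v : br x v = a *: v -> v \in G x a.
Proof. by move=> xv; apply: eigen_geig; rewrite adE. Qed.
Lemma eigG0 x v : br x v = 0 -> v \in G x 0.
Proof. by move=> xv; apply: eigG; rewrite xv scale0r. Qed.
Lemma G_eigen x a b v : v \in G x a -> v != 0 -> br x v = b *: v -> b = a.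
Proof. by move=> va v0 xv; apply: (geig_eigen va v0); rewrite adE. Qed.
Lemma G_stable x a v : v \in G x a -> br x v \in G x a.
Proof. by move=> va; rewrite -adE geig_stable. Qed.
Lemma G0_stable x y a v : br x y = 0 -> v \in G x a -> br y v \in G x a.
Proof. by move=> xy /pr_id <-; rewrite -pr_comm // memv_pr. Qed.

(** By the Leibniz rule x - (a + b) acts on [u, v] as x - a on u plus x - b on v; the induction in
    [key] is on a bound for the sum of the two exponents. *)
Lemma brG x a b u v : u \in G x a -> v \in G x b -> br u v \in G x (a + b).
Proof.
rewrite !mem_geig.
have key m : forall i j u v, (i + j <= m)%N -> pact (ad br x) (('X - a%:P) ^+ i) u = 0 ->
    pact (ad br x) (('X - b%:P) ^+ j) v = 0 ->
    pact (ad br x) (('X - (a + b)%:P) ^+ m) (br u v) = 0.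
  elim: m => [|m IHm] i j {}u {}v.
    rewrite leqn0 addn_eq0 => /andP[/eqP -> /eqP ->]; rewrite !expr0 -polyC1 !pactC !scale1r.
    by move=> ->; rewrite br0l.
  move=> ijm ui vj; rewrite exprSr pactM pactXsubC adE.
  have -> : br x (br u v) - (a + b) *: br u v = br (br x u - a *: u) v + br u (br x v - b *: v).
    rewrite brA brBl brBr brZl brZr scalerDl opprD.
    by rewrite addrACA.
  rewrite linearD /=.
  case: i ijm ui => [|i] ijm ui.
    move: ui; rewrite expr0 -polyC1 pactC scale1r => ->.
    by rewrite br0r scaler0 subr0 !br0l linear0 addr0.
  case: j ijm vj => [|j] ijm vj.
    move: vj; rewrite expr0 -polyC1 pactC scale1r => ->.
    by rewrite br0r scaler0 subr0 !br0r linear0 addr0.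
  have -> : pact (ad br x) (('X - (a + b)%:P) ^+ m) (br (br x u - a *: u) v) = 0.
    apply: (IHm i j.+1) => //.
    by rewrite -adE -pactXsubC -pactM -exprSr.
  rewrite add0r.
  apply: (IHm i.+1 j) => //; first by rewrite -ltnS -addnS.
  by rewrite -adE -pactXsubC -pactM -exprSr.
move=> /eqP ua /eqP vb; rewrite -mem_geig; apply: geigP; apply: (key _ _ _ u v (leqnn _) ua vb).
Qed.

(* The derivation acting on the generalized eigenspace of [a] as the conjugate of [a]. *)
Definition dbar x : 'End(V) := \sum_(a <- spec (ad br x)) a^* *: pr x a.

Lemma dbarG x a v : v \in G x a -> dbar x v = a^* *: v.
Proof.
move=> va; rewrite sum_lfunE; have [sa|sa] := boolP (a \in spec (ad br x)).
  rewrite (bigD1_seq a) ?undup_uniq //= scale_lfunE pr_id // big1 ?addr0 // => b ba.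
  by rewrite scale_lfunE (pr_diff ba) ?scaler0.
have -> : v = 0 by apply: (geig_notin sa).
by rewrite scaler0 big1 // => b _; rewrite linear0.
Qed.

Lemma dbar_br x u v : dbar x (br u v) = br (dbar x u) v + br u (dbar x v).
Proof.
rewrite [u](pr_sum x) [v](pr_sum x); set s := spec _.
rewrite br_suml !linear_sum !br_suml -big_split /=; apply: eq_bigr => a _.
rewrite !br_sumr linear_sum -big_split /=; apply: eq_bigr => b _.
have ua := memv_pr x a u; have vb := memv_pr x b v.
by rewrite (dbarG (brG ua vb)) (dbarG ua) (dbarG vb) brZl brZr rmorphD scalerDl.
Qed.

Lemma dbar0 x v : br x v = 0 -> dbar x v = 0.
Proof. by move=> /eigG0/dbarG ->; rewrite conjC0 scale0r. Qed.

(** Since [dbar x] is a derivation, ad of [dbar x u] is the commutator of [dbar x] with ad u; the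
    rest is cyclicity of the trace. *)
Lemma etr_dbar x u v : etr (dbar x \o ad br (br u v))%VF = kap (dbar x u) v.
Proof.
have dE w : ad br (dbar x w) = (dbar x \o ad br w)%VF - (ad br w \o dbar x)%VF.
  by apply/lfunP => t; rewrite add_lfunE opp_lfunE !comp_lfunE !adE dbar_br addrK.
rewrite /kap dE ad_br comp_lfunDr comp_lfunDl comp_lfunNr comp_lfunNl !etrB !comp_lfunA.
by congr (_ - _); rewrite [LHS]etrC comp_lfunA.
Qed.

Lemma ad_sum I (r : seq I) (P : pred I) F :
  ad br (\sum_(i <- r | P i) F i) = \sum_(i <- r | P i) ad br (F i).
Proof. by apply/lfunP => v; rewrite sum_lfunE adE br_suml; apply: eq_bigr => i _; rewrite adE. Qed.

Lemma dbar_pr x a v : dbar x (pr x a v) = pr x a (dbar x v).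
Proof.
rewrite [v](pr_sum x) !linear_sum; apply: eq_bigr => b _ /=.
have vb := memv_pr x b v; rewrite (dbarG vb) linearZ /=.
have [ab|ab] := eqVneq a b; last by rewrite (pr_diff ab vb) linear0 scaler0.
by subst b; rewrite (pr_id vb) (dbarG vb).
Qed.

(* The trace of [dbar x] against [ad x] is the sum of the squared moduli of the
   eigenvalues of [ad x]. *)
Lemma nilp_trace x : etr (dbar x \o ad br x)%VF = 0 -> adnil x.
Proof.
move=> tr0.
have ev mu v : v != 0 -> (dbar x \o ad br x)%VF v = mu *: v -> exists a, mu = a^* * a.
  move=> v0 fv; have [a pa] := gproj_neq0 (ad br x) v0.
  exists a; move: (memv_pr x a v) => ua.
  have fu : a^* *: br x (pr x a v) = mu *: pr x a v.
    rewrite -(dbarG (G_stable ua)) -linearZ /= -fv comp_lfunE adE.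
    by rewrite -pr_comm ?brxx // dbar_pr.
  have [a0|a0] := eqVneq a 0.
    move: fu; rewrite a0 conjC0 scale0r mul0r => /esym/eqP; rewrite scaler_eq0 -a0.
    by rewrite -/(pr x a) in pa; rewrite (negPf pa) orbF => /eqP.
  have xu : br x (pr x a v) = ((a^*)^-1 * mu) *: pr x a v.
    by rewrite -scalerA -fu scalerA mulVf ?conjC_eq0 // scale1r.
  by rewrite -{2}(G_eigen ua pa xu) mulrA divff ?mul1r // conjC_eq0.
have f0 : forall mu v, v != 0 -> (dbar x \o ad br x)%VF v = mu *: v -> 0 <= mu.
  by move=> mu v v0 /(ev _ _ v0)[a ->]; rewrite mulrC mul_conjC_ge0.
move=> a v v0 xv; apply/eqP; rewrite -mul_conjC_eq0 mulrC; apply/eqP.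
apply: (etr_ge0_eq0 f0 tr0 v0).
by rewrite comp_lfunE adE xv linearZ /= (dbarG (eigG xv)) scalerA mulrC.
Qed.

(** Cartan's criterion: the sum of the squared moduli of the eigenvalues of ad x equals the sum of
    the [kap (dbar x p.1) p.2]. It applies when [dbar x] kills the p.1, or when the p.2 are
    orthogonal to everything. *)
Lemma nilp_brackets x (r : seq (V * V)) : x = \sum_(p <- r) br p.1 p.2 ->
  (forall p, p \in r -> kap (dbar x p.1) p.2 = 0) -> adnil x.
Proof.
move=> xE r0; apply: nilp_trace; rewrite [in ad br _]xE ad_sum.
have -> : (dbar x \o \sum_(p <- r) ad br (br p.1 p.2))%VF = \sum_(p <- r) (dbar x \o ad br (br p.1 p.2))%VF.
  by elim/big_rec2: _ => [|p f g _ <-]; rewrite ?comp_lfun0r ?comp_lfunDr.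
have -> : etr (\sum_(p <- r) (dbar x \o ad br (br p.1 p.2))%VF) = \sum_(p <- r) etr (dbar x \o ad br (br p.1 p.2))%VF.
  elim/big_rec2: _ => [|p _ f _ <-]; last by rewrite etrD.
  by rewrite -[0 in LHS](scale0r 0) etrZ mul0r.
by rewrite big_seq big1 // => p rp; rewrite etr_dbar r0.
Qed.

(** * Derived subspaces and Engel's theorem *)

Lemma mem_derived S x y : x \in S -> y \in S -> br x y \in derived br S.
Proof.
move=> Sx Sy; rewrite (coord_vbasis Sx) (coord_vbasis Sy) br_suml memv_suml // => i _.
rewrite br_sumr memv_suml // => j _; rewrite brZl brZr !memvZ // memv_span //.
by apply/allpairsP; exists ((vbasis S)`_i, (vbasis S)`_j); rewrite !mem_nth ?size_tuple.
Qed.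

Lemma derived_subP S U : (derived br S <= U)%VS <-> (forall x y, x \in S -> y \in S -> br x y \in U).
Proof.
split=> [sSU x y Sx Sy|SU]; first exact/(subvP sSU)/mem_derived.
by apply/span_subvP => _ /allpairsP[[x y] /= [Sx Sy ->]]; apply: SU; apply: vbasis_mem.
Qed.

Lemma derived_sum S x : x \in derived br S ->
  exists2 r : seq (V * V), x = \sum_(p <- r) br p.1 p.2 & forall p, p \in r -> p.1 \in S /\ p.2 \in S.
Proof.
rewrite /derived; set X := [seq _ | _ <- _, _ <- _].
have : {subset X <= [pred z | [exists p : 'I_(\dim S) * 'I_(\dim S), z == br (vbasis S)`_p.1 (vbasis S)`_p.2]]}.
  move=> _ /allpairsP[[u v] /= [Su Sv ->]]; apply/existsP.
  have iu : (index u (vbasis S) < \dim S)%N by rewrite -[X in (_ < X)%N](size_tuple (vbasis S)) index_mem.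
  have iv : (index v (vbasis S) < \dim S)%N by rewrite -[X in (_ < X)%N](size_tuple (vbasis S)) index_mem.
  by exists (Ordinal iu, Ordinal iv); rewrite /= !nth_index.
elim: X x => [|z X IHX] x XS.
  by rewrite span_nil memv0 => /eqP ->; exists [::]; rewrite ?big_nil.
rewrite span_cons => /memv_addP[_ /vlineP[c ->] [y Xy ->]].
have [|r yr rS] := IHX y _ Xy; first by move=> t Xt; apply: XS; rewrite inE Xt orbT.
have /existsP[[i j] /= /eqP zE] := XS z (mem_head _ _).
have Si (k : 'I_(\dim S)) : (vbasis S)`_k \in S by rewrite vbasis_mem ?mem_nth ?size_tuple.
exists ((c *: (vbasis S)`_i, (vbasis S)`_j) :: r); first by rewrite big_cons /= brZl -zE yr.
by move=> p; rewrite inE => /orP[/eqP -> /=|/rS //]; rewrite memvZ.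
Qed.

Definition subalg S := forall x y, x \in S -> y \in S -> br x y \in S.
Definition stable A M := forall x m, x \in A -> m \in M -> br x m \in M.

Lemma dim_addl U v : v \notin U -> \dim (U + <[v]>) = (\dim U).+1.
Proof.
move=> Uv; have v0 : v != 0 by apply: contraNneq Uv => ->; rewrite mem0v.
rewrite dimv_disjoint_sum ?dim_vline ?v0 ?addn1 //.
apply/eqP; rewrite -subv0; apply/subvP => w /memv_capP[Uw /vlineP[c wE]].
have [c0|c0] := eqVneq c 0; first by rewrite wE c0 scale0r mem0v.
by case/negP: Uv; rewrite -[v](scalerK c0) -wE memvZ.
Qed.

Lemma exists_outside U W : (W <= U)%VS -> W != U -> exists2 v, v \in U & v \notin W.
Proof.
move=> WU neWU; apply/subvPn; apply: contra neWU => UW.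
by rewrite eqEsubv WU UW.
Qed.

(* Engel's theorem relative to a proper stable subspace, by induction on the dimension of [K]:
   the induction hypothesis, applied to a subalgebra acting on [K] modulo itself, enlarges
   that subalgebra one dimension at a time. *)
Lemma engel_rel n K N M M' : (\dim K <= n)%N -> subalg K -> (K <= N)%VS -> (M <= N)%VS ->
  (forall x v, x \in K -> v \in N -> exists m, iter m (br x) v = 0) ->
  stable K M -> stable K M' -> (M' <= M)%VS -> M' != M ->
  exists2 v, v \in M & v \notin M' /\ forall x, x \in K -> br x v \in M'.
Proof.
elim: n K N M M' => [|n IHn] K N M M'.
  rewrite leqn0 dimv_eq0 => /eqP -> _ _ _ _ _ _ M'M neM.
  have [v Mv M'v] := exists_outside M'M neM; exists v => //; split=> // x.
  by rewrite memv0 => /eqP ->; rewrite br0l mem0v.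
move=> dK algK KN MN nil stM stM' M'M neM.
have step H : (H <= K)%VS -> subalg H -> (\dim H < \dim K)%N ->
    exists2 z, z \in K & z \notin H /\ forall x, x \in H -> br x z \in H.
  move=> HK algH dH; have HxK x : x \in H -> x \in K by move/(subvP HK).
  apply: (IHn H N K H) => //.
  - by rewrite -ltnS (leq_trans dH).
  - exact: subv_trans HK KN.
  - by move=> x v Hx; apply: nil; apply: HxK.
  - by move=> x m Hx; apply: algK; apply: HxK.
  - by apply: contraTneq dH => ->; rewrite ltnn.
have chain d : (d < \dim K)%N -> exists2 H, (H <= K)%VS & subalg H /\ \dim H = d.
  elim: d => [|d IHd] dK'.
    exists 0%VS; first exact: sub0v; rewrite dimv0; split=> // x y.
    by rewrite memv0 => /eqP ->; rewrite br0l mem0v.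
  have [H HK [algH dH]] := IHd (ltnW dK').
  have [|z Kz [Hz zH]] := step H HK algH; first by rewrite dH ltnW.
  exists (H + <[z]>)%VS; first by rewrite subv_add HK -memvE.
  rewrite dim_addl // dH; split=> // x0 y0 /memv_addP[x1 Hx1 [_ /vlineP[c ->] ->]].
  move=> /memv_addP[y1 Hy1 [_ /vlineP[c' ->] ->]].
  rewrite brDl !brDr !brZl !brZr brxx !scaler0 addr0 (subvP (addvSl _ _)) //.
  rewrite [br z y1]brC scalerN; apply: memvB; last by apply: memvZ; apply: zH.
  by apply: memvD; [apply: algH | apply: memvZ; apply: zH].
have [K0|K0] := posnP (\dim K).
  by apply: (IHn K N M M') => //; rewrite K0.
have [H HK [algH dH]] : exists2 H, (H <= K)%VS & subalg H /\ \dim H = (\dim K).-1.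
  by apply: chain; rewrite prednK.
have dHK : (\dim H < \dim K)%N by rewrite dH prednK.
have [z Kz [Hz zH]] := step H HK algH dHK.
have KE : (H + <[z]>)%VS = K.
  apply/eqP; rewrite eqEdim subv_add HK -memvE Kz /=.
  by rewrite dim_addl // dH prednK.
have HxK x : x \in H -> x \in K by move/(subvP HK).
have [||||v0 Mv0 [M'v0 v0H]] := IHn H N M M' _ algH (subv_trans HK KN) MN _ _ _ M'M neM.
- by rewrite dH -ltnS prednK.
- by move=> x v Hx; apply: nil; apply: HxK.
- by move=> x m Hx; apply: stM; apply: HxK.
- by move=> x m Hx; apply: stM'; apply: HxK.
have zM k : iter k (br z) v0 \in M by elim: k => //= k; apply: stM.
have zM' k x : x \in H -> br x (iter k (br z) v0) \in M'.
  elim: k x => [|k IHk] x Hx /=; first exact: v0H.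
  rewrite brA; apply: memvD; first by apply: IHk; apply: zH.
  by apply: stM' => //; apply: IHk.
have [m zm] := nil z v0 Kz (subvP MN _ Mv0).
have: iter m (br z) v0 \in M' by rewrite zm mem0v.
elim: m {zm} => [|m IHm] zm; first by rewrite (negPf M'v0) in zm.
have [/IHm //|M'm] := boolP (iter m (br z) v0 \in M').
exists (iter m (br z) v0) => //; split=> // x; rewrite -KE.
move=> /memv_addP[x1 Hx1 [_ /vlineP[c ->] ->]].
rewrite brDl brZl; apply: memvD; first exact: zM'.
by apply: memvZ; rewrite -iterS.
Qed.

Lemma engel_fixed K N M : subalg K -> (K <= N)%VS -> (M <= N)%VS ->
  (forall x v, x \in K -> v \in N -> exists m, iter m (br x) v = 0) ->
  stable K M -> M != 0%VS -> exists v, [/\ v \in M, v != 0 & forall x, x \in K -> br x v = 0].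
Proof.
move=> algK KN MN nil stM M0.
have [||v Mv [v0 Kv]] := engel_rel (leqnn _) algK KN MN nil stM _ (sub0v M).
- by move=> x m _; rewrite memv0 => /eqP ->; rewrite br0r mem0v.
- by rewrite eq_sym.
exists v; split; rewrite // -1?memv0 // => x /Kv.
by rewrite memv0 => /eqP.
Qed.

(** The relative form of Engel's theorem builds stable subspaces of every dimension up to
    codimension one; one further vector v with [K, v] in M then shows that [K, K] lies in the
    hyperplane M. *)
Lemma engel_derived K : subalg K -> (forall x, x \in K -> adnil x) -> K != 0%VS -> derived br K != K.
Proof.
move=> algK nil K0.
have nilK x v : x \in K -> v \in fullv -> exists m, iter m (br x) v = 0.
  by move=> /nil nx _; exists (\dim {:V}); rewrite nilp_iter.
have step M : (M <= K)%VS -> stable K M -> M != K ->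
    exists2 v, v \in K & v \notin M /\ forall x, x \in K -> br x v \in M.
  by move=> MK stM; apply: (engel_rel (leqnn _) algK (subvf _) (subvf _) nilK algK stM MK).
have [M MK [stM dM]] : exists2 M, (M <= K)%VS & stable K M /\ \dim M = (\dim K).-1.
  have: ((\dim K).-1 < \dim K)%N by rewrite prednK // lt0n dimv_eq0.
  elim: (_.-1) => [|d IHd] dK.
    exists 0%VS; first exact: sub0v; rewrite dimv0; split=> // x m _.
    by rewrite memv0 => /eqP ->; rewrite br0r mem0v.
  have [M MK [stM dM]] := IHd (ltnW dK).
  have [|v Kv [Mv vM]] := step M MK stM; first by apply: contraTneq dK => MKe; rewrite -MKe dM -leqNgt.
  exists (M + <[v]>)%VS; first by rewrite subv_add MK -memvE.
  rewrite dim_addl // dM; split=> // x m0 Kx /memv_addP[m1 Mm [_ /vlineP[c ->] ->]].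
  rewrite brDr brZr (subvP (addvSl _ _)) //.
  by apply: memvD; [apply: stM | apply: memvZ; apply: vM].
have dMK : (\dim M < \dim K)%N by rewrite dM prednK // lt0n dimv_eq0.
have [|v Kv [Mv vM]] := step M MK stM; first by apply: contraTneq dMK => ->; rewrite ltnn.
have KE : (M + <[v]>)%VS = K.
  apply/eqP; rewrite eqEdim subv_add MK -memvE Kv /=.
  by rewrite dim_addl // dM prednK // lt0n dimv_eq0.
have: (derived br K <= M)%VS.
  apply/derived_subP => x y Kx; rewrite -KE => /memv_addP[m1 Mm [_ /vlineP[c ->] ->]].
  by rewrite brDr brZr; apply: memvD; [apply: stM | apply: memvZ; apply: vM].
move=> dKM; apply: contraTneq dMK => dKE; rewrite -leqNgt.
by apply: dimvS; rewrite -[X in (X <= _)%VS]dKE.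
Qed.

(** * Orthogonality for the Killing form *)

Fact kap_linear u : semilinear (fun x => kap x u : C^o).
Proof. by split=> [a x|x y]; rewrite ?kapZl ?kapDl. Qed.

Definition kapf u : 'Hom(V, C^o) := linfun (HB.pack_for {linear V -> C^o} (fun x => kap x u : C^o)
  (GRing.isSemilinear.Build C V C^o _ _ (kap_linear u))).

Lemma kapfE u x : kapf u x = kap x u.
Proof. by rewrite lfunE. Qed.

Definition perp U : {vspace V} := (\bigcap_(i < \dim U) lker (kapf (vbasis U)`_i))%VS.

Lemma memv_perp U x : reflect (forall u, u \in U -> kap x u = 0) (x \in perp U).
Proof.
apply: (iffP idP) => [xU u Uu|xU].
  rewrite (coord_vbasis Uu) kap_sumr big1 // => i _.
  have /subv_bigcapP/(_ i isT) : (<[x]> <= perp U)%VS by rewrite -memvE.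
  by rewrite -memvE memv_ker kapfE kapZr => /eqP ->; rewrite mulr0.
rewrite memvE; apply/subv_bigcapP => i _; rewrite -memvE memv_ker kapfE xU //.
by rewrite vbasis_mem ?mem_nth ?size_tuple.
Qed.

(** The pairing embeds [A] into the dual of [B], here the row vectors of values on a basis. *)
Lemma dim_pairing A B : (forall x, x \in A -> (forall y, y \in B -> kap x y = 0) -> x = 0) ->
  (\dim A <= \dim B)%N.
Proof.
move=> ndg.
have lin : semilinear (fun x => \row_(i < \dim B) kap x (vbasis B)`_i).
  by split=> [a x|x y]; apply/rowP => i; rewrite !mxE ?kapZl ?kapDl.
pose L0 : {linear V -> 'rV[C]_(\dim B)} :=
  HB.pack (fun x => \row_(i < \dim B) kap x (vbasis B)`_i) (GRing.isSemilinear.Build C V _ _ _ lin).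
pose L := linfun L0.
have LE x : L x = \row_(i < \dim B) kap x (vbasis B)`_i by rewrite lfunE.
rewrite -(@limg_dim_eq _ _ _ L).
  by rewrite (leq_trans (dimvS (subvf _))) // dimvf dim_matrix mul1r.
apply/eqP; rewrite -subv0; apply/subvP => x /memv_capP[Ax]; rewrite memv_ker LE memv0 => /eqP Lx.
apply/eqP/ndg => // y By; rewrite (coord_vbasis By) kap_sumr big1 // => i _.
by have /rowP/(_ i) := Lx; rewrite !mxE kapZr => ->; rewrite mulr0.
Qed.

Definition ndg S := forall x, x \in S -> (forall y, y \in S -> kap x y = 0) -> x = 0.

(** Two pairings bound the dimension of the double orthogonal of [U] by that of [U]. Phrased as a
    membership test, this turns existence of a decomposition or of a preimage into a vanishing
    statement about orthogonal vectors. *)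
Lemma double_perp S U x : ndg S -> (U <= S)%VS -> x \in S ->
  (forall w, w \in S -> (forall u, u \in U -> kap w u = 0) -> kap w x = 0) -> x \in U.
Proof.
move=> nS US Sx xU; pose W := (S :&: perp U)%VS.
have dW : (\dim S <= \dim W + \dim U)%N.
  rewrite -(dimv_cap_compl S (perp U)) leq_add2l; apply: dim_pairing => y.
  move=> Dy yU; apply/eqP; rewrite -memv0 -(capv_diff S (perp U)) memv_cap Dy.
  exact/memv_perp.
have dU : (\dim (S :&: perp W) + \dim W <= \dim S)%N.
  rewrite -(dimv_cap_compl S W) [X in (_ <= X)%N]addnC; apply: leq_add; last first.
    by apply: dimvS; rewrite subv_cap subvv capvSl.
  apply: dim_pairing => y /memv_capP[Sy /memv_perp yW] yD; apply: nS => // s.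
  rewrite -(addv_diff_cap S W) => /memv_addP[s1 s1D [s2 /memv_capP[_ s2W] ->]].
  by rewrite kapDr yD ?yW ?addr0.
have UW : (U <= S :&: perp W)%VS.
  rewrite subv_cap US; apply/subvP => u Uu; apply/memv_perp => w /memv_capP[Sw /memv_perp wU].
  by rewrite kapC wU.
have /eqP -> : U == (S :&: perp W)%VS.
  by rewrite eqEdim UW -(leq_add2r (\dim W)) (leq_trans dU) // addnC.
rewrite memv_cap Sx; apply/memv_perp => w /memv_capP[Sw /memv_perp wU].
by rewrite kapC xU.
Qed.

Lemma ideal_derived S : ideal br S -> ideal br (derived br S).
Proof.
move=> idS x y /derived_sum[r -> rS]; rewrite br_sumr big_seq memv_suml // => p /rS[p1 p2].
by rewrite brA memvD // mem_derived // idS.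
Qed.

(** The radical of the Killing form is an ideal whose derived series stops at a perfect term [P].
    Elements of [P] are sums of brackets of vectors orthogonal to everything, hence nilpotent by
    Cartan's criterion, so Engel's theorem forces [P] = 0 and the radical is solvable. *)
Lemma semisimple_ndg : semisimple br -> forall x, (forall y, kap x y = 0) -> x = 0.
Proof.
move=> ss x0 x0V; pose I := perp fullv.
suff I0 : I = 0%VS by apply/eqP; rewrite -memv0 -I0; apply/memv_perp.
have idI : ideal br I.
  move=> x y /memv_perp Iy; apply/memv_perp => z _.
  by rewrite brC kapNl kap_inv Iy ?oppr0 ?memvf.
have idn n : ideal br (iter n (derived br) I) by elim: n => //= n; apply: ideal_derived.
have decr n : (iter n.+1 (derived br) I <= iter n (derived br) I)%VS.
  by rewrite iterS; apply/derived_subP => x y _; apply: idn.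
have [n nE] : exists n, iter n.+1 (derived br) I = iter n (derived br) I.
  have dimle n : (\dim (iter n (derived br) I) + n <= \dim I)%N \/ exists m, iter m.+1 (derived br) I = iter m (derived br) I.
    elim: n => [|n [IHn|]]; [by left; rewrite addn0| |by right].
    have [E|/eqP E] := eqVneq (iter n.+1 (derived br) I) (iter n (derived br) I); first by right; exists n.
    left; apply: leq_trans IHn; rewrite addnS ltn_add2r ltn_neqAle dimvS // andbT.
    by apply/negP => /eqP d; apply: E; apply/eqP; rewrite eqEdim decr d /=.
  have [d|//] := dimle (\dim I).+1.
  by move: d; rewrite addnS ltnNge leq_addl.
apply: (ss I idI); exists n; set P := iter n (derived br) I in nE *.
have PI : (P <= I)%VS by rewrite /P; elim: n {nE} @P => //= n IHn; apply: subv_trans (decr n) IHn.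
have dP : derived br P = P by [].
apply/eqP/negPn/negP => P0; have : derived br P != P; last by rewrite dP eqxx.
apply: engel_derived => // [x y _ Py|x Px]; first exact: idn.
have [r xE rP] : exists2 r : seq (V * V), x = \sum_(p <- r) br p.1 p.2 & forall p, p \in r -> p.1 \in P /\ p.2 \in P.
  by apply: derived_sum; rewrite dP.
apply: (nilp_brackets xE) => p /rP[_ p2]; rewrite kapC.
by apply: (elimT (memv_perp _ _) (subvP PI _ p2)); rewrite memvf.
Qed.

Lemma nilp_central S z : z \in derived br S -> (forall x, x \in S -> br z x = 0) -> adnil z.
Proof.
move=> /derived_sum[r zE rS] zS; apply: (nilp_brackets zE) => p /rS[p1 _].
by rewrite dbar0 ?kap0l // zS.
Qed.

(** Otherwise Engel's theorem gives a nonzero central element inside the derived algebra. It is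
    ad-nilpotent on all of [V] and commutes with [S], hence is orthogonal to [S]. *)
Lemma abelian_of_nilpotent S : subalg S -> ndg S ->
  (forall x y, x \in S -> y \in S -> exists m, iter m (br x) y = 0) ->
  forall x y, x \in S -> y \in S -> br x y = 0.
Proof.
move=> algS nS nil x y Sx Sy.
suff S0 : derived br S = 0%VS by apply/eqP; rewrite -memv0 -S0 mem_derived.
apply/eqP/negPn/negP => S0.
have dS : (derived br S <= S)%VS by apply/derived_subP.
have [|v [dv v0 Sv]] := engel_fixed algS (subvv S) dS nil _ S0.
  by move=> u w Su dw; apply: mem_derived => //; apply: (subvP dS).
have vS u : u \in S -> br v u = 0 by move=> Su; rewrite brC Sv ?oppr0.
move: v0; rewrite (nS v) ?eqxx ?(subvP dS) // => u Su.
by rewrite kap_nilp // ?vS //; apply: nilp_central dv vS.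
Qed.

(** * Weight shifts and elements with integral spectrum *)

Lemma pr_shift y x a b v : x \in G y a -> br x (pr y b v) = pr y (a + b) (br x v).
Proof.
move=> xa; rewrite [v in RHS](pr_sum y) br_sumr linear_sum.
have term c : pr y (a + b) (br x (pr y c v)) = if c == b then br x (pr y b v) else 0.
  have xc := brG xa (memv_pr y c v).
  have [cb|cb] := eqVneq c b; first by subst c; rewrite (pr_id xc).
  by rewrite (pr_diff _ xc) // (inj_eq (addrI a)) eq_sym.
rewrite [RHS](eq_bigr _ (fun c _ => term c)).
rewrite -big_mkcond; have [sb|sb] := boolP (b \in spec (ad br y)).
  by rewrite -big_filter filter_pred1_uniq ?undup_uniq // big_seq1.
have -> : pr y b v = 0 by apply: (geig_notin sb); apply: memv_gproj.
by rewrite br0r big1_seq // => c /andP[/eqP ->].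
Qed.

Lemma not_injective_spec (f : 'End(V)) (g : nat -> C) : injective g -> ~ forall k, g k \in spec f.
Proof.
move=> ginj gs; have: {subset map g (iota 0 (size (spec f)).+1) <= spec f}.
  by move=> _ /mapP[k _ ->].
move/uniq_leq_size; rewrite map_inj_uniq // iota_uniq size_map size_iota => /(_ isT).
by rewrite ltnn.
Qed.

Lemma pr_spec y a v : pr y a v != 0 -> a \in spec (ad br y).
Proof. by apply: contraNT => sa; apply/eqP/(geig_notin sa); apply: memv_gproj. Qed.

(** If b were nonzero, a nonzero component of v at c would force nonzero components at c - a, c -
    2a, and so on: infinitely many eigenvalues of ad y. *)
Lemma shift_eigen y (f : 'End(V)) a b v : (forall c w, f (pr y c w) = pr y (a + c) (f w)) ->
  a != 0 -> v != 0 -> f v = b *: v -> b = 0.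
Proof.
move=> fa a0 v0 fv; apply/eqP/negPn/negP => b0.
have [c vc] := gproj_neq0 (ad br y) v0.
apply: (@not_injective_spec (ad br y) (fun k => c - k%:R * a)) => [k l /addrI/oppr_inj/(mulIf a0)/eqP|k].
  by rewrite eqr_nat => /eqP.
apply: (@pr_spec y _ v); elim: k => [|k IHk]; first by rewrite mul0r subr0.
apply: contraNneq IHk => vk; apply/eqP.
have := fa (c - k.+1%:R * a) v; rewrite vk linear0 fv linearZ /=.
have -> : a + (c - k.+1%:R * a) = c - k%:R * a by rewrite -natr1; ring.
by move/esym/eqP; rewrite scaler_eq0 (negPf b0) => /eqP.
Qed.

Lemma adnil_shift y x a : x \in G y a -> a != 0 -> adnil x.
Proof.
move=> xa a0 b v v0 xv; apply: (shift_eigen (y := y) (f := ad br x) (a := a) _ a0 v0); last by rewrite adE.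
by move=> c w; rewrite !adE; apply: pr_shift.
Qed.

Lemma kapG y a b u v : u \in G y a -> v \in G y b -> a + b != 0 -> kap u v = 0.
Proof.
move=> ua vb ab; apply: etr_eq0 => c w w0; apply: (shift_eigen (y := y) _ ab w0) => d t.
by rewrite !comp_lfunE !adE (pr_shift _ _ vb) (pr_shift _ _ ua) addrA.
Qed.

(** [ad h] is diagonalizable with integer eigenvalues; diagonalizability is expressed by generalized
    eigenvectors being eigenvectors. Such elements stand for the one-parameter subgroups of tori. *)
Definition integral h := forall a v, v \in G h a -> v != 0 ->
  (exists j : int, a = j%:~R) /\ br h v = a *: v.

Lemma integralE h a v : integral h -> v \in G h a -> br h v = a *: v.
Proof.
by move=> hh va; have [->|/(hh a v va)[]//] := eqVneq v 0; rewrite br0r scaler0.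
Qed.

Lemma integral_pr h a v : integral h -> pr h a v != 0 -> exists j : int, a = j%:~R.
Proof. by move=> hh /(hh a _ (memv_pr h a v))[]. Qed.

Lemma grade_integral h i : integral h -> grade br h i = G h i%:~R.
Proof.
move=> hh; apply/vspaceP => v; rewrite memv_ker add_lfunE opp_lfunE scale_lfunE id_lfunE adE.
apply/idP/idP => [|va]; last by rewrite (integralE hh va) subrr.
by rewrite subr_eq0 => /eqP /eigG.
Qed.

Lemma G_neg h a v : v \in G h a -> v \in G (- h) (- a).
Proof.
rewrite mem_geig => /eqP va; apply: (@geigP _ _ _ _ (\dim {:V})).
have key n : pact (ad br (- h)) (('X - (- a)%:P) ^+ n) v = (-1) ^+ n *: pact (ad br h) (('X - a%:P) ^+ n) v.
  elim: n => [|n IHn]; first by rewrite !expr0 -polyC1 !pactC !scale1r.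
  rewrite !exprS !pactM !pactXsubC IHn !adE brNl brZr mulN1r !scaleNr opprK scalerBr opprB.
  by rewrite !scalerA [a * _]mulrC addrC.
by rewrite key va scaler0.
Qed.

Lemma injective_surjective (f : 'End(V)) U : (forall u, u \in U -> f u \in U) ->
  (forall u, u \in U -> f u = 0 -> u = 0) -> forall v, v \in U -> exists2 u, u \in U & f u = v.
Proof.
move=> fU finj v Uv; have fUE : (f @: U)%VS = U.
  apply/eqP; rewrite eqEdim limg_dim_eq ?leqnn ?andbT.
    by apply/subvP => _ /memv_imgP[u Uu ->]; apply: fU.
  apply/eqP; rewrite -subv0; apply/subvP => u /memv_capP[Uu].
  by rewrite memv_ker memv0 => /eqP /(finj u Uu) ->.
by move: Uv; rewrite -{1}fUE => /memv_imgP[u Uu ->]; exists u.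
Qed.

(** * The adjoint action of an sl2-triple *)

Section Raising.
Variables (e h f0 : V).
Hypotheses (he : br h e = 2%:R *: e) (ef : br e f0 = h).

Lemma raising_G : e \in G h 2%:R. Proof. exact: eigG. Qed.

Lemma raising_adnil : adnil e.
Proof. by apply: adnil_shift raising_G _; rewrite pnatr_eq0. Qed.

Lemma br_eh v : br e (br h v) = br h (br e v) - 2%:R *: br e v.
Proof. by rewrite [br h (br e v)]brA he brZl [_ + br e _]addrC addrK. Qed.

(** The basic formula of sl2 theory, derived from [h, e] = 2e and [e, f0] = h alone so that it
    applies before f0 has been corrected to an eigenvector of h. *)
Lemma iter_e_f k v : iter k.+1 (br e) (br f0 v) = br f0 (iter k.+1 (br e) v)
  + k.+1%:R *: (br h (iter k (br e) v) - k%:R *: iter k (br e) v).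
Proof.
have alg (x y w : V) (m : C) :
    y + x + (m + 1) *: (y - 2%:R *: w - m *: w) = x + (m + 1 + 1) *: (y - (m + 1) *: w).
  rewrite [(m + 1 + 1) *: _]scalerDl scale1r -[y - _ - _]addrA -opprD -scalerDl !scalerBr !scalerA.
  rewrite [y + x]addrC -!addrA; congr (x + _); rewrite [LHS]addrCA; congr (_ + _).
  rewrite [RHS]addrCA; congr (y + _); rewrite -opprD -scalerDl; congr (- (_ *: _)); ring.
elim: k => [|k IHk]; first by rewrite /= brA ef scale0r subr0 scale1r addrC.
rewrite iterS IHk brDr brZr brBr brZr br_eh -![br e (iter k _ _)]iterS.
by rewrite [br e (br f0 _)]brA ef -[k.+2%:R]natr1 -[k.+1%:R]natr1 alg.
Qed.

Lemma last_iter v : v != 0 -> exists k, iter k (br e) v != 0 /\ br e (iter k (br e) v) = 0.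
Proof.
move=> v0; have := nilp_iter v raising_adnil; elim: (\dim _) => [/= v0'|n IHn en].
  by rewrite v0' eqxx in v0.
by have [/IHn //|en0] := eqVneq (iter n (br e) v) 0; exists n.
Qed.

Lemma iter_e_G k a v : v \in G h a -> iter k (br e) v \in G h (a + k.*2%:R).
Proof.
move=> va; elim: k => [|k IHk] /=; first by rewrite addr0.
have -> : a + (k.*2).+2%:R = 2%:R + (a + k.*2%:R) by rewrite -2!natr1; ring.
exact: brG raising_G IHk.
Qed.

(** If a is none of 0, ..., dim V - 1, then v = e^k u implies that v is e^(k+1) of a multiple of f0
    u, by [iter_e_f]. So v lies in the image of e^(dim V), which is zero. *)
Lemma ker_eigen_nat a v : br e v = 0 -> v != 0 -> br h v = a *: v -> exists j : nat, a = j%:R.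
Proof.
move=> ev v0 hv.
have [/existsP[j /eqP ->]|] := boolP [exists j : 'I_(\dim {:V}), a == j%:R]; first by exists j.
rewrite negb_exists => /forallP na.
have im k : (k <= \dim {:V})%N -> exists u, v = iter k (br e) u.
  elim: k => [_|k IHk kV]; first by exists v.
  have [u vu] := IHk (ltnW kV); have ak : a != k%:R := na (Ordinal kV).
  exists (((k.+1%:R * (a - k%:R))^-1) *: br f0 u).
  have itZ n c w : iter n (br e) (c *: w) = c *: iter n (br e) w.
    by elim: n => //= n ->; rewrite brZr.
  rewrite itZ iter_e_f iterS -vu ev br0r add0r hv -scalerBl !scalerA -mulrA mulVf ?scale1r //.
  by rewrite mulf_neq0 ?pnatr_eq0 // subr_eq0.
have [u vu] := im _ (leqnn _); move: v0.
by rewrite vu nilp_iter ?eqxx //; apply: raising_adnil.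
Qed.

(** The defect g = [h, f0] + 2 f0 lies in the kernel of e, where h + 2 is invertible since h has
    only natural eigenvalues there. Subtracting the preimage z of g from f0 repairs the triple. *)
Lemma morozov S : subalg S -> e \in S -> h \in S -> f0 \in S -> exists2 f, f \in S & sl2_triple br e h f.
Proof.
move=> algS Se Sh Sf; pose U := (S :&: zc br e)%VS.
pose L := ad br h + 2%:R *: \1%VF.
have LE u : L u = br h u + 2%:R *: u by rewrite add_lfunE scale_lfunE id_lfunE adE.
pose g := br h f0 + 2%:R *: f0.
have Ug : g \in U.
  rewrite memv_cap memvD ?memvZ ?algS //= mem_zc /g brDr brZr ef brA ef brxx addr0.
  by rewrite [br e h]brC he brNl brZl ef addNr.
have [||z /memv_capP[Sz] ] := @injective_surjective L U _ _ g Ug.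
- move=> u /memv_capP[Su]; rewrite mem_zc => /eqP eu; rewrite LE memv_cap memvD ?memvZ ?algS //=.
  by rewrite mem_zc brDr brZr eu br_eh eu !br0r !scaler0 subr0 addr0.
- move=> u /memv_capP[_]; rewrite mem_zc => /eqP eu Lu; apply/eqP/negPn/negP => u0.
  have [|j] := @ker_eigen_nat (- 2%:R) u eu u0.
    by apply/eqP; rewrite -subr_eq0 scaleNr opprK -LE Lu.
  by move/eqP; rewrite eq_sym -subr_eq0 opprK -natrD pnatr_eq0 addn2.
rewrite mem_zc LE => /eqP ez zg.
exists (f0 - z); first by rewrite memvB.
split=> //; last by rewrite brBr ez subr0.
rewrite brBr; apply/eqP; rewrite -subr_eq0 opprK scalerBr addrACA -opprD zg /g.
by rewrite subrr.
Qed.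

End Raising.

Lemma sl2_swap e h f : sl2_triple br e h f -> sl2_triple br f (- h) e.
Proof.
case=> he hf ef; split; first by rewrite brNl hf opprK.
  by rewrite brNl he.
by rewrite brC ef.
Qed.

Section Triple.
Variables (e h f : V).
Hypothesis T : sl2_triple br e h f.

Let he : br h e = 2%:R *: e. Proof. by case: T. Qed.
Let hf : br h f = - (2%:R *: f). Proof. by case: T. Qed.
Let ef : br e f = h. Proof. by case: T. Qed.

Lemma sl2_eG : e \in G h 2%:R. Proof. exact: eigG. Qed.
Lemma sl2_fG : f \in G h (- 2%:R). Proof. by apply: eigG; rewrite hf scaleNr. Qed.
Lemma sl2_e_adnil : adnil e. Proof. exact: raising_adnil he. Qed.

(* [e^(k+1) f] maps the preimage of [v] under [e^k] to [(k+1)(h - k) v], so [h - k] pushes a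
   subspace of [ker e] from the image of [e^k] into that of [e^(k+1)]. *)
Lemma ker_climb a U k : (U <= zc br e :&: G h a)%VS -> (forall u, u \in U -> br h u \in U) ->
  k%:R != a -> (forall v, v \in U -> exists u, v = iter k (br e) u) ->
  forall v, v \in U -> exists u, v = iter k.+1 (br e) u.
Proof.
move=> UX hU ka im v Uv.
pose L := ad br h - k%:R *: \1%VF.
have LE u : L u = br h u - k%:R *: u by rewrite add_lfunE opp_lfunE scale_lfunE id_lfunE adE.
have [||u Uu uv] := @injective_surjective L U _ _ v Uv.
- by move=> u Uu; rewrite LE memvB ?memvZ ?hU.
- move=> u Uu /eqP; rewrite LE subr_eq0 => /eqP hu; apply/eqP/negPn/negP => u0.
  have /memv_capP[_ ua] := subvP UX u Uu.
  by case/negP: ka; rewrite (G_eigen ua u0 hu).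
have [t ut] := im u Uu; exists (k.+1%:R^-1 *: br f t).
have itZ n c w : iter n (br e) (c *: w) = c *: iter n (br e) w.
  by elim: n => //= n ->; rewrite brZr.
have /memv_capP[] := subvP UX u Uu; rewrite mem_zc => /eqP eu _.
by rewrite itZ (iter_e_f he ef) -ut iterS -ut eu br0r add0r scalerA mulVf ?pnatr_eq0 // scale1r -uv LE.
Qed.

Lemma ker_climb0 a U k : (U <= zc br e :&: G h a)%VS -> (forall u, u \in U -> br h u \in U) ->
  (forall l, (k <= l < \dim {:V})%N -> l%:R != a) ->
  (forall v, v \in U -> exists u, v = iter k (br e) u) -> forall v, v \in U -> v = 0.
Proof.
move=> UX hU ka im v Uv.
have imk l : (l + k <= maxn k (\dim {:V}))%N -> forall v, v \in U -> exists u, v = iter (l + k) (br e) u.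
  elim: l => [|l IHl] lk //; apply: (ker_climb UX hU); last by apply/IHl/ltnW.
  apply: ka; rewrite leq_addl /=; move: lk; rewrite leq_max addSn => /orP[|//].
  by rewrite ltnNge leq_addl.
have [|u ->] := imk (\dim {:V} - k)%N _ v Uv; first by rewrite addnC -maxnE.
have -> : (\dim {:V} - k + k = (k - \dim {:V}) + \dim {:V})%N by rewrite addnC -maxnE addnC -maxnE maxnC.
rewrite iterD nilp_iter; last exact: sl2_e_adnil.
by elim: (k - _)%N => //= n ->; rewrite br0r.
Qed.

(** For a = j, climbing puts X inside the image of e^j. At k = j the formula shows that h - j sends
    X into the image of e^(j+1); beyond j nothing stops the climb, so (h - j) X lies in the image of
    e^(dim V) and vanishes. *)
Lemma ker_e_eigen a v : v \in G h a -> br e v = 0 -> br h v = a *: v.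
Proof.
move=> va ev; pose X := (zc br e :&: G h a)%VS.
have hX u : u \in X -> br h u \in X.
  move=> /memv_capP[]; rewrite mem_zc => /eqP eu ua; rewrite memv_cap G_stable // andbT.
  by rewrite mem_zc (br_eh he) eu br0r scaler0 subr0.
have Xv : v \in X by rewrite memv_cap va mem_zc ev eqxx.
have [|] := boolP [exists j : 'I_(\dim {:V}), a == j%:R]; last first.
  rewrite negb_exists => /forallP na.
  rewrite (@ker_climb0 a X 0 _ _ _ _ v Xv) ?br0r ?scaler0 // => [l /= lV|u _]; last by exists u.
  by have := na (Ordinal lV); rewrite /= eq_sym.
move=> /existsP[j /eqP ja].
have im k : (k <= j)%N -> forall v, v \in X -> exists u, v = iter k (br e) u.
  elim: k => [|k IHk] kj u Xu; first by exists u.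
  apply: (ker_climb (subvv X) hX) => //; last exact/IHk/ltnW.
  by rewrite ja eqr_nat ltn_eqF.
pose L := ad br h - a *: \1%VF.
have LE u : L u = br h u - a *: u by rewrite add_lfunE opp_lfunE scale_lfunE id_lfunE adE.
have LX u : u \in X -> L u \in X by move=> Xu; rewrite LE memvB ?memvZ ?hX.
apply/eqP; rewrite -subr_eq0 -LE; apply/eqP.
apply: (@ker_climb0 a (L @: X)%VS j.+1) => [|_ /memv_imgP[u Xu ->]|l /andP[jl _]|_ /memv_imgP[u Xu ->]|].
- by apply/subvP => _ /memv_imgP[u Xu ->]; apply: LX.
- suff -> : br h (L u) = L (br h u) by apply: memv_img; apply: hX.
  by rewrite !LE brBr brZr.
- by rewrite ja eqr_nat gtn_eqF.
- have [t ut] := im j (leqnn j) u Xu; exists (j.+1%:R^-1 *: br f t).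
  have itZ n c w : iter n (br e) (c *: w) = c *: iter n (br e) w.
    by elim: n => //= n ->; rewrite brZr.
  have /memv_capP[] := Xu; rewrite mem_zc => /eqP eu _.
  by rewrite itZ (iter_e_f he ef) -ut iterS -ut eu br0r add0r scalerA mulVf ?pnatr_eq0 // scale1r LE ja.
- exact: memv_img.
Qed.

Lemma ker_e_nat a v : v \in G h a -> br e v = 0 -> v != 0 -> exists j : nat, a = j%:R.
Proof. by move=> va ev v0; apply: (ker_eigen_nat he ef ev v0); apply: ker_e_eigen. Qed.

(** At the last nonzero iterate w = e^k v the formula yields h w = k w, whereas w has weight j + 1 +
    2k. *)
Lemma ef_injective j v : v \in G h j.+1%:R -> br e (br f v) = 0 -> v = 0.
Proof.
move=> va efv; apply/eqP/negPn/negP => v0; have [k [w0 ew]] := last_iter he v0.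
have := iter_e_f he ef k v; rewrite iterSr efv iterS ew br0r add0r.
have -> : iter k (br e) 0 = 0 by elim: (k) => //= n ->; rewrite br0r.
move/esym/eqP; rewrite scaler_eq0 pnatr_eq0 /= subr_eq0 => /eqP hw.
move: (G_eigen (iter_e_G he k va) w0 hw) => /eqP.
by rewrite -natrD eqr_nat -addnn; lia.
Qed.

Lemma ker_iter_eigen k j v : v \in G h j%:R -> iter k (br e) v = 0 -> br h v = j%:R *: v.
Proof.
elim: k j v => [|k IHk] j v vj; first by move=> /= ->; rewrite br0r scaler0.
case: k IHk => [|k] IHk ekv; first exact: ker_e_eigen.
pose u := br h v - j%:R *: v.
have ev : br h (br e v) = (2 + j)%:R *: br e v.
  by apply: IHk; [rewrite natrD; apply: brG => //; apply: sl2_eG | rewrite -iterSr].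
have eu : br e u = 0.
  by rewrite brBr (br_eh he) ev brZr natrD scalerDl -addrA -opprD subrr.
have uj : u \in G h j%:R by rewrite memvB ?memvZ ?G_stable.
have hu := ker_e_eigen uj eu.
(* The eigenvalue of e f at weight j in a string of top weight j + 2(k + 1); subtracting it makes
   e^(k+1) kill [w]. *)
pose c : C := (k.+2 * (j + k.+1))%:R.
pose w := br e (br f v) - c *: v.
have efG x a : x \in G h a -> br e (br f x) \in G h a.
  move=> xa; have := brG sl2_eG (brG sl2_fG xa).
  by rewrite addrA subrr add0r.
have wj : w \in G h j%:R by rewrite memvB ?memvZ ?efG.
have itZ n d t : iter n (br e) (d *: t) = d *: iter n (br e) t.
  by elim: n => //= n ->; rewrite brZr.
have itB n t1 t2 : iter n (br e) (t1 - t2) = iter n (br e) t1 - iter n (br e) t2.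
  by elim: n => //= n ->; rewrite brBr.
have ew : iter k.+1 (br e) w = 0.
  rewrite itB itZ -iterSr (iter_e_f he ef) ekv br0r add0r.
  have -> : br h (iter k.+1 (br e) v) = (j + k.+1.*2)%:R *: iter k.+1 (br e) v.
    by apply: ker_e_eigen; [rewrite natrD; apply: iter_e_G he _ _ _ vj | rewrite -iterS].
  rewrite -scalerBl scalerA -scalerBl -natrB; last by lia.
  by rewrite -natrM /c -natrB; [rewrite (_ : _ - _ = 0)%N ?scale0r //; lia | lia].
have hw := IHk j w wj ew.
have hef : br h (br e (br f v)) = br e (br f (br h v)).
  by rewrite [LHS]brA he brZl [br h (br f v)]brA hf brNl brZl brDr brNr brZr addrA subrr add0r.
have hvE : br h v = u + j%:R *: v by rewrite subrK.
(* h - j kills [w] and commutes with e f, while [u] is (h - j) v. As e u = 0 also gives e f u = h u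
   = j u, and c > j, this forces u = 0. *)
have efu : br e (br f u) = c *: u.
  move: hw; rewrite brBr brZr hef hvE !brDr !brZr scalerBr scalerDr !scalerA [c * _]mulrC.
  rewrite opprD addrACA => /eqP; rewrite -[X in _ == X]add0r (inj_eq (addIr _)) subr_eq0.
  by move/eqP.
have: (c - j%:R) *: u = 0.
  by rewrite scalerBl -efu brA ef eu br0r addr0 hu subrr.
rewrite /c -natrB; last by lia.
move/eqP; rewrite scaler_eq0 pnatr_eq0 => /orP[|]; first by lia.
by rewrite subr_eq0 => /eqP.
Qed.

End Triple.

(** Applying e until the last nonzero iterate lands in the kernel of e, whose weights are natural
    numbers. Weights below zero are treated with the triple {f, -h, e}. *)
Lemma sl2_integral e h f : sl2_triple br e h f -> integral h.
Proof.
move=> T a v va v0; have [he hf ef] := T.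
have [k [w0 ew]] := last_iter he v0.
have [j jE] := ker_e_nat T (iter_e_G he k va) ew w0.
have aE : a = (j%:Z - (k.*2)%:Z)%:~R by rewrite intrD intrN -!pmulrn -jE addrK.
split; first by exists (j%:Z - (k.*2)%:Z).
case: (leqP k.*2 j) => [kj|jk].
  have aN : a = (j - k.*2)%:R by rewrite natrB // -jE addrK.
  rewrite aN in va *; apply: (ker_iter_eigen T va (nilp_iter _ _)).
  exact: sl2_e_adnil T.
have aN : - a = (k.*2 - j)%:R by rewrite natrB ?(ltnW jk) // -jE opprD addrCA subrr addr0.
have := G_neg va; rewrite aN => va'.
have := ker_iter_eigen (sl2_swap T) va' (nilp_iter _ (sl2_e_adnil (sl2_swap T))).
by rewrite -aN brNl scaleNr => /oppr_inj.
Qed.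

(** * Sums of weight spaces and dimension counts for triples *)

Definition Fil h (P : pred C) : {vspace V} := (\sum_(a <- spec (ad br h) | P a) G h a)%VS.

Lemma mem_Fil h (P : pred C) v : reflect (forall a, ~~ P a -> pr h a v = 0) (v \in Fil h P).
Proof.
apply: (iffP idP) => [|vP].
  rewrite /Fil; elim: (spec _) v => [|b s IHs] v.
    by rewrite big_nil memv0 => /eqP -> a _; rewrite linear0.
  rewrite big_cons; case: ifP => Pb; last exact: IHs.
  move=> /memv_addP[u ub [w /IHs ws ->]] a Pa; rewrite linearD /= ws // addr0.
  by apply: pr_diff ub; apply: contraNneq Pa => ->.
rewrite (pr_sum h v) /Fil; elim: (spec _) => [|b s IHs]; first by rewrite !big_nil mem0v.
rewrite !big_cons; case: ifP => Pb; first by rewrite memv_add ?memv_pr.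
by rewrite vP ?Pb // add0r.
Qed.

Lemma G_Fil h (P : pred C) a v : v \in G h a -> (v != 0 -> P a) -> v \in Fil h P.
Proof.
move=> va vP; apply/mem_Fil => b Pb; have [-> |/vP Pa] := eqVneq v 0; first by rewrite linear0.
by apply: pr_diff va; apply: contraNneq Pb => ->.
Qed.

Lemma Fil_br h (P Q R : pred C) u v : (forall a b, P a -> Q b -> R (a + b)) ->
  u \in Fil h P -> v \in Fil h Q -> br u v \in Fil h R.
Proof.
move=> PQR /mem_Fil uP /mem_Fil vQ; rewrite (pr_sum h u) (pr_sum h v) br_suml memv_suml // => a _.
rewrite br_sumr memv_suml // => b _.
have [Pa|/uP ->] := boolP (P a); last by rewrite br0l mem0v.
have [Qb|/vQ ->] := boolP (Q b); last by rewrite br0r mem0v.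
by apply: G_Fil (brG (memv_pr h a u) (memv_pr h b v)) _ => _; apply: PQR.
Qed.

Lemma Fil_split h (P Q : pred C) W : (forall v, v \in W -> br h v \in W) ->
  (forall v a, v \in W -> pr h a v != 0 -> P a || Q a) -> forall v, v \in W ->
  exists v1 v2, [/\ v = v1 + v2, v1 \in (W :&: Fil h P)%VS & v2 \in (W :&: Fil h Q)%VS].
Proof.
move=> hW WPQ v Wv.
pose v1 := \sum_(a <- spec (ad br h) | P a) pr h a v.
pose v2 := \sum_(a <- spec (ad br h) | ~~ P a) pr h a v.
exists v1, v2; split; first by rewrite [LHS](pr_sum h) (bigID P).
  rewrite memv_suml // => a Pa; rewrite memv_cap pr_stable //=.
  by apply: G_Fil (memv_pr h a v) _.
rewrite memv_suml // => a Pa; rewrite memv_cap pr_stable //=.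
apply: G_Fil (memv_pr h a v) _ => va; have := WPQ v a Wv va.
by rewrite (negPf Pa).
Qed.

Section TripleModule.
Variables (e h f : V) (W : {vspace V}).
Hypothesis T : sl2_triple br e h f.
Hypotheses (eW : forall v, v \in W -> br e v \in W) (hW : forall v, v \in W -> br h v \in W)
  (fW : forall v, v \in W -> br f v \in W).

(** e f is injective on the weight space of j + 1, hence bijective there. *)
Lemma sl2_surj (j : nat) v : v \in W -> v \in G h j.+1%:R ->
  exists u, [/\ u \in W, u \in G h (j.+1%:R - 2%:R) & br e u = v].
Proof.
move=> Wv va; pose L := (ad br e \o ad br f)%VF.
have LE u : L u = br e (br f u) by rewrite comp_lfunE !adE.
have [|||u /memv_capP[Wu ua]] := injective_surjective (f := L) (U := (W :&: G h j.+1%:R)%VS) _ _ (v := v) _.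
- move=> u /memv_capP[Wu ua]; rewrite LE memv_cap eW ?fW //=.
  have := brG (sl2_eG T) (brG (sl2_fG T) ua).
  by rewrite addrA subrr add0r.
- move=> u /memv_capP[_ ua]; rewrite LE; exact: (ef_injective T ua).
- by rewrite memv_cap Wv.
rewrite LE => uv; exists (br f u); split=> //; first exact: fW.
by rewrite addrC; apply: brG (sl2_fG T) ua.
Qed.

(** The kernel of e has weights at least 0, and e maps the part of weight at least 0 onto the part
    of weight at least 2; rank-nullity leaves the weights 0 and 1. *)
Lemma sl2_dim : \dim (W :&: zc br e) = (\dim (W :&: G h 0) + \dim (W :&: G h 1))%N.
Proof.
have hh := sl2_integral T.
pose F0 := (W :&: Fil h (>= 0)%R)%VS; pose F2 := (W :&: Fil h (>= 2%:R)%R)%VS.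
have prW a v : v \in W -> pr h a v \in W by apply: pr_stable.
have kerE : (W :&: zc br e = F0 :&: lker (ad br e))%VS.
  apply/vspaceP => v; rewrite !memv_cap !memv_ker -andbA; congr (_ && _).
  rewrite andb_idl // adE => /eqP ev; apply/mem_Fil => a; apply: contraNeq => va.
  have [|j ->] := ker_e_nat T (memv_pr h a v) _ va; last by rewrite ler0n.
  by rewrite (pr_shift _ _ (sl2_eG T)) ev linear0.
have imE : (ad br e @: F0 = F2)%VS.
  apply/eqP; rewrite eqEsubv; apply/andP; split; apply/subvP => v.
    move=> /memv_imgP[u /memv_capP[Wu u0] ->]; rewrite adE memv_cap eW //=.
    apply: (@Fil_br h (pred1 2%:R) _ _ _ _ _ _ u0).
      by move=> a b /eqP -> b0; rewrite lerDl.
    by apply: G_Fil (sl2_eG T) _ => _ /=.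
  move=> /memv_capP[Wv /mem_Fil v2]; rewrite (pr_sum h v) memv_suml // => a _.
  have [->|va] := eqVneq (pr h a v) 0; first exact: mem0v.
  have a2 : 2%:R <= a by apply: contraNT va => /v2 ->.
  have [j aE] := integral_pr hh va; subst a.
  have jE : exists k : nat, j = k.+2.
    case: j a2 {va} => [[|[|k]]|k]; last by rewrite NegzE -[2%:R]/((2%:Z)%:~R) ler_int.
    - by rewrite -[2%:R]/((2%:Z)%:~R) ler_int.
    - by rewrite -[2%:R]/((2%:Z)%:~R) ler_int.
    by exists k.
  have [k jk] := jE; subst j.
  have [u [Wu uG <-]] := sl2_surj (prW _ v Wv) (memv_pr h k.+2%:R v).
  rewrite -adE memv_img // memv_cap Wu; apply: G_Fil uG _ => _ /=.
  by rewrite subr_ge0 ler_nat.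
have sumE : (F0 = (W :&: G h 0) + ((W :&: G h 1) + F2))%VS.
  apply/eqP; rewrite eqEsubv; apply/andP; split; last first.
    rewrite !subv_add; apply/and3P; split; apply/subvP => v /memv_capP[Wv va]; rewrite memv_cap Wv.
    - by apply: G_Fil va _ => _ /=.
    - by apply: G_Fil va _ => _ /=; apply: ler01.
    by apply/mem_Fil => a a0; apply: (elimT (mem_Fil _ _ _) va); apply: contra a0; apply: le_trans; apply: ler0n.
  apply/subvP => v /memv_capP[Wv /mem_Fil v0]; rewrite (pr_sum h v) memv_suml // => a _.
  have [->|va] := eqVneq (pr h a v) 0; first exact: mem0v.
  have a0 : 0 <= a by apply: contraNT va => /v0 ->.
  have [j aE] := integral_pr hh va; subst a.
  have [[|[|k]] jE] : exists k : nat, j = k.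
  - by case: j a0 {va} => [k|k]; [exists k | rewrite NegzE ler0z].
  - by subst j; rewrite (subvP (addvSl _ _)) // memv_cap prW // memv_pr.
  - by subst j; rewrite (subvP (addvSr _ _)) // (subvP (addvSl _ _)) // memv_cap prW // memv_pr.
  subst j; rewrite (subvP (addvSr _ _)) // (subvP (addvSr _ _)) // memv_cap prW //.
  by apply: G_Fil (memv_pr _ _ v) _ => _ /=; rewrite -[2%:R]/((2%:Z)%:~R) ler_int.
have two_gt (b : C) : b = 0 \/ b = 1 -> ~~ (2%:R <= b).
  by case=> ->; rewrite lt_geF ?ltr1n ?ltr0n.
have d2 : ((W :&: G h 1) :&: F2 = 0)%VS.
  apply/eqP; rewrite -subv0; apply/subvP => v /memv_capP[/memv_capP[_ v1] /memv_capP[_ /mem_Fil v2]].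
  by rewrite memv0 -(pr_id v1) v2 //; apply: two_gt; right.
have d1 : ((W :&: G h 0) :&: ((W :&: G h 1) + F2) = 0)%VS.
  apply/eqP; rewrite -subv0; apply/subvP => v /memv_capP[/memv_capP[_ v0]].
  move=> /memv_addP[u /memv_capP[_ u1] [w /memv_capP[_ /mem_Fil w2] vE]].
  rewrite memv0 -(pr_id v0) {1}vE linearD /= (pr_diff _ u1) ?w2 ?addr0 //.
    by apply: two_gt; left.
  by rewrite eq_sym oner_eq0.
apply/eqP; rewrite -(eqn_add2r (\dim F2)) -addnA -(dimv_disjoint_sum d2) -(dimv_disjoint_sum d1) -sumE kerE.
by rewrite -imE limg_ker_dim.
Qed.

Lemma sl2_ker0 : (forall v, v \in W -> br e v = 0 -> v = 0) -> W = 0%VS.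
Proof.
move=> ker0; apply/eqP; rewrite -subv0; apply/subvP => v Wv; rewrite memv0.
apply/negPn/negP => v0; have [he _ _] := T.
have [k [w0 ew]] := last_iter he v0; case/eqP: w0; apply: ker0 ew.
by elim: k => //= k; apply: eW.
Qed.

End TripleModule.

(** Surjectivity of e propagates vanishing upwards from weight 1. A vector of weight -1 is sent to
    weight 1, hence killed by e, although kernel weights are natural; the swapped triple then
    propagates downwards. *)
Lemma sl2_even e h f : sl2_triple br e h f -> G h 1 = 0%VS ->
  forall j : int, odd `|j|%N -> G h j%:~R = 0%VS.
Proof.
move=> T G1.
have Tr w : forall v, v \in fullv -> br w v \in fullv by move=> v _; apply: memvf.
have pos (j : nat) : odd j -> G h j%:R = 0%VS.
  elim/ltn_ind: j => -[|[|j]] IHj // oj; apply/eqP; rewrite -subv0; apply/subvP => v va.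
  have [u [_ ua <-]] := sl2_surj T (Tr e) (Tr f) (memvf v) va.
  have E : j.+2%:R - 2%:R = j%:R :> C by rewrite -addn2 natrD addrK.
  move: ua; rewrite E IHj //; last by rewrite /= negbK in oj.
  by move=> /[!memv0]/eqP ->; rewrite br0r.
case=> j /=; first exact: pos.
rewrite NegzE => oj; apply/eqP; rewrite -subv0; apply/subvP => v.
move=> /G_neg; rewrite mulrNz opprK => va.
have T' := sl2_swap T.
have Gn k : odd k -> G (- h) k%:R = 0%VS.
  elim/ltn_ind: k => -[|[|k]] IHk // ok; apply/eqP; rewrite -subv0; apply/subvP => u ua.
    have := G_neg ua; rewrite opprK => u1.
    have eu : br e u = 0.
      apply/eqP; rewrite -memv0 -G1; have := brG (sl2_eG T) u1.
      by have -> : 2%:R + - 1%:R = 1 :> C by ring.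
    rewrite memv0; apply/negPn/negP => u0.
    have [j' /eqP] := ker_e_nat T u1 eu u0.
    by rewrite eq_sym -subr_eq0 opprK -natrD pnatr_eq0 addn1.
  have [w [_ wa <-]] := sl2_surj T' (Tr f) (Tr e) (memvf u) ua.
  have E : k.+2%:R - 2%:R = k%:R :> C by rewrite -addn2 natrD addrK.
  move: wa; rewrite E IHk //; last by rewrite /= negbK in ok.
  by move=> /[!memv0]/eqP ->; rewrite br0r.
by move: va; rewrite -pmulrn Gn.
Qed.

Lemma sl2_unique e h f f' : sl2_triple br e h f -> sl2_triple br e h f' -> f = f'.
Proof.
move=> T [_ hf' ef']; have [_ hf ef] := T; apply/eqP; rewrite -subr_eq0; apply/negPn/negP => d0.
have dG : f - f' \in G h (- 2%:R).
  by apply: eigG; rewrite brBr hf hf' scaleNr scalerBr opprB opprK addrC.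
have [|j /eqP] := ker_e_nat T dG _ d0; first by rewrite brBr ef ef' subrr.
by rewrite eq_sym -subr_eq0 opprK -natrD pnatr_eq0 addn2.
Qed.

(** * The Jacobson-Morozov theorem *)

(** z = [x, w] commutes with x and is nilpotent by Cartan's criterion. If ad w ad x had an
    eigenvector v for some nonzero a, the last nonzero iterate x^(k+1) v would be an eigenvector of
    z for a / (k + 1). *)
Lemma kap_nilp2 x w : adnil x -> br x (br x w) = 0 -> kap x w = 0.
Proof.
move=> nx xxw; pose z := br x w.
have xz v : br x (br z v) = br z (br x v) by rewrite brA xxw br0l add0r.
have nz : adnil z.
  apply: (nilp_brackets (r := [:: (x, w)])); first by rewrite big_seq1.
  by move=> p; rewrite inE => /eqP -> /=; rewrite dbar0 ?kap0l // brC xxw oppr0.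
rewrite kapC; apply: etr_eq0 => a v v0; rewrite comp_lfunE !adE => wxv.
apply/eqP/negPn/negP => a0.
have E k : iter k.+1 (br x) (br w (br x v)) = br w (iter k.+2 (br x) v) + k.+1%:R *: br z (iter k.+1 (br x) v).
  elim: k => [|k IHk]; first by rewrite /= brA scale1r addrC.
  rewrite iterS IHk brDr brZr [br x (br w _)]brA -/z xz -!iterS.
  by rewrite -[k.+2%:R]natr1 scalerDl scale1r [br z _ + br w _]addrC -addrA [br z _ + _]addrC.
have [k [kv kv1]] : exists k, iter k (br x) v != 0 /\ iter k.+1 (br x) v = 0.
  have := nilp_iter v nx; elim: (\dim _) => [/= v0'|n IHn en]; first by rewrite v0' eqxx in v0.
  by have [/IHn //|en0] := eqVneq (iter n (br x) v) 0; exists n.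
have itZ n c t : iter n (br x) (c *: t) = c *: iter n (br x) t.
  by elim: n => //= n ->; rewrite brZr.
case: k kv kv1 => [|k] kv kv1.
  by move/eqP: wxv; rewrite (kv1 : br x v = 0) br0r eq_sym scaler_eq0 (negPf a0) (negPf v0).
have := E k; rewrite [iter k.+2 _ _]kv1 br0r add0r wxv itZ => zu.
have : br z (iter k.+1 (br x) v) = (k.+1%:R^-1 * a) *: iter k.+1 (br x) v.
  by rewrite -scalerA zu scalerA mulVf ?pnatr_eq0 // scale1r.
by move/(nz _ _ kv)/eqP; rewrite mulf_eq0 invr_eq0 pnatr_eq0 (negPf a0).
Qed.

(** By [kap_nilp2] everything orthogonal to the image of (ad x)^2 on [S] is orthogonal to x, so x =
    [x, [x, s]]. Projecting to weights of y keeps the triple homogeneous: y = 0 gives the plain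
    theorem, y in a Cartan subalgebra gives root triples. *)
Lemma jacobson_morozov S y a x : subalg S -> ndg S -> y \in S -> x \in S -> x \in G y a ->
  adnil x -> exists h f, [/\ sl2_triple br x h f, h \in S, h \in G y 0, f \in S & f \in G y (- a)].
Proof.
move=> algS nS Sy Sx xa nx.
have prS b v : v \in S -> pr y b v \in S by apply: pr_stable => u; apply: algS.
pose L := (ad br x \o ad br x)%VF.
have LE u : L u = br x (br x u) by rewrite comp_lfunE !adE.
have : x \in (L @: S)%VS.
  apply: (double_perp nS) => //; first by apply/subvP => _ /memv_imgP[u Su ->]; rewrite LE !algS.
  move=> w Sw wL; rewrite kapC; apply: kap_nilp2 => //; apply: nS => [|s Ss]; first by rewrite !algS.
  by rewrite [br x (br x w)]brC kapNl kap_inv [br x w]brC kapNl opprK kap_inv -LE wL // memv_img.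
move=> /memv_imgP[s Ss]; rewrite LE => xE.
(* The factor -2 makes h = [x, f0] satisfy [h, x] = 2 [x, [x, s]] = 2x. *)
pose f0 := - 2%:R *: pr y (- a) s.
have Sf0 : f0 \in S by rewrite memvZ ?prS.
pose h := br x f0.
have hG : h \in G y 0 by rewrite -(subrr a); apply: brG xa _; rewrite memvZ ?memv_pr.
have Sh : h \in S by apply: algS.
have hx : br h x = 2%:R *: x.
  rewrite brC /h /f0 !brZr scaleNr opprK; congr (_ *: _).
  rewrite (pr_shift _ _ xa) subrr (pr_shift _ _ xa) addr0 -xE.
  exact: pr_id.
have [f Sf T] := morozov hx (erefl h) algS Sx Sh Sf0.
have [_ hf xf] := T.
exists h, (pr y (- a) f); split; rewrite ?prS ?memv_pr //; split=> //.
  by rewrite (pr_shift _ _ hG) add0r hf linearN linearZ.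
by rewrite (pr_shift _ _ xa) subrr xf; apply: pr_id.
Qed.

(** * Exponentials of nilpotent elements *)

Definition exppoly n : {poly C} := \poly_(k < n) (k`!%:R)^-1.
Definition Exp x : 'End(V) := pact (ad br x) (exppoly (\dim {:V}).+1).

Lemma exppolyE n x v : pact (ad br x) (exppoly n) v = \sum_(0 <= k < n) (k`!%:R)^-1 *: iter k (br x) v.
Proof.
rewrite (pact_wide _ _ (size_poly _ _)) big_mkord; apply: eq_bigr => k _.
by rewrite coef_poly ltn_ord iter_ad.
Qed.

Lemma ExpE x v : Exp x v = expad br x v.
Proof. by rewrite exppolyE big_mkord. Qed.

Lemma iter_br0 x k : iter k (br x) 0 = 0.
Proof. by elim: k => //= k ->; rewrite br0r. Qed.

Lemma Exp_trunc m x v : adnil x -> iter m (br x) v = 0 ->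
  Exp x v = \sum_(0 <= k < m) (k`!%:R)^-1 *: iter k (br x) v.
Proof.
move=> nx xm; rewrite exppolyE; set n := (\dim _).+1.
have ext p : iter p (br x) v = 0 -> (p <= m + n)%N ->
    \sum_(0 <= k < m + n) (k`!%:R)^-1 *: iter k (br x) v = \sum_(0 <= k < p) (k`!%:R)^-1 *: iter k (br x) v.
  move=> xp pmn; rewrite (big_cat_nat _ pmn) //= [X in _ + X]big_nat_cond [X in _ + X]big1 ?addr0 // => k /andP[/andP[pk _] _].
  by rewrite -(subnK pk) iterD xp iter_br0 scaler0.
rewrite -(ext n) ?leq_addl //; last by rewrite /n iterS nilp_iter ?br0r.
by rewrite (ext m) ?leq_addr.
Qed.

Lemma iter_br_br m x u v : iter m (br x) (br u v) =
  \sum_(0 <= i < m.+1) 'C(m, i)%:R *: br (iter i (br x) u) (iter (m - i) (br x) v).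
Proof.
elim: m => [|m IHm]; first by rewrite big_nat1 scale1r.
rewrite iterS IHm br_sumr.
under eq_bigr => i _ do rewrite brZr brA scalerDr.
rewrite big_split /= [RHS]big_nat_recl // bin0 scale1r subn0.
under [in RHS]eq_bigr => i _ do rewrite binS natrD scalerDl subSS.
rewrite big_split /= addrC addrA; congr (_ + _).
rewrite [LHS]big_nat_recl // [X in _ = _ + X]big_nat_recr //= bin0 bin_small // mulr0n scale0r addr0.
rewrite scale1r subn0; congr (_ + _); rewrite !big_nat; apply: eq_bigr => i /andP[_ im].
by rewrite -(subnSK im).
Qed.

Lemma sum_triangle (F : nat -> nat -> V) m :
  \sum_(0 <= n < m) \sum_(0 <= i < n.+1) F i (n - i)%N = \sum_(0 <= i < m) \sum_(0 <= j < m - i) F i j.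
Proof.
elim: m => [|m IHm]; first by rewrite !big_nil.
rewrite big_nat_recr //= {}IHm [in RHS]big_nat_recr //= subSnn big_nat1.
rewrite [\sum_(0 <= i < m.+1) F i _]big_nat_recr //= subnn addrA; congr (_ + _).
rewrite -big_split /= !big_nat; apply: eq_bigr => i /andP[_ im].
by rewrite (subSn (ltnW im)) [RHS]big_nat_recr.
Qed.

(** The Cauchy product. Summing up to N + N makes the triangle contain the square i, j < N, outside
    which all terms vanish. *)
Lemma Exp_br x u v : adnil x -> Exp x (br u v) = br (Exp x u) (Exp x v).
Proof.
move=> nx; set N := \dim {:V}.
have big0 k w : (N <= k)%N -> iter k (br x) w = 0.
  by move=> Nk; rewrite -(subnK Nk) iterD nilp_iter ?iter_br0.
rewrite (Exp_trunc (m := (N + N)%N) nx) ?big0 ?leq_addr //.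
rewrite (Exp_trunc (m := N) (v := u) nx) ?(Exp_trunc (m := N) (v := v) nx) ?big0 //.
pose F i j := (i`!%:R)^-1 *: ((j`!%:R)^-1 *: br (iter i (br x) u) (iter j (br x) v)).
transitivity (\sum_(0 <= n < N + N) \sum_(0 <= i < n.+1) F i (n - i)%N).
  apply: eq_big_nat => n _; rewrite iter_br_br scaler_sumr; apply: eq_big_nat => i /andP[_ ni].
  rewrite /F !scalerA; congr (_ *: _).
  have fn0 k : (k`!%:R : C) != 0 by rewrite pnatr_eq0 -lt0n fact_gt0.
  rewrite -(bin_fact (m := i) (n := n)) // !natrM !invfM [LHS]mulrC mulVKf //.
  by rewrite pnatr_eq0 -lt0n bin_gt0.
rewrite sum_triangle (big_cat_nat (n := N)) ?leq_addr //= [X in _ + X]big_nat_cond [X in _ + X]big1 ?addr0; last first.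
  move=> i /andP[/andP[Ni _] _]; rewrite big1 // => j _.
  by rewrite /F big0 ?br0l ?scaler0.
rewrite br_suml; apply: eq_big_nat => i /andP[_ iN]; rewrite brZl br_sumr scaler_sumr.
have NNi : (N <= N + N - i)%N by rewrite -addnBA ?leq_addr // ltnW.
rewrite (big_cat_nat (n := N)) //= [X in _ + X]big_nat_cond [X in _ + X]big1 ?addr0; last first.
  by move=> j /andP[/andP[Nj _] _]; rewrite /F [iter j _ _]big0 ?br0r ?scaler0.
by apply: eq_bigr => j _; rewrite /F brZr.
Qed.

(** What the conjugacy arguments use of products of exp(ad u) with u in [U] nilpotent. The last two
    clauses let one follow elements commuting with [U] and modules such as [S] or weight spaces. *)
Definition aut U (g : 'End(V)) := [/\ forall x y, g (br x y) = br (g x) (g y), injective g,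
  (forall v, (forall u, u \in U -> br u v = 0) -> g v = v) &
  (forall M, (forall u m, u \in U -> m \in M -> br u m \in M) -> forall m, m \in M -> g m \in M)].

Lemma aut_id U : aut U \1%VF.
Proof.
split=> [x y|x y|v _|M _ m]; rewrite ?id_lfunE //.
Qed.

Lemma aut_comp U g1 g2 : aut U g1 -> aut U g2 -> aut U (g1 \o g2)%VF.
Proof.
move=> [m1 i1 f1 s1] [m2 i2 f2 s2]; split=> [x y|x y|v Uv|M UM m Mm]; rewrite ?comp_lfunE.
- by rewrite m2 m1.
- by rewrite ?comp_lfunE => /i1/i2.
- by rewrite f2 ?f1.
- by apply: (s1 _ UM); apply: (s2 _ UM).
Qed.

Lemma aut_sub U W g : (U <= W)%VS -> aut U g -> aut W g.
Proof.
move=> /subvP UW [m i f s]; split=> // [v Wv|M WM]; first by apply: f => u /UW; apply: Wv.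
by apply: s => u m' /UW; apply: WM.
Qed.

Lemma aut_Exp U x : x \in U -> adnil x -> aut U (Exp x).
Proof.
move=> Ux nx; split.
- by move=> u v; apply: Exp_br.
- apply/lker0P; rewrite -subv0; apply/subvP => v; rewrite memv_ker memv0 => /eqP xv0.
  apply/negPn/negP => v0.
  have [k [kv kv1]] : exists k, iter k (br x) v != 0 /\ iter k.+1 (br x) v = 0.
    have := nilp_iter v nx; elim: (\dim _) => [/= v0'|n IHn en]; first by rewrite v0' eqxx in v0.
    by have [/IHn //|en0] := eqVneq (iter n (br x) v) 0; exists n.
  have : Exp x (iter k (br x) v) = 0.
    elim: k {kv kv1} => //= k IHk; rewrite -[RHS](br0r x) -IHk -!adE /Exp.
    by apply: pact_comm.
  rewrite (Exp_trunc (m := 1) nx) // big_nat1 fact0 invr1 scale1r.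
  by move/eqP: kv.
- move=> v Uv; have x1 : iter 1 (br x) v = 0 by apply: Uv.
  by rewrite (Exp_trunc nx x1) big_nat1 fact0 invr1 scale1r.
- move=> M UM m Mm; apply: pact_stable => // u Mu; rewrite adE; exact: UM.
Qed.

Lemma aut_inv U g : aut U g -> forall M, (forall u m, u \in U -> m \in M -> br u m \in M) -> (g @: M)%VS = M.
Proof.
move=> [_ gi _ gs] M UM; apply/eqP; rewrite eqEdim limg_dim_eq ?leqnn ?andbT.
  by apply/subvP => _ /memv_imgP[m Mm ->]; apply: gs UM _ Mm.
by move/lker0P/eqP: gi => ->; rewrite capv0.
Qed.

Lemma aut_triple U g e h f : aut U g -> sl2_triple br e h f -> sl2_triple br (g e) (g h) (g f).
Proof. by move=> [gm _ _ _] [he hf ef]; split; rewrite -gm ?he ?hf ?ef ?linearN ?linearZ. Qed.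

Lemma aut_G U g h a : aut U g -> integral h -> integral (g h) -> (g @: G h a)%VS = G (g h) a.
Proof.
move=> [gm gi _ _] hh hgh; have g0 : lker g == 0%VS by apply/lker0P.
apply/vspaceP => v; apply/memv_imgP/idP => [[u ua ->]|va].
  by apply: eigG; rewrite -gm (integralE hh ua) linearZ.
exists ((g^-1)%VF v); last by rewrite lker0_lfunVK.
apply: eigG; apply: gi; rewrite gm linearZ /= lker0_lfunVK //.
exact: integralE hgh va.
Qed.

Lemma Exp_br2 x v : adnil x -> br x (br x v) = 0 -> Exp x v = v + br x v.
Proof.
move=> nx xv; rewrite (Exp_trunc (m := 2) nx) // !big_nat_recl // big_geq //= fact0.
by rewrite !invr1 !scale1r addr0.
Qed.

Lemma Exp_br3 x v : adnil x -> br x (br x (br x v)) = 0 -> Exp x v = v + br x v + 2%:R^-1 *: br x (br x v).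
Proof.
move=> nx xv; rewrite (Exp_trunc (m := 3) nx) // !big_nat_recl // big_geq //= fact0.
by rewrite !invr1 !scale1r addr0 addrA.
Qed.

Lemma spec_bound h : exists B : nat, forall j : int, j%:~R \in spec (ad br h) -> (`|j| <= B)%N.
Proof.
elim: (spec _) => [|a s [B sB]]; first by exists 0%N.
have [[j0 j0a]|na] := boolp.EM (exists j : int, j%:~R = a :> C); last first.
  exists B => j; rewrite inE => /orP[/eqP ja|/sB //].
  by case: na; exists j.
exists (maxn `|j0| B) => j; rewrite inE => /orP[/eqP ja|/sB jB]; last by rewrite leq_max jB orbT.
by move: ja; rewrite -j0a => /intr_inj ->; rewrite leq_maxl.
Qed.

Lemma Fil_int h (P Q : pred C) v : integral h -> (forall j : int, P j%:~R -> Q j%:~R) ->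
  v \in Fil h P -> v \in Fil h Q.
Proof.
move=> hh PQ /mem_Fil vP; rewrite (pr_sum h v) memv_suml // => a _.
apply: G_Fil (memv_pr h a v) _ => va; have [j aE] := integral_pr hh va; subst a.
by apply: PQ; apply: contraNT va => /vP ->.
Qed.

Lemma Fil_big h (B : nat) v : integral h -> (forall j : int, j%:~R \in spec (ad br h) -> (`|j| <= B)%N) ->
  v \in Fil h (>= (B.+1%:Z)%:~R) -> v = 0.
Proof.
move=> hh hB /mem_Fil vB; rewrite (pr_sum h v) big_seq big1 // => a sa.
apply/eqP/negPn/negP => va; have [j aE] := integral_pr hh va; subst a.
have jB : (B.+1%:Z)%:~R <= j%:~R :> C by apply: contraNT va => /vB ->.
by move: jB (hB j sa); rewrite ler_int; lia.
Qed.

Lemma Fil_adnil h x : integral h -> x \in Fil h (> 0) -> adnil x.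
Proof.
move=> hh x0; have [B hB] := spec_bound h.
have x1 : x \in Fil h (>= 1%:~R).
  by apply: Fil_int hh _ x0 => j /=; rewrite ltr0z ler_int.
move=> a v v0 xv; apply: (@nilpotent_eigen _ _ (ad br x) (B + B.+1)%N a v v0); first by rewrite adE.
rewrite iter_ad; apply: (@Fil_big h B) => //.
have vB : v \in Fil h (>= (- B%:Z)%:~R).
  rewrite (pr_sum h v) big_seq memv_suml // => b sb.
  apply: G_Fil (memv_pr h b v) _ => vb; have [j bE] := integral_pr hh vb; subst b.
  by have := hB j sb; rewrite /= ler_int; lia.
have itk k : iter k (br x) v \in Fil h (>= (k%:Z - B%:Z)%:~R).
  elim: k => [|k IHk] /=; first by rewrite sub0r.
  apply: Fil_br x1 IHk => b c /= b1 cB.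
  have -> : (k.+1%:Z - B%:Z)%:~R = 1%:~R + (k%:Z - B%:Z)%:~R :> C by rewrite -intrD; congr (_%:~R); lia.
  exact: lerD.
have := itk (B + B.+1)%N; by have -> : (B + B.+1)%:Z - B%:Z = B.+1%:Z by lia.
Qed.

(** Successive approximation: for w of weights at least j + 1, solve [h, u] = w; then exp(ad u)
    sends h + w to h + w' with w' of weights at least j + 2. Weights are bounded, so this ends. *)
Lemma unipotent_conj h U : integral h -> subalg U -> (forall u, u \in U -> br h u \in U) ->
  (U <= Fil h (> 0)%R)%VS -> forall nu, nu \in U -> exists2 g, aut U g & g (h + nu) = h.
Proof.
move=> hh algU hU UF nu Unu; have [B hB] := spec_bound h.
pose Uj (j : nat) := (U :&: Fil h (>= (j%:Z)%:~R)%R)%VS.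
have UjU j u : u \in Uj j -> u \in U by case/memv_capP.
have Uadnil u : u \in U -> adnil u by move/(subvP UF); apply: Fil_adnil.
have Ubr i j u v : u \in Uj i -> v \in Uj j -> br u v \in Uj (i + j)%N.
  move=> /memv_capP[Uu ui] /memv_capP[Uv vj]; rewrite memv_cap algU //=.
  by apply: Fil_br ui vj => a b /= ai bj; rewrite PoszD intrD lerD.
have Ule i j u : (i <= j)%N -> u \in Uj j -> u \in Uj i.
  move=> ij /memv_capP[Uu /mem_Fil uj]; rewrite memv_cap Uu; apply/mem_Fil => a ai; apply: uj.
  by apply: contra ai => /=; apply: le_trans; rewrite ler_int lez_nat.
have hUj j u : u \in Uj j -> br h u \in Uj j.
  move=> /memv_capP[Uu /mem_Fil uj]; rewrite memv_cap hU //=; apply/mem_Fil => a /uj ua.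
  by rewrite pr_comm ?brxx // ua br0r.
have hinj u : u \in U -> br h u = 0 -> u = 0.
  move=> /(subvP UF)/mem_Fil u0 hu.
  by rewrite -(pr_id (eigG0 hu)) u0 //= ltxx.
suff main m j : (B < j.+1 + m)%N -> forall w, w \in Uj j.+1 -> exists2 g, aut U g & g (h + w) = h.
  apply: (main B 0%N) => //; rewrite memv_cap Unu.
  by apply: Fil_int hh _ (subvP UF _ Unu) => j /=; rewrite ltr0z ler_int.
elim: m j => [|m IHm] j jB w Uw.
  exists \1%VF; first exact: aut_id.
  rewrite id_lfunE (_ : w = 0) ?addr0 //; apply: (Fil_big hh hB).
  have /memv_capP[_] : w \in Uj B.+1 by apply: Ule Uw; rewrite addn0 in jB.
  by [].
have [||u Uu uw] := injective_surjective (f := ad br h) (U := Uj j.+1) _ _ Uw.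
- by move=> u Uu; rewrite adE hUj.
- by move=> u Uu; rewrite adE; apply: hinj; apply: UjU Uu.
have nu' := Uadnil u (UjU _ _ Uu).
rewrite adE in uw.
pose w' := Exp u (h + w) - h.
have Uw' : w' \in Uj j.+2.
  have uu v : v \in Uj j.+1 -> br u v \in Uj j.+2.
    by move=> Uv; apply: Ule (Ubr _ _ _ _ Uu Uv); lia.
  have u2 v : v \in Uj j.+2 -> br u v \in Uj j.+2.
    by move=> Uv; apply: Ule (Ubr _ _ _ _ Uu Uv); lia.
  have E : br u (h + w) = br u w - w by rewrite brDr [br u h]brC uw addrC.
  rewrite /w' (Exp_trunc (m := (\dim {:V}).+2) nu'); last first.
    by rewrite 2!iterS nilp_iter ?br0r.
  rewrite !big_nat_recl // iterS /= E fact0 invr1 !scale1r.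
  have alg (x y z t : V) : x + y + (z - y + t) - x = z + t.
    by rewrite addrAC [x + y]addrC addrK addrA [y + _]addrC subrK.
  rewrite alg; apply: memvD; first exact: uu.
  rewrite memv_suml // => k _; apply: memvZ.
  suff: iter k (br u) (br u (br u (h + w))) \in Uj j.+2 by rewrite -!iterSr.
  elim: k => [|k IHk] /=; last exact: u2.
  by rewrite E brBr; apply: memvB; [apply: u2; apply: uu | apply: uu].
have [|g2 g2a g2E] := IHm j.+1 _ w' Uw'; first by rewrite addSnnS.
exists (g2 \o Exp u)%VF; first by apply: aut_comp g2a (aut_Exp (UjU _ _ Uu) nu').
by rewrite comp_lfunE -[Exp u _](subrK h) -/w' addrC g2E.
Qed.

(** * Conjugacy of principal triples *)

(** The three exponentials represent the Weyl reflection of the triple, and a is the value at y of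
    the root of x. *)
Lemma reflection x h f y a : sl2_triple br x h f -> br y x = a *: x -> br y f = - (a *: f) ->
  Exp x (Exp (- f) (Exp x y)) = y - a *: h.
Proof.
move=> T yx yf; have [hx hf xf] := T.
have nx := sl2_e_adnil T.
have nf : adnil (- f).
  have := sl2_e_adnil (sl2_swap T) => nf b v v0; rewrite brNl => /eqP.
  by rewrite eqr_oppLR -scaleNr => /eqP /(nf _ _ v0)/eqP; rewrite oppr_eq0 => /eqP.
have xy : br x y = - (a *: x) by rewrite brC yx.
have xh : br x h = - (2%:R *: x) by rewrite brC hx.
have fh : br f h = 2%:R *: f by rewrite brC hf opprK.
have fy : br f y = a *: f by rewrite brC yf opprK.
have fx : br f x = - h by rewrite brC xf.
have two0 : (2%:R : C) != 0 by rewrite pnatr_eq0.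
rewrite (Exp_br2 (v := y) nx) xy; last by rewrite brNr brZr brxx scaler0 oppr0.
have b1 : br (- f) (y + - (a *: x)) = - (a *: f) - a *: h.
  by rewrite brNl brBr brZr fy fx scalerN opprK opprD.
have b2 : br (- f) (- (a *: f) - a *: h) = (a * 2%:R) *: f.
  by rewrite brNl brBr brNr !brZr brxx scaler0 oppr0 sub0r opprK fh scalerA.
rewrite (Exp_br3 nf) b1 b2; last by rewrite brZr brNl brxx oppr0 scaler0.
have -> : y + - (a *: x) + (- (a *: f) - a *: h) + 2%:R^-1 *: ((a * 2%:R) *: f) = y - a *: x - a *: h.
  rewrite scalerA mulrCA mulVf // mulr1 -!addrA; do 2 congr (_ + _).
  by rewrite [- (a *: h) + _]addrC addKr.
have c1 : br x (y - a *: x - a *: h) = a *: x.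
  rewrite !brBr !brZr brxx scaler0 subr0 xy xh scalerN opprK scalerA -scaleNr -scalerDl; congr (_ *: _).
  ring.
by rewrite (Exp_br2 nx) c1 ?brZr ?brxx ?scaler0 // -addrA [- (a *: h) + _]addrC addrA subrK.
Qed.

Lemma reflection_f x h f : sl2_triple br x h f -> Exp x (Exp (- f) (Exp x f)) = - x.
Proof.
move=> T; have [hx hf xf] := T.
have nx := sl2_e_adnil T.
have nf : adnil (- f).
  have := sl2_e_adnil (sl2_swap T) => nf b v v0; rewrite brNl => /eqP.
  by rewrite eqr_oppLR -scaleNr => /eqP /(nf _ _ v0)/eqP; rewrite oppr_eq0 => /eqP.
have xh : br x h = - (2%:R *: x) by rewrite brC hx.
have fh : br f h = 2%:R *: f by rewrite brC hf opprK.
have fx : br f x = - h by rewrite brC xf.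
have two0 : (2%:R : C) != 0 by rewrite pnatr_eq0.
rewrite (Exp_br3 (v := f) nx) xf xh; last by rewrite brNr brZr brxx scaler0 oppr0.
have -> : f + h + 2%:R^-1 *: (- (2%:R *: x)) = f + h - x.
  by rewrite scalerN scalerA mulVf // scale1r.
have b1 : br (- f) (f + h - x) = - (2%:R *: f) - h.
  by rewrite brNl brBr brDr brxx add0r fh fx opprK opprD.
have b2 : br (- f) (- (2%:R *: f) - h) = 2%:R *: f.
  by rewrite brNl brBr brNr brZr brxx scaler0 oppr0 sub0r opprK fh.
rewrite (Exp_br3 nf) b1 b2; last by rewrite brZr brNl brxx oppr0 scaler0.
have -> : f + h - x + (- (2%:R *: f) - h) + 2%:R^-1 *: (2%:R *: f) = - x.
  rewrite scalerA mulVf // scale1r scaler_nat mulr2n opprD [f + h - x]addrC -!addrA -[RHS]addr0.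
  by congr (_ + _); rewrite [- h + f]addrC addKr [- f - h]addrC addNKr subrr.
by rewrite (Exp_br2 (v := - x) nx) brNr brxx oppr0 ?br0r ?addr0.
Qed.

Lemma kap_pr y a x v : v \in G y (- a) -> kap x v = kap (pr y a x) v.
Proof.
move=> va; rewrite [x in LHS](pr_sum y) kap_suml.
have [sa|sa] := boolP (a \in spec (ad br y)).
  rewrite (bigD1_seq a) ?undup_uniq //= big1 ?addr0 // => b ba.
  by apply: (kapG (memv_pr y b x) va); rewrite subr_eq0.
have -> : pr y a x = 0 by apply/eqP; apply: contraNT sa; apply: pr_spec.
rewrite kap0l big_seq big1 // => b sb.
by apply: (kapG (memv_pr y b x) va); rewrite subr_eq0; apply: contraNneq sa => <-.
Qed.

Lemma kap_Fil y (P Q : pred C) u v : (forall a b, P a -> Q b -> a + b != 0) ->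
  u \in Fil y P -> v \in Fil y Q -> kap u v = 0.
Proof.
move=> PQ /mem_Fil uP /mem_Fil vQ; rewrite (pr_sum y u) (pr_sum y v) kap_suml big1 // => a _.
rewrite kap_sumr big1 // => b _.
have [Pa|/uP ->] := boolP (P a); last by rewrite kap0l.
have [Qb|/vQ ->] := boolP (Q b); last by rewrite kap0r.
by apply: kapG (memv_pr y a u) (memv_pr y b v) _; apply: PQ.
Qed.

(** * Borel subalgebras of regular integral elements *)

Section InSubalgebra.
Variable S : {vspace V}.
Hypotheses (algS : subalg S) (nS : ndg S).

Lemma subalg_pr y a v : y \in S -> v \in S -> pr y a v \in S.
Proof. by move=> Sy; apply: pr_stable => u; apply: algS. Qed.

Lemma pr_ndg y a x : y \in S -> x \in S -> x \in G y a ->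
  (forall v, v \in S -> v \in G y (- a) -> kap x v = 0) -> x = 0.
Proof.
move=> Sy Sx xa x0; apply: nS => // v Sv.
rewrite kapC (kap_pr (y := y) (a := - a)) ?opprK // kapC; apply: x0; rewrite ?memv_pr //.
exact: subalg_pr.
Qed.

Lemma perp_Fil h (P Q : pred C) x : integral h -> h \in S -> x \in S ->
  (forall j : int, ~~ Q j%:~R -> P (- j%:~R)) ->
  (forall v, v \in S -> v \in Fil h P -> kap x v = 0) -> x \in Fil h Q.
Proof.
move=> hh Sh Sx PQ x0; apply/mem_Fil => a Qa; apply: (@pr_ndg h a) => //; rewrite ?memv_pr ?subalg_pr //.
move=> v Sv va; rewrite -kap_pr //; apply: x0 => //; apply: (G_Fil va) => v0.
have [[j /eqP jE] _] := hh _ _ va v0.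
have aE : a = (- j)%:~R by apply/eqP; rewrite intrN -eqr_oppLR jE.
by rewrite aE; apply: PQ; rewrite -aE.
Qed.

(* [h] is integral with abelian centralizer, so that [S :&: Fil h (>= 0)] is a Borel subalgebra. *)
Definition reg h := [/\ integral h, h \in S &
  forall x y, x \in S -> x \in G h 0 -> y \in S -> y \in G h 0 -> br x y = 0].

Local Notation p h := (S :&: Fil h (>= 0)%R)%VS.
Local Notation n h := (S :&: Fil h (> 0)%R)%VS.

Lemma perp_n h x : reg h -> x \in S -> (forall v, v \in n h -> kap x v = 0) -> x \in p h.
Proof.
move=> [hh Sh _] Sx x0; rewrite memv_cap Sx; apply: (perp_Fil (P := (> 0)%R) hh Sh Sx) => [j /=|v Sv vF].
  by rewrite ler0z -ltNge oppr_gt0 ltrz0.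
by apply: x0; rewrite memv_cap Sv.
Qed.

Lemma kap_np h u v : u \in n h -> v \in p h -> kap u v = 0.
Proof.
move=> /memv_capP[_ un] /memv_capP[_ vp]; apply: kap_Fil un vp => a b /= a0 b0.
by rewrite gt_eqF // ltr_wpDr.
Qed.

Lemma n_adnil h x : reg h -> x \in n h -> adnil x.
Proof. by move=> [hh _ _] /memv_capP[_]; apply: Fil_adnil. Qed.

(** On the lowest component of a vector, powers of x act as powers of the weight zero part t, so t
    is nilpotent too. It commutes with the zero weight space of [S], hence is orthogonal to it and
    vanishes. *)
Lemma adnil_n h x : reg h -> x \in p h -> adnil x -> x \in n h.
Proof.
move=> rh; have [hh Sh ab] := rh => /memv_capP[Sx /mem_Fil xp] nx.
pose t := pr h 0 x.
have tG : t \in G h 0 by apply: memv_pr.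
have St : t \in S by apply: subalg_pr.
have xtF : x - t \in Fil h (> 0).
  apply/mem_Fil => a a0; rewrite linearB /=.
  have [->|na] := eqVneq a 0; first by rewrite (pr_id tG) subrr.
  by rewrite (pr_diff na tG) subr0 xp //; apply: contra a0 => a0; rewrite lt_def na.
suff t0 : t = 0 by rewrite t0 subr0 in xtF; rewrite memv_cap Sx.
apply: (@pr_ndg h 0) => // v Sv; rewrite oppr0 => vG.
apply: kap_nilp; first exact: ab.
move=> c w w0 tw; have [b wb] := gproj_neq0 (ad br h) w0; rewrite -/(pr h b) in wb.
have tb u : br t (pr h b u) = pr h b (br t u) by rewrite (pr_shift _ _ tG) add0r.
have key m : iter m (br x) (pr h b w) \in Fil h (>= b) /\
    pr h b (iter m (br x) (pr h b w)) = c ^+ m *: pr h b w.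
  elim: m => [|m [IF IE]] /=.
    split; first by apply: G_Fil (memv_pr h b w) _ => _ /=.
    by rewrite scale1r pr_id ?memv_pr.
  have xE : br x (iter m (br x) (pr h b w)) =
      br t (iter m (br x) (pr h b w)) + br (x - t) (iter m (br x) (pr h b w)).
    by rewrite brBl addrCA subrr addr0.
  have tF : br t (iter m (br x) (pr h b w)) \in Fil h (>= b).
    apply: (@Fil_br h (pred1 0) (>= b)%R) IF => [a d /eqP -> bd /=|]; first by rewrite add0r.
    by apply: G_Fil tG _ => _ /=.
  have xF : br (x - t) (iter m (br x) (pr h b w)) \in Fil h (> b).
    by apply: Fil_br xtF IF => a d /= a0 bd; rewrite -[b]add0r ltr_leD.
  rewrite xE; split.
    apply: memvD tF _; apply/mem_Fil => a ba; apply: (elimT (mem_Fil _ _ _) xF).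
    by apply: contra ba => /ltW.
  rewrite linearD /= -tb IE brZr (elimT (mem_Fil _ _ _) xF) /= ?ltxx // addr0.
  by rewrite tb tw linearZ /= scalerA exprSr.
have [_] := key (\dim {:V}); rewrite nilp_iter // linear0 => /esym/eqP.
by rewrite scaler_eq0 (negPf wb) orbF expf_eq0 => /andP[_ /eqP].
Qed.

(** The infinitesimal form of two Borel subalgebras sharing a Cartan subalgebra. A vector w
    orthogonal to the right-hand side lies in [p h2] and in [n h1 + n h2]; its part in [n h1] is
    nilpotent and lies in [p h2], hence in [n h2]. So w lies in [n h2], which is orthogonal to
    [p h2]. *)
Lemma bruhat h1 h2 x : reg h1 -> reg h2 -> x \in p h2 ->
  exists u nu, [/\ x = u + nu, u \in p h1, u \in p h2 & nu \in n h2].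
Proof.
move=> r1 r2 x2; have pS h v : v \in p h -> v \in S by case/memv_capP.
have nS' h v : v \in n h -> v \in S by case/memv_capP.
have np h v : v \in n h -> v \in p h.
  move=> /memv_capP[Sv /mem_Fil vn]; rewrite memv_cap Sv; apply/mem_Fil => a a0; apply: vn.
  by apply: contra a0 => /ltW.
suff: x \in ((p h1 :&: p h2) + n h2)%VS.
  by move=> /memv_addP[u /memv_capP[u1 u2] [nu nun ->]]; exists u, nu.
apply: (double_perp nS) => [||w Sw w0]; last 1 first.
- have w2 : w \in p h2.
    by apply: perp_n => // v vn; apply: w0; apply: (subvP (addvSr _ _)).
  have : w \in (n h1 + n h2)%VS.
    apply: (double_perp nS) => // [|u Su u0].
      by rewrite subv_add !capvSl.
    rewrite kapC; apply: w0; apply: (subvP (addvSl _ _)); rewrite memv_cap.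
    by apply/andP; split; apply: perp_n => // v vn; apply: u0;
      [apply: (subvP (addvSl _ _)) | apply: (subvP (addvSr _ _))].
  move=> /memv_addP[a an [b bn wE]].
  have a2 : a \in n h2.
    apply: adnil_n => //; last exact: n_adnil r1 an.
    have -> : a = w - b by rewrite wE addrK.
    by apply: memvB => //; apply: np.
  by apply: (@kap_np h2) => //; rewrite wE memvD.
- by rewrite subv_add capvSl andbT (subv_trans (capvSl _ _)) ?capvSl.
exact: pS x2.
Qed.

Lemma aut_S g v : aut S g -> v \in S -> g v \in S.
Proof. by move=> [_ _ _ gs]; apply: gs => u m; apply: algS. Qed.

Lemma aut_integral g h : aut S g -> integral h -> integral (g h).
Proof.
move=> [gm gi _ _] hh a v va v0; have g0 : lker g == 0%VS by apply/lker0P.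
pose w := (g^-1)%VF v; have vE : v = g w by rewrite lker0_lfunVK.
have w0 : w != 0 by apply: contraNneq v0 => w0; rewrite vE w0 linear0.
have wa : w \in G h a.
  apply: (@geigP _ _ _ _ (\dim {:V})); apply: gi; rewrite linear0.
  have : pact (ad br (g h)) (('X - a%:P) ^+ \dim {:V}) v = 0.
    by apply/eqP; rewrite -mem_geig.
  rewrite vE; move: (_ ^+ _) => q <-; rewrite !pactE linear_sum; apply: eq_bigr => i _.
  rewrite linearZ !iter_ad; congr (_ *: _).
  by elim: (nat_of_ord i) => //= k IHk; rewrite gm IHk.
have [jE hw] := hh a w wa w0; split=> //.
by rewrite vE -gm hw linearZ.
Qed.

Lemma aut_mem g h a v : aut S g -> integral h -> v \in S -> v \in G (g h) a ->
  exists u, [/\ u \in S, u \in G h a & v = g u].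
Proof.
move=> ga hh Sv va.
have SgE : (g @: S)%VS = S by apply: (aut_inv ga) => u m; apply: algS.
have := Sv; rewrite -{1}SgE => /memv_imgP[u Su vE].
exists u; split=> //; apply: eigG; have [gm gi _ _] := ga.
apply: gi; rewrite gm -vE (integralE (aut_integral ga hh) va) linearZ /=.
by rewrite vE.
Qed.

Lemma aut_reg g h : aut S g -> reg h -> reg (g h).
Proof.
move=> ga [hh Sh ab]; split; [exact: aut_integral | exact: aut_S | move=> x y Sx xG Sy yG].
have [u [Su uG ->]] := aut_mem ga hh Sx xG; have [w [Sw wG ->]] := aut_mem ga hh Sy yG.
by have [gm _ _ _] := ga; rewrite -gm ab // linear0.
Qed.

Lemma aut_Fil g h P v : aut S g -> integral h -> v \in Fil h P -> g v \in Fil (g h) P.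
Proof.
move=> ga hh /mem_Fil vP; rewrite (pr_sum h v) linear_sum memv_suml // => a _.
have [gm _ _ _] := ga.
apply: (G_Fil (a := a)).
  by apply: eigG; rewrite -gm (integralE hh (memv_pr h a v)) linearZ.
by move=> gv; apply: contraNT gv => /vP ->; rewrite linear0.
Qed.

Lemma n_conj h nu : reg h -> nu \in n h -> exists2 g, aut S g & g (h + nu) = h.
Proof.
move=> [hh Sh _] nun.
have [|||g ga gE] := unipotent_conj hh (U := n h) _ _ _ nun.
- move=> u v /memv_capP[Su uF] /memv_capP[Sv vF]; rewrite memv_cap algS //=.
  by apply: Fil_br uF vF => a b; apply: addr_gt0.
- move=> u /memv_capP[Su /mem_Fil uF]; rewrite memv_cap algS //=.
  by apply/mem_Fil => a /uF ua; rewrite pr_comm ?brxx // ua br0r.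
- exact: capvSr.
by exists g => //; apply: aut_sub ga; apply: capvSl.
Qed.

(** With h2 = u + nu, the element h2 - nu = u of [p h1] is conjugate to h2 under [n h2]. *)
Lemma conj_step1 h1 h2 : reg h1 -> reg h2 -> exists2 g, aut S g & h2 \in Fil (g h1) (>= 0).
Proof.
move=> r1 r2; have [hh2 Sh2 _] := r2; have [hh1 _ _] := r1.
have h2p : h2 \in p h2.
  by rewrite memv_cap Sh2; apply: (G_Fil (a := 0)); [apply: eigG0; rewrite brxx | move=> _ /=].
have [u [nu [h2E u1 _ nun]]] := bruhat r1 r2 h2p.
have [|g ga gE] := n_conj r2 (nu := - nu); first by rewrite memvN.
exists g => //; rewrite -gE; have -> : h2 - nu = u by rewrite h2E addrK.
by apply: aut_Fil => //; case/memv_capP: u1.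
Qed.

(** h1 differs by an element of [n h1] from z, a vector commuting with h2. So z is conjugate to h1,
    and the same conjugation carries [h2, z] = 0 to the claim. *)
Lemma conj_step2 h1 h2 : reg h1 -> reg h2 -> h2 \in Fil h1 (>= 0) ->
  exists2 g, aut S g & br (g h2) h1 = 0.
Proof.
move=> r1 r2 h2F; have [hh2 Sh2 _] := r2; have [hh1 Sh1 _] := r1.
have h1p : h1 \in p h1.
  by rewrite memv_cap Sh1; apply: (G_Fil (a := 0)); [apply: eigG0; rewrite brxx | move=> _ /=].
have [u [nu [h1E u2 u1 nun]]] := bruhat r2 r1 h1p.
pose z := pr h2 0 u.
have zp : z \in p h1.
  apply: pr_stable u1 => v /memv_capP[Sv vF]; rewrite memv_cap algS //=.
  by apply: Fil_br h2F vF => a b; apply: addr_ge0.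
have uzn : u - z \in n h1.
  apply: adnil_n r1 _ _; first by rewrite memvB.
  apply: (n_adnil r2); case/memv_capP: u2 => Su /mem_Fil uF.
  rewrite memv_cap memvB ?subalg_pr //=; apply/mem_Fil => a a0; rewrite linearB /=.
  have zG : z \in G h2 0 by apply: memv_pr.
  have [->|na] := eqVneq a 0; first by rewrite (pr_id zG) subrr.
  by rewrite (pr_diff na zG) subr0 uF //; apply: contra a0 => a0; rewrite lt_def na.
have [|g ga gE] := n_conj r1 (nu := - (nu + (u - z))); first by rewrite memvN memvD.
exists g => //; rewrite -gE; have -> : h1 - (nu + (u - z)) = z.
  by rewrite h1E; rewrite -[u + nu]addrC opprD addrA [nu + u]addrC addrK opprB addrC subrK.
have [gm _ _ _] := ga; rewrite -gm; have -> : br h2 z = 0.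
  by rewrite (integralE hh2 (memv_pr h2 0 u)) scale0r.
by rewrite linear0.
Qed.

End InSubalgebra.

(** * Integral elements and positivity of the Killing form *)

Lemma pr_eig y a b v : br y v = b *: v -> pr y a v = if a == b then v else 0.
Proof.
move=> yv; have vb := eigG yv; have [->|ab] := eqVneq a b; first exact: pr_id.
exact: pr_diff ab vb.
Qed.

Lemma integral_intro d : (forall v, exists2 r : seq (C * V), v = \sum_(p <- r) p.2 &
    forall p, p \in r -> br d p.2 = p.1 *: p.2 /\ (p.2 != 0 -> exists j : int, p.1 = j%:~R)) -> integral d.
Proof.
move=> dV a v va v0; have [r vE rP] := dV v.
have vE' : v = \sum_(p <- r | a == p.1) p.2.
  rewrite -{1}(pr_id va) vE linear_sum [RHS]big_mkcond; apply: eq_big_seq => p /rP[dp _].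
  exact: pr_eig.
split; last first.
  rewrite vE' br_sumr scaler_sumr big_seq_cond [RHS]big_seq_cond; apply: eq_bigr => p /andP[/rP[dp _] /eqP ->].
  exact: dp.
have /hasP[p rp /andP[/eqP -> p0]] : has (fun p : C * V => (a == p.1) && (p.2 != 0)) r.
  apply: contraNT v0; rewrite -all_predC => /allP r0; rewrite vE' big_seq_cond big1 // => p /andP[rp ap].
  by have := r0 p rp; rewrite /= ap /= negbK => /eqP.
by have [_ /(_ p0)] := rP p rp.
Qed.

Lemma integral_add h1 h2 : integral h1 -> integral h2 -> br h1 h2 = 0 -> integral (h1 + h2).
Proof.
move=> hh1 hh2 h12; apply: integral_intro => v.
exists [seq (a + b, pr h2 b (pr h1 a v)) | a <- spec (ad br h1), b <- spec (ad br h2)].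
  rewrite big_allpairs_dep /= {1}(pr_sum h1 v); apply: eq_bigr => a _.
  exact: pr_sum.
move=> _ /allpairsP[[a b] /= [_ _ ->]] /=.
have h2c : br h2 h1 = 0 by rewrite brC h12 oppr0.
have ha : br h1 (pr h2 b (pr h1 a v)) = a *: pr h2 b (pr h1 a v).
  by rewrite -pr_comm // (integralE hh1 (memv_pr h1 a v)) linearZ.
have hb := integralE hh2 (memv_pr h2 b (pr h1 a v)).
split; first by rewrite brDl ha hb scalerDl.
move=> v0; have [[j ->] _] := hh2 b _ (memv_pr h2 b (pr h1 a v)) v0.
have [[i ->] _] := hh1 a _ (eigG ha) v0.
by exists (i + j); rewrite intrD.
Qed.

Lemma integral_scale (m : int) h : integral h -> integral (m%:~R *: h).
Proof.
move=> hh; apply: integral_intro => v.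
exists [seq (m%:~R * a, pr h a v) | a <- spec (ad br h)]; first by rewrite big_map -pr_sum.
move=> _ /mapP[a _ ->] /=; split; first by rewrite brZl (integralE hh (memv_pr h a v)) scalerA.
by move=> /(integral_pr hh)[j ->]; exists (m * j); rewrite intrM.
Qed.

Lemma integral_sub h1 h2 : integral h1 -> integral h2 -> br h1 h2 = 0 -> integral (h1 - h2).
Proof.
move=> hh1 hh2 h12; apply: integral_add; rewrite ?brNr ?h12 ?oppr0 //.
by have := integral_scale (m := -1) hh2; rewrite mulrN1z scaleN1r.
Qed.

Lemma integral_square d a v : integral d -> v != 0 -> (ad br d \o ad br d)%VF v = a *: v ->
  exists j : int, a = (j * j)%:~R.
Proof.
move=> hd v0; rewrite comp_lfunE !adE => fv.
have [c vc] := gproj_neq0 (ad br d) v0; rewrite -/(pr d c) in vc.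
have [j cE] := integral_pr hd vc; subst c; exists j.
have dv := integralE hd (memv_pr d j%:~R v).
have : a *: pr d j%:~R v = (j%:~R * j%:~R) *: pr d j%:~R v.
  by rewrite -linearZ -fv /= !pr_comm ?brxx // dv brZr dv scalerA.
move/eqP; rewrite -subr_eq0 -scalerBl scaler_eq0 (negPf vc) orbF subr_eq0 => /eqP ->.
by rewrite intrM.
Qed.

Lemma kap_integral_nat d : integral d -> exists m : nat, kap d d = m%:R.
Proof.
move=> hd; apply: etr_nat => a v v0 fv; have [j ->] := integral_square hd v0 fv.
by exists `|(j * j)%R|%N; rewrite natr_absz ger0_norm // -expr2 sqr_ge0.
Qed.

Lemma integral_kap0 S d : ndg S -> d \in S -> integral d -> kap d d = 0 -> d = 0.
Proof.
move=> nS Sd hd dd; apply: nS => // y _; rewrite /kap.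
suff -> : ad br d = 0 by rewrite comp_lfun0l -[0 in LHS](scale0r 0) etrZ mul0r.
apply/lfunP => v; rewrite adE zero_lfunE (pr_sum d v) br_sumr big1 // => a _.
have [->|va] := eqVneq (pr d a v) 0; first by rewrite br0r.
have dv := integralE hd (memv_pr d a v).
have [j aE] := integral_pr hd va; subst a; rewrite dv.
have : (j * j)%:~R = 0 :> C.
  apply: (etr_ge0_eq0 _ dd va); last by rewrite comp_lfunE !adE dv brZr dv scalerA intrM.
  by move=> b w w0 /(integral_square hd w0)[i ->]; rewrite ler0z -expr2 sqr_ge0.
by move/eqP; rewrite intr_eq0 mulf_eq0 orbb => /eqP ->; rewrite scale0r.
Qed.

(** 2 kap(x, f) = kap(h, h) is a sum of squares of integers, to which x itself contributes 4. *)
Lemma sl2_kap_pos x h f : sl2_triple br x h f -> x != 0 ->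
  exists2 m : nat, (0 < m)%N & 2%:R * kap x f = m%:R.
Proof.
move=> T x0; have [hx hf xf] := T; have hh := sl2_integral T.
have hhE : kap h h = 2%:R * kap x f.
  by rewrite -{1}xf kap_inv brC hf opprK kapZr.
have [m mE] := kap_integral_nat hh; exists m; last by rewrite -hhE.
rewrite lt0n; apply/negP => /eqP m0.
have tr0 : etr (ad br h \o ad br h)%VF = 0 by rewrite -/(kap h h) mE m0.
have four : (ad br h \o ad br h)%VF x = (2%:R * 2%:R) *: x.
  by rewrite comp_lfunE !adE hx brZr hx scalerA.
have : 2%:R * 2%:R = 0 :> C.
  apply: (etr_ge0_eq0 _ tr0 x0 four) => b w w0 /(integral_square hh w0)[i ->].
  by rewrite ler0z -expr2 sqr_ge0.
by move/eqP; rewrite -natrM pnatr_eq0.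
Qed.

(** * Principal triples of a subalgebra are conjugate *)

Section Conjugacy.
Variable S : {vspace V}.
Hypotheses (algS : subalg S) (nS : ndg S).

(** By [sl2_dim] the centralizer of e in [S] then has the dimension of the zero weight space of h,
    which is abelian. *)
Definition principal_triple e h f :=
  [/\ sl2_triple br e h f, [/\ e \in S, h \in S & f \in S], reg S h & (S :&: G h 1 = 0)%VS].

Lemma aut_principal g e h f : aut S g -> principal_triple e h f -> principal_triple (g e) (g h) (g f).
Proof.
move=> ga [T [Se Sh Sf] rh h1]; have [hh _ _] := rh.
split; [exact: aut_triple ga T | by split; apply: aut_S ga _ | exact: aut_reg |].
apply/eqP; rewrite -subv0; apply/subvP => v /memv_capP[Sv v1].
have [u [Su u1 ->]] := aut_mem algS ga hh Sv v1.
have : u \in (S :&: G h 1)%VS by rewrite memv_cap Su.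
by rewrite h1 !memv0 => /eqP ->; rewrite linear0.
Qed.

Lemma reg_comm h x y : reg S h -> x \in S -> y \in S -> br h x = 0 -> br h y = 0 -> br x y = 0.
Proof. by move=> [_ _ ab] Sx Sy hx hy; apply: ab => //; apply: eigG0. Qed.

(* A root vector on which [h1] and [h2] have opposite signs yields a reflection bringing [h1]
   closer to [h2]. *)
Lemma reflect_closer e1 h1 f1 h2 x (a b : int) : principal_triple e1 h1 f1 -> h2 \in S -> br h1 h2 = 0 ->
  x \in S -> x != 0 -> br h1 x = a%:~R *: x -> br h2 x = b%:~R *: x -> a * b < 0 ->
  exists g, [/\ aut S g, br (g h1) h2 = 0 & kap (g h1 - h2) (g h1 - h2) < kap (h1 - h2) (h1 - h2)].
Proof.
move=> [T1 [Se Sh1 Sf] r1 _] Sh2 h12 Sx x0 hx1 hx2 ab.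
have a0 : a != 0 by apply: contraTneq ab => ->; rewrite mul0r ltxx.
have nx : adnil x by apply: adnil_shift (eigG hx1) _; rewrite intr_eq0.
have [hx [f [T Shx hxG Sfx fG]]] := jacobson_morozov algS nS Sh1 Sx (eigG hx1) nx.
have [hh1 _ _] := r1; have [hxx hxf xf] := T.
have h1f : br h1 f = - (a%:~R *: f) by rewrite (integralE hh1 fG) scaleNr.
have h1hx : br h1 hx = 0 by rewrite (integralE hh1 hxG) scale0r.
have nf := sl2_e_adnil (sl2_swap T).
have nNf : adnil (- f).
  move=> b' v v0; rewrite brNl => /eqP.
  by rewrite eqr_oppLR -scaleNr => /eqP /(nf _ _ v0)/eqP; rewrite oppr_eq0 => /eqP.
pose g := (Exp x \o (Exp (- f)%R \o Exp x))%VF.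
have gE : g h1 = h1 - a%:~R *: hx by rewrite !comp_lfunE; apply: reflection T hx1 h1f.
exists g; split.
- by apply: aut_comp; [|apply: aut_comp]; apply: aut_Exp; rewrite ?memvN.
- rewrite gE brBl h12 brZl (@reg_comm h1 hx h2) ?scaler0 ?subr0 //.
have [m m0 mE] := sl2_kap_pos T x0.
have khh : kap hx hx = 2%:R * kap x f.
  by rewrite -{1}xf kap_inv brC hxf opprK kapZr.
have kh1 : kap hx h1 = a%:~R * kap x f.
  by rewrite -xf kap_inv brC h1f opprK kapZr.
have kh2 : kap hx h2 = b%:~R * kap x f.
  by rewrite -xf kapC -kap_inv hx2 kapZl.
rewrite gE addrAC; set d := h1 - h2.
have kd : kap hx d = (a%:~R - b%:~R) * kap x f by rewrite kapBr kh1 kh2 mulrBl.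
have E u y : kap (u - y) (u - y) = kap u u - 2%:R * kap y u + kap y y.
  by rewrite kapBl !kapBr [kap u y]kapC; ring.
rewrite E !kapZl kapZr kd khh -subr_gt0.
have -> (t : C) : t - (t - 2%:R * (a%:~R * ((a%:~R - b%:~R) * kap x f)) + a%:~R * (a%:~R * (2%:R * kap x f))) =
  (- (a%:~R * b%:~R)) * (2%:R * kap x f) by ring.
by rewrite mE mulr_gt0 ?ltr0n // oppr_gt0 -intrM ltrz0.
Qed.

(* When [h1] and [h2] define the same positive part [n], the degree two parts agree, because
   everything in degree at least three for either grading lies in [[n, n]]. *)
Lemma same_degree2 e1 h1 f1 e2 h2 f2 : principal_triple e1 h1 f1 -> principal_triple e2 h2 f2 ->
  br h1 h2 = 0 ->
  (forall x (a b : int), x \in S -> x != 0 -> br h1 x = a%:~R *: x -> br h2 x = b%:~R *: x -> 0 <= a * b) ->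
  br h1 e2 = 2%:R *: e2.
Proof.
move=> [T1 [Se1 Sh1 Sf1] r1 odd1] [T2 [Se2 Sh2 Sf2] r2 odd2] h12 pos.
have [hh1 _ _] := r1; have [hh2 _ _] := r2; have h21 : br h2 h1 = 0 by rewrite brC h12 oppr0.
have zero1 x (b : int) : x \in S -> x != 0 -> br h1 x = 0 -> br h2 x = b%:~R *: x -> b = 0.
  move=> Sx x0 hx1 hx2; have := reg_comm r1 Sh2 Sx h12 hx1.
  by rewrite hx2 => /eqP; rewrite scaler_eq0 (negPf x0) orbF intr_eq0 => /eqP.
have zero2 x (a : int) : x \in S -> x != 0 -> br h2 x = 0 -> br h1 x = a%:~R *: x -> a = 0.
  move=> Sx x0 hx2 hx1; have := reg_comm r2 Sh1 Sx h21 hx2.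
  by rewrite hx1 => /eqP; rewrite scaler_eq0 (negPf x0) orbF intr_eq0 => /eqP.
have sgn x (a b : int) : x \in S -> x != 0 -> br h1 x = a%:~R *: x -> br h2 x = b%:~R *: x -> (0 < a) = (0 < b).
  move=> Sx x0 hx1 hx2; have ab := pos x a b Sx x0 hx1 hx2.
  have az : a = 0 -> b = 0 by move=> az; apply: (zero1 x) => //; rewrite hx1 az scale0r.
  have bz : b = 0 -> a = 0 by move=> bz; apply: (zero2 x) => //; rewrite hx2 bz scale0r.
  by nia.
have comp x : x \in S -> forall a b, pr h1 a (pr h2 b x) != 0 -> exists i j : int,
    [/\ a = i%:~R, b = j%:~R, pr h1 a (pr h2 b x) \in S, br h1 (pr h1 a (pr h2 b x)) = i%:~R *: pr h1 a (pr h2 b x)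
      & br h2 (pr h1 a (pr h2 b x)) = j%:~R *: pr h1 a (pr h2 b x)].
  move=> Sx a b x0.
  have xS : pr h1 a (pr h2 b x) \in S by rewrite !subalg_pr.
  have hb : br h2 (pr h1 a (pr h2 b x)) = b *: pr h1 a (pr h2 b x).
    by rewrite -pr_comm // (integralE hh2 (memv_pr h2 b x)) linearZ.
  have [[j bE] _] := hh2 b _ (eigG hb) x0.
  have [[i aE] _] := hh1 a _ (memv_pr h1 a _) x0.
  by exists i, j; rewrite -aE -bE (integralE hh1 (memv_pr h1 a _)).
have n12 x : x \in S -> x \in Fil h1 (> 0) -> x \in Fil h2 (>= 2%:R).
  move=> Sx xF; apply/mem_Fil => b b2; apply/eqP/negPn/negP => xb.
  have xbF : pr h2 b x \in Fil h1 (> 0).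
    apply: pr_stable xF => v; apply: (@Fil_br h1 (pred1 0)) => [c d /eqP -> /=|]; first by rewrite add0r.
    by apply: (G_Fil (a := 0)); [apply: eigG0 | move=> _ /=].
  have [a xab] := gproj_neq0 (ad br h1) xb; rewrite -/(pr h1 a) in xab.
  have [i [j [aE bE xS hi hj]]] := comp x Sx a b xab.
  have i0 : 0 < i.
    rewrite -(ltr0z C) -aE; apply: contraNT xab => a0.
    by apply/eqP; apply: (elimT (mem_Fil _ _ _) xbF).
  have j0 : 0 < j by rewrite -(sgn _ _ _ xS xab hi hj).
  have [j1|j1] := eqVneq j 1.
    have : pr h2 b x \in (S :&: G h2 1)%VS by rewrite memv_cap subalg_pr //= bE j1 memv_pr.
    by rewrite odd2 memv0 => /eqP xb0; rewrite xb0 eqxx in xb.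
  by case/negP: b2; rewrite /= bE -[2%:R]/((2%:Z)%:~R) ler_int; move: j0 j1; clear; lia.
have n21 x : x \in S -> x \in Fil h2 (> 0) -> x \in Fil h1 (> 0).
  move=> Sx xF; apply/mem_Fil => a a0; apply/eqP/negPn/negP => xa.
  have xaF : pr h1 a x \in Fil h2 (> 0).
    apply: pr_stable xF => v; apply: (@Fil_br h2 (pred1 0)) => [c d /eqP -> /=|]; first by rewrite add0r.
    by apply: (G_Fil (a := 0)); [apply: eigG0 | move=> _ /=].
  have [b xab] := gproj_neq0 (ad br h2) xa; rewrite -/(pr h2 b) in xab.
  have hx1 : br h1 (pr h2 b (pr h1 a x)) = a *: pr h2 b (pr h1 a x).
    by rewrite -pr_comm // (integralE hh1 (memv_pr h1 a x)) linearZ.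
  have hx2 := integralE hh2 (memv_pr h2 b (pr h1 a x)).
  have [[i aE] _] := hh1 _ _ (eigG hx1) xab; have [[j bE] _] := hh2 _ _ (eigG hx2) xab; subst a b.
  have j0 : 0 < j.
    rewrite -(ltr0z C); apply: contraNT xab => j0.
    by apply/eqP; apply: (elimT (mem_Fil _ _ _) xaF).
  by case/negP: a0; rewrite /= ltr0z (sgn (pr h2 j%:~R (pr h1 i%:~R x)) i j) // !subalg_pr.
suff e2G : e2 \in G h1 2%:R by apply: integralE.
have e2F : e2 \in Fil h1 (> 0).
  by apply: n21 => //; apply: G_Fil (sl2_eG T2) _ => _ /=; rewrite ltr0n.
rewrite (pr_sum h1 e2) memv_suml // => a _.
have [->|ea] := eqVneq (pr h1 a e2) 0; first exact: mem0v.
have [i aE] := integral_pr hh1 ea; subst a.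
have i0 : 0 < i.
  rewrite -(ltr0z C); apply: contraNT ea => j0.
  by apply/eqP; apply: (elimT (mem_Fil _ _ _) e2F).
have [i1|i1] := eqVneq i 1.
  have : pr h1 i%:~R e2 \in (S :&: G h1 1)%VS by rewrite memv_cap subalg_pr //= i1 memv_pr.
  by rewrite odd1 memv0 => /eqP ->; rewrite mem0v.
have [->|i2] := eqVneq i 2; first exact: memv_pr.
have [k iE] : exists k : nat, i = k.+3 by exists (`|i| - 3)%N; move: i0 i1 i2; clear; lia.
case/eqP: ea; subst i.
have Se : pr h1 k.+3%:R e2 \in S by rewrite subalg_pr.
have e1S v : v \in S -> br e1 v \in S by apply: algS.
have f1S v : v \in S -> br f1 v \in S by apply: algS.
have [u [Su uG uE]] := sl2_surj T1 e1S f1S Se (memv_pr h1 k.+3%:R e2).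
have e14 : br e1 u \in Fil h2 (>= (2%:R + 2%:R)).
  apply: (@Fil_br h2 (>= 2%:R)%R (>= 2%:R)%R) => [c d /= c2 d2||]; first exact: lerD.
    by apply: n12 => //; apply: G_Fil (sl2_eG T1) _ => _ /=; rewrite ltr0n.
  apply: n12 => //; apply: G_Fil uG _ => _ /=.
  by rewrite subr_gt0 ltr_nat.
have e2G2 : pr h1 k.+3%:R e2 \in G h2 2%:R.
  apply: eigG; rewrite -pr_comm //; have [-> _ _] := T2.
  by rewrite linearZ.
rewrite -pmulrn -(pr_id e2G2) -uE; apply: (elimT (mem_Fil _ _ _) e14) => /=.
by rewrite -natrD ler_nat.
Qed.

(** Descent on the natural number kap(h1 - h2, h1 - h2). When no reflection applies, h1 - h2
    commutes with e1 and e2, so it is orthogonal to h1 = [e1, f1] and to h2 = [e2, f2], hence to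
    itself. *)
Lemma conj_principal_comm e1 h1 f1 e2 h2 f2 : principal_triple e1 h1 f1 -> principal_triple e2 h2 f2 ->
  br h1 h2 = 0 -> exists2 g, aut S g & g h1 = h2.
Proof.
move=> P1 P2 h12; have [m mE] : exists m : nat, kap (h1 - h2) (h1 - h2) = m%:R.
  have [_ _ [hh1 _ _] _] := P1; have [_ _ [hh2 _ _] _] := P2.
  by apply: kap_integral_nat; apply: integral_sub.
elim/ltn_ind: m e1 h1 f1 P1 h12 mE => m IHm e1 h1 f1 P1 h12 mE.
have [T1 [Se1 Sh1 Sf1] r1 _] := P1; have [T2 [Se2 Sh2 Sf2] r2 _] := P2.
have [hh1 _ _] := r1; have [hh2 _ _] := r2.
have [[x [a [b [Sx x0 hx1 hx2 ab]]]]|noneg] := boolp.EM (exists x (a b : int),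
    [/\ x \in S, x != 0, br h1 x = a%:~R *: x, br h2 x = b%:~R *: x & a * b < 0]).
  have [g [ga g12 gk]] := reflect_closer P1 Sh2 h12 Sx x0 hx1 hx2 ab.
  have P1' := aut_principal ga P1.
  have [_ _ [hg _ _] _] := P1'.
  have [m' mE'] := kap_integral_nat (integral_sub hg hh2 g12).
  have [|g' ga' g'E] := IHm m' _ _ _ _ P1' g12 mE'; first by rewrite -(ltr_nat C) -mE' -mE.
  by exists (g' \o g)%VF; [apply: aut_comp | rewrite comp_lfunE].
exists \1%VF; first exact: aut_id.
have pos12 x (a b : int) : x \in S -> x != 0 -> br h1 x = a%:~R *: x -> br h2 x = b%:~R *: x -> 0 <= a * b.
  by move=> Sx x0 hx1 hx2; rewrite leNgt; apply/negP => ab; apply: noneg; exists x, a, b.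
have h21 : br h2 h1 = 0 by rewrite brC h12 oppr0.
have he2 := same_degree2 P1 P2 h12 pos12.
have he1 : br h2 e1 = 2%:R *: e1.
  by apply: (same_degree2 P2 P1 h21) => x a b Sx x0 hx2 hx1; rewrite mulrC; apply: (pos12 x).
have [he11 hf11 ef11] := T1; have [he22 hf22 ef22] := T2.
apply/eqP; rewrite id_lfunE -subr_eq0; apply/eqP.
apply: (integral_kap0 nS); rewrite ?memvB //; first exact: integral_sub.
have k1 : kap (h1 - h2) h1 = 0 by rewrite -{2}ef11 -kap_inv brBl he11 he1 subrr kap0l.
have k2 : kap (h1 - h2) h2 = 0 by rewrite -{2}ef22 -kap_inv brBl he22 he2 subrr kap0l.
by rewrite kapBr k1 k2 subrr.
Qed.

Theorem conj_principal e1 h1 f1 e2 h2 f2 : principal_triple e1 h1 f1 -> principal_triple e2 h2 f2 ->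
  exists g1 g2, [/\ aut S g1, aut S g2 & g1 h1 = g2 h2].
Proof.
move=> P1 P2; have [_ _ r1 _] := P1; have [_ _ r2 _] := P2.
have [g ga gF] := conj_step1 algS nS r1 r2.
have P1' := aut_principal ga P1; have [_ _ r1' _] := P1'.
have [g2 g2a g2E] := conj_step2 algS nS r1' r2 gF.
have P2' := aut_principal g2a P2.
have [|g3 g3a g3E] := conj_principal_comm P1' P2'; first by rewrite brC g2E oppr0.
by exists (g3 \o g)%VF, g2; split=> //; [apply: aut_comp | rewrite comp_lfunE].
Qed.

End Conjugacy.

Lemma zc_G0 h : integral h -> zc br h = G h 0.
Proof.
move=> hh; apply/vspaceP => v; rewrite mem_zc; apply/eqP/idP => [/eigG0 //|].
by move=> v0; rewrite (integralE hh v0) scale0r.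
Qed.

(* If [y] has minimal centralizer in [S], then so has a suitable [u + c y] for every [u] in
   that centralizer, and both centralizers coincide. *)
Lemma abelian_of_minimal S y : subalg S -> y \in S -> integral y ->
  (forall x, x \in S -> (\dim (S :&: zc br y) <= \dim (S :&: zc br x))%N) ->
  forall u w, u \in S -> u \in G y 0 -> w \in S -> w \in G y 0 -> br u w = 0.
Proof.
move=> algS Sy hy ymin u w Su u0 Sw w0; have [B uB] := spec_bound u.
have yu : br y u = 0 by rewrite (integralE hy u0) scale0r.
have uy : br u y = 0 by rewrite brC yu oppr0.
pose z := u + B.+1%:R *: y.
have sub : (S :&: zc br z <= S :&: zc br y)%VS.
  apply/subvP => v /memv_capP[Sv]; rewrite memv_cap Sv !mem_zc /= => /eqP zv.
  rewrite (pr_sum y v) br_sumr big1 // => a _.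
  have [->|va] := eqVneq (pr y a v) 0; first by rewrite br0r.
  have ya := integralE hy (memv_pr y a v); rewrite ya.
  have [j aE] := integral_pr hy va; subst a.
  have zy : br y z = 0 by rewrite /z brDr brZr yu brxx scaler0 addr0.
  have: br z (pr y j%:~R v) = 0 by rewrite -pr_comm // zv linear0.
  rewrite /z brDl brZl ya scalerA => /eqP; rewrite addr_eq0 -scaleNr => /eqP uv.
  have su : (- (B.+1%:Z * j))%:~R \in spec (ad br u).
    rewrite mem_undup; apply/mem_roots_chp; exists (pr y j%:~R v) => //.
    by rewrite adE uv intrN intrM.
  have j0 : j = 0 by move: (uB _ su); clear; nia.
  by rewrite j0 scale0r.
have Sz : z \in S by rewrite memvD ?memvZ.
have E : (S :&: zc br z = S :&: zc br y)%VS.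
  by apply/eqP; rewrite eqEdim sub ymin.
have wy : w \in (S :&: zc br y)%VS by rewrite memv_cap Sw zc_G0.
move: (wy); rewrite -E memv_cap mem_zc /z brDl brZl => /andP[_].
by rewrite (integralE hy w0) scale0r scaler0 addr0 => /eqP.
Qed.

(** * Reductive subalgebras *)

Section Reductive.
Variable K : {vspace V}.
Hypotheses (algK : subalg K) (nK : ndg K).
Local Notation S := (derived br K).

Lemma derived_sub : (S <= K)%VS.
Proof. exact/derived_subP. Qed.

Lemma derived_subalg : subalg S.
Proof. by move=> x y /(subvP derived_sub) Kx /(subvP derived_sub) Ky; apply: mem_derived. Qed.

Lemma derived_central x : x \in S -> (forall y, y \in K -> br x y = 0) -> x = 0.
Proof.
move=> Sx xK; have nx := nilp_central Sx xK.
by apply: nK => [|y Ky]; [exact: (subvP derived_sub) | rewrite kap_nilp ?xK].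
Qed.

Lemma perp_derived x : x \in K -> (forall y, y \in S -> kap x y = 0) -> forall y, y \in K -> br x y = 0.
Proof.
move=> Kx xS y Ky; apply: nK => [|z Kz]; first exact: algK.
by rewrite kap_inv xS ?mem_derived.
Qed.

Lemma derived_ndg : ndg S.
Proof.
by move=> x Sx xS; apply: derived_central => //; apply: perp_derived => //; apply: (subvP derived_sub).
Qed.

(** Vectors of [K] orthogonal to [S] are central. A vector orthogonal to both summands is central
    and, by [double_perp], lies in [S], hence is zero. *)
Lemma reductive_split y : y \in K -> exists u z, [/\ u \in S, z \in K, y = u + z & forall x, x \in K -> br z x = 0].
Proof.
move=> Ky; suff: y \in (S + K :&: perp S)%VS.
  move=> /memv_addP[u Su [z /memv_capP[Kz /memv_perp zS] ->]]; exists u, z; split=> //.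
  exact: perp_derived.
apply: (double_perp nK) => // [|u Ku u0]; first by rewrite subv_add derived_sub capvSl.
have uS v : v \in S -> kap u v = 0 by move=> Sv; apply: u0; apply: (subvP (addvSl _ _)).
suff -> : u = 0 by rewrite kap0l.
apply: derived_central; last exact: perp_derived.
apply: (double_perp nK) => // [|w Kw wS]; first exact: derived_sub.
rewrite kapC; apply: u0; apply: (subvP (addvSr _ _)); rewrite memv_cap Kw.
exact/memv_perp.
Qed.

Lemma derived_perfect : derived br S = S.
Proof.
apply/eqP; rewrite eqEsubv; apply/andP; split; apply/derived_subP => x y Sx Sy.
  exact: derived_subalg.
have [u [z [Su _ -> zK]]] := reductive_split Sx; have [w [t [Sw Kt -> tK]]] := reductive_split Sy.
have Kw : w \in K by apply: (subvP derived_sub).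
have Ku : u \in K by apply: (subvP derived_sub).
by rewrite brDl !brDr !zK // [br u t]brC tK // oppr0 !addr0 mem_derived.
Qed.

(** Nilpotency on [S] puts [S] inside [G x 0], where [dbar x] vanishes. As x is a sum of brackets
    from the perfect algebra [S], Cartan's criterion extends nilpotency to all of [V]. *)
Lemma adnil_of_derived x n : x \in S -> (forall y, y \in S -> iter n (br x) y = 0) -> adnil x.
Proof.
rewrite -{1}derived_perfect => /derived_sum[r xE rS] nx.
apply: (nilp_brackets xE) => p /rS[p1 _].
have : p.1 \in G x 0 by apply: (@geig0P _ _ _ n); rewrite iter_ad nx.
by move=> /dbarG ->; rewrite conjC0 scale0r kap0l.
Qed.

(** x has a centralizer of minimal dimension dim S_0 + dim S_1, while that of h has dimension dim
    S_0. So S_1 = 0 and h reaches the minimum too. *)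
Lemma principal_nilpotent_triple x : principal_nilpotent_in br S x ->
  exists h f, principal_triple S x h f.
Proof.
move=> [Sx [n nx] [_ xmin]]; have ax := adnil_of_derived Sx nx.
have S0 : 0 \in S by apply: mem0v.
have [|h [f [T Sh _ Sf _]]] := jacobson_morozov derived_subalg derived_ndg S0 Sx (a := 0) _ ax.
  by apply: eigG0; rewrite br0l.
have hh := sl2_integral T.
have sS t : t \in S -> forall v, v \in S -> br t v \in S by move=> St v; apply: derived_subalg.
have dE := sl2_dim T (sS _ Sx) (sS _ Sh) (sS _ Sf).
have dh := xmin h Sh; rewrite (zc_G0 hh) dE in dh.
have d1 : \dim (S :&: G h 1) = 0%N by move: dh; lia.
exists h, f; split=> //; last by apply/eqP; rewrite -dimv_eq0 d1.
split=> //; apply: abelian_of_minimal => //; first exact: derived_subalg.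
by move=> y Sy; rewrite (zc_G0 hh) -[X in (X <= _)%N]addn0 -d1 -dE; apply: xmin.
Qed.

End Reductive.

(** * The centralizer of a triple *)

Section Centralizer.
Variables (e h f : V).
Hypotheses (T : sl2_triple br e h f) (nV : ndg fullv).
Let k := (zc br e :&: zc br h :&: zc br f)%VS.

Lemma mem_k x : reflect [/\ br e x = 0, br h x = 0 & br f x = 0] (x \in k).
Proof.
rewrite !memv_cap !mem_zc -andbA.
by apply: (iffP and3P) => [[/eqP ? /eqP ? /eqP ?]|[-> -> ->]].
Qed.

Lemma k_subalg : subalg k.
Proof.
move=> x y /mem_k[ex hx fx] /mem_k[ey hy fy]; apply/mem_k.
by split; rewrite brA ?ex ?ey ?hx ?hy ?fx ?fy br0l br0r addr0.
Qed.

Lemma ker_e_G0 x : x \in G h 0 -> br e x = 0 -> x \in k.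
Proof.
move=> x0 ex; have [he hf ef] := T; have hh := sl2_integral T.
have hx : br h x = 0 by rewrite (integralE hh x0) scale0r.
apply/mem_k; split=> //; apply/eqP/negPn/negP => fx0.
have efx : br e (br f x) = 0 by rewrite brA ef hx ex br0r addr0.
have [j /eqP] := ker_e_nat T (brG (sl2_fG T) x0) efx fx0.
by rewrite addr0 eq_sym -subr_eq0 opprK -natrD pnatr_eq0 addn2.
Qed.

Lemma G0_split x : x \in G h 0 -> x \in (k + ad br e @: fullv)%VS.
Proof.
have [he hf ef] := T; have hh := sl2_integral T.
suff main n y : y \in G h 0 -> iter n (br e) y = 0 -> y \in (k + ad br e @: fullv)%VS.
  by move=> x0; apply: main x0 (nilp_iter _ (sl2_e_adnil T)).
elim: n y => [|[|n] IHn] y y0 ey; first by rewrite (ey : y = 0) mem0v.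
  by rewrite (subvP (addvSl _ _)) // ker_e_G0.
(* On weight zero vectors killed by e^(n+2) one has e^(n+2) f y = c e^(n+1) y, so y - c^-1 e f y is
   already killed by e^(n+1). *)
pose c : C := n.+2%:R * n.+1%:R.
have c0 : c != 0 by rewrite mulf_neq0 ?pnatr_eq0.
have yE : y = (y - c^-1 *: br e (br f y)) + c^-1 *: br e (br f y) by rewrite subrK.
rewrite yE memvD //; last first.
  by rewrite memvZ // (subvP (addvSr _ _)) // -adE memv_img ?memvf.
have efy : br e (br f y) \in G h 0.
  by have := brG (sl2_eG T) (brG (sl2_fG T) y0); rewrite addrA subrr add0r.
apply: IHn; first by rewrite memvB ?memvZ.
have itB m u v : iter m (br e) (u - v) = iter m (br e) u - iter m (br e) v.
  by elim: m => //= m ->; rewrite brBr.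
have itZ m d t : iter m (br e) (d *: t) = d *: iter m (br e) t.
  by elim: m => //= m ->; rewrite brZr.
rewrite itB itZ -iterSr (iter_e_f he ef) ey br0r add0r.
have -> : br h (iter n.+1 (br e) y) = n.+1.*2%:R *: iter n.+1 (br e) y.
  by apply: (integralE hh); have := iter_e_G he n.+1 y0; rewrite add0r.
by rewrite -scalerBl -natrB -addnn ?leq_addl // addnK [n.+2%:R *: _]scalerA -/c scalerA mulVf // scale1r subrr.
Qed.

(** [k] has weight 0, so it pairs only with weight 0, and [G h 0] lies in [k] plus the image of e,
    which is orthogonal to [k] by invariance. *)
Lemma k_ndg : ndg k.
Proof.
move=> x kx xk; have /mem_k[ex hx fx] := kx; apply: nV => [|y _]; first exact: memvf.
rewrite (pr_sum h y) kap_sumr big1 // => a _.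
have [->|a0] := eqVneq a 0; last by rewrite (kapG (eigG0 hx) (memv_pr h a y)) ?add0r.
have /memv_addP[u ku [_ /memv_imgP[v _ ->] ->]] := G0_split (memv_pr h 0 y).
by rewrite kapDr xk // adE add0r -kap_inv brC ex oppr0 kap0l.
Qed.

(** h1 - h lies in z(e) and has positive weights only: its weight zero part is in [k] and is also e
    applied to a vector of weight -2, hence zero by [ef_injective] for the swapped triple. Then
    [unipotent_conj] moves h1 to h, and f is determined by e and h. *)
Lemma triple_conj h1 f1 : sl2_triple br e h1 f1 ->
  exists g, [/\ aut (zc br e) g, g e = e, g h1 = h & g f1 = f].
Proof.
move=> T1; have [he1 hf1 ef1] := T1; have [he hf ef] := T; have hh := sl2_integral T.
pose U := (zc br e :&: Fil h (> 0)%R)%VS.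
pose nu := h1 - h.
have enu : br e nu = 0 by rewrite brBr ![br e _]brC he he1 subrr.
have Unu : nu \in U.
  rewrite memv_cap mem_zc enu eqxx /=; apply/mem_Fil => a a0; apply/eqP/negPn/negP => na.
  have ep : br e (pr h a nu) = 0 by rewrite (pr_shift _ _ (sl2_eG T)) enu linear0.
  have [j aE] := ker_e_nat T (memv_pr h a nu) ep na; subst a.
  have j0 : j = 0%N by apply/eqP; move: a0; rewrite /= ltr0n lt0n negbK.
  subst j; case/eqP: na.
  have nuE : nu = br e (f1 - f) by rewrite brBr ef1 ef.
  have u2 : pr h (- 2%:R) (f1 - f) \in G (- h) 2%:R by have := G_neg (memv_pr h (- 2%:R) (f1 - f)); rewrite opprK.
  have prE : pr h 0%:R nu = br e (pr h (- 2%:R) (f1 - f)).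
    by rewrite nuE (pr_shift _ _ (sl2_eG T)) subrr.
  rewrite prE (ef_injective (sl2_swap T) u2) ?br0r // -prE.
  by have /mem_k[] := ker_e_G0 (memv_pr h 0 nu) ep.
have [|||g ga gE] := unipotent_conj hh (U := U) _ _ _ Unu.
- move=> u v /memv_capP[+ uF] /memv_capP[+ vF]; rewrite !mem_zc => /eqP eu /eqP ev.
  rewrite memv_cap mem_zc brA eu ev br0l br0r addr0 eqxx /=.
  by apply: Fil_br uF vF => a b; apply: addr_gt0.
- move=> u /memv_capP[+ /mem_Fil uF]; rewrite mem_zc => /eqP eu.
  rewrite memv_cap mem_zc (br_eh he) eu br0r scaler0 subrr eqxx /=.
  by apply/mem_Fil => a /uF ua; rewrite pr_comm ?brxx // ua br0r.
- exact: capvSr.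
have ge : g e = e.
  by case: ga => _ _ gf _; apply: gf => u /memv_capP[+ _]; rewrite mem_zcC => /eqP.
have gh : g h1 = h by rewrite -[RHS]gE /nu addrC subrK.
exists g; split=> //; first by apply: aut_sub ga; apply: capvSl.
have := aut_triple ga T1; rewrite ge gh => T'.
exact: sl2_unique T' T.
Qed.

End Centralizer.

(** * The adjoint group and the torus of a triple *)

Lemma adjoint_group_comp g1 g2 : adjoint_group br g1 -> adjoint_group br g2 ->
  exists2 g, adjoint_group br g & g =1 g1 \o g2.
Proof.
move=> a1 a2; elim: a1 => [|x g nx _ [g' a' g'E]]; first by exists g2.
by exists (expad br x \o g'); [apply: ag_exp | move=> v /=; rewrite g'E].
Qed.

Lemma sl2_scale c e h f : c != 0 -> sl2_triple br e h f -> sl2_triple br (c *: e) h (c^-1 *: f).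
Proof.
move=> c0 [he hf ef]; split.
- by rewrite brZr he !scalerA mulrC.
- by rewrite brZr hf scalerN !scalerA mulrC.
- by rewrite brZl brZr ef scalerA mulfV // scale1r.
Qed.

Lemma Exp_fix x v : adnil x -> br x v = 0 -> Exp x v = v.
Proof. by move=> nx xv; rewrite (Exp_br2 nx) xv ?br0r ?addr0. Qed.

(** Only exponentials of nilpotent elements generate the group, so the torus element is a product of
    two Weyl elements: one sends e to -f, the other, for the triple rescaled by s = sqrt(t), sends
    -f to s^2 e. *)
Lemma torus e h f t : sl2_triple br e h f -> t != 0 -> exists g, [/\ adjoint_group br g, g e = t *: e &
  forall v, br e v = 0 -> br f v = 0 -> g v = v].
Proof.
move=> T t0; pose s := sqrtC t.
have s0 : s != 0 by rewrite sqrtC_eq0.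
have T1 := sl2_scale s0 T.
have N1 : (-1 : C) != 0 by rewrite oppr_eq0 oner_eq0.
have T2 : sl2_triple br (- f) (- h) (- e).
  by have := sl2_scale N1 (sl2_swap T); rewrite invrN invr1 !scaleN1r.
have ne1 := sl2_e_adnil T1; have nf2 := sl2_e_adnil T2.
have ne := sl2_e_adnil T.
have nf1 : adnil (- (s^-1 *: f)).
  have := sl2_e_adnil (sl2_scale (c := - s^-1) _ (sl2_swap T)).
  by rewrite scaleNr; apply; rewrite oppr_eq0 invr_eq0.
exists (expad br (s *: e) \o (expad br (- (s^-1 *: f)) \o (expad br (s *: e) \o
  (expad br (- f) \o (expad br e \o (expad br (- f) \o id)))))); split.
- by do 6 (apply: ag_exp; first exact/adnilP); apply: ag_id.
- rewrite /= -!ExpE; have := reflection_f T2; rewrite !opprK !linearN /= => r2.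
  have -> : Exp (- f) (Exp e (Exp (- f) e)) = - f.
    by apply/eqP; rewrite -eqr_oppLR r2.
  have r1 := reflection_f T1.
  have -> : - f = - s *: (s^-1 *: f) by rewrite scalerA mulNr mulfV // scaleN1r.
  have lin c u w v : Exp u (Exp w (Exp u (c *: v))) = c *: Exp u (Exp w (Exp u v)) by rewrite !linearZ.
  by rewrite lin r1 scaleNr scalerN opprK scalerA -expr2 sqrtCK.
- move=> v ev fv; rewrite /= -!ExpE.
  rewrite !Exp_fix // ?brNl ?brZl ?ev ?fv ?scaler0 ?oppr0 //.
Qed.

(** * Cartan subalgebras *)

Lemma exists_min (P : V -> Prop) (f : V -> nat) x : P x ->
  exists2 x, P x & forall y, P y -> (f x <= f y)%N.
Proof.
move=> Px; have: (f x <= f x)%N by []; move: {2}(f x) => m; elim: m x Px => [|m IHm] x Px xm.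
  by exists x => // y _; rewrite (leq_trans xm).
have [[y [Py yx]]|nmin] := boolp.EM (exists y, P y /\ (f y < f x)%N).
  by apply: (IHm y) => //; rewrite -ltnS (leq_trans yx).
by exists x => // y Py; rewrite leqNgt; apply/negP => yx; apply: nmin; exists y.
Qed.

Lemma exists_nonroot (p : {poly C}) : p != 0 -> exists n : nat, p.[n%:R] != 0.
Proof.
move=> p0; have [//|nr] := boolp.EM (exists n : nat, p.[n%:R] != 0).
pose rs : seq C := [seq n%:R | n <- iota 0 (size p)].
have : (size rs < size p)%N.
  apply: max_poly_roots => //.
    apply/allP => _ /mapP[n _ ->]; apply/negPn/negP => rn; apply: nr; exists n.
    by move: rn; rewrite rootE.
  by rewrite map_inj_uniq ?iota_uniq // => i j /eqP; rewrite eqr_nat => /eqP.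
by rewrite size_map size_iota ltnn.
Qed.

Lemma vpoly_eq0 (p : {poly C}) (N : nat) (u : nat -> V) : p != 0 ->
  (forall t : C, p.[t] != 0 -> \sum_(k < N) t ^+ k *: u k = 0) -> forall k, (k < N)%N -> u k = 0.
Proof.
move=> p0 pu k kN; rewrite [u k](coord_vbasis (memvf _)) big1 // => i _.
pose q : {poly C} := \poly_(l < N) coord (vbasis fullv) i (u l).
have : q * p = 0.
  apply/eqP/negPn/negP => /exists_nonroot[n]; rewrite hornerM mulf_eq0 negb_or => /andP[qn pn].
  case/eqP: qn; have /(congr1 (coord (vbasis fullv) i)) := pu _ pn.
  rewrite linear0 linear_sum horner_poly => E; rewrite -[RHS]E; apply: eq_bigr => l _.
  by rewrite linearZ /= mulrC.
move/eqP; rewrite mulf_eq0 (negPf p0) orbF => /eqP q0.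
have := coef_poly N (fun l => coord (vbasis fullv) i (u l)) k; rewrite -/q q0 coef0 kN => <-.
by rewrite scale0r.
Qed.

(** p is the determinant of the map at t, projected to the image at t0 and written in the image
    basis; it equals 1 at t0. *)
Lemma generic_injective (A : nat -> 'End(V)) (N : nat) (t0 : C) U :
  (forall u, u \in U -> \sum_(k < N) t0 ^+ k *: A k u = 0 -> u = 0) ->
  exists2 p : {poly C}, p.[t0] != 0 & forall t, p.[t] != 0 ->
    forall u, u \in U -> \sum_(k < N) t ^+ k *: A k u = 0 -> u = 0.
Proof.
move=> inj0; pose At t : 'End(V) := \sum_(k < N) t ^+ k *: A k.
have AtE t u : At t u = \sum_(k < N) t ^+ k *: A k u.
  by rewrite sum_lfunE; apply: eq_bigr => k _; rewrite scale_lfunE.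
pose X : (\dim U).-tuple V := map_tuple (At t0) (vbasis U).
pose B := (At t0 @: U)%VS.
have bX : basis_of B X.
  have kerU : (U :&: lker (At t0) = 0)%VS.
    apply/eqP; rewrite -subv0; apply/subvP => u /memv_capP[Uu].
    by rewrite memv_ker AtE memv0 => /eqP /(inj0 _ Uu) ->.
  by apply: limg_basis_of => //; apply: vbasisP.
pose N_ t := \matrix_(i < \dim U, j < \dim U) coord X j (projv B (At t (vbasis U)`_i)).
pose P := \matrix_(i < \dim U, j < \dim U) \poly_(k < N) coord X j (projv B (A k (vbasis U)`_i)).
have PE t : map_mx (horner_eval t) P = N_ t.
  apply/matrixP => i j; rewrite !mxE /horner_eval horner_poly AtE !linear_sum /=.
  by apply: eq_bigr => k _; rewrite !linearZ /= mulrC.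
exists (\det P).
  have -> : (\det P).[t0] = \det (map_mx (horner_eval t0) P) by rewrite det_map_mx.
  rewrite PE (_ : N_ t0 = 1%:M) ?det1 ?oner_eq0 //; apply/matrixP => i j; rewrite !mxE.
  rewrite projv_id; last by rewrite memv_img // vbasis_mem ?mem_nth ?size_tuple.
  have -> : At t0 (vbasis U)`_i = X`_i by rewrite (nth_map 0) ?size_tuple.
  by rewrite coord_free ?(basis_free bX) // eq_sym.
move=> t; have -> : (\det P).[t] = \det (map_mx (horner_eval t) P) by rewrite det_map_mx.
rewrite PE => dN u Uu ut; rewrite (coord_vbasis Uu).
pose r := \row_i coord (vbasis U) i u.
suff r0 : r = 0.
  by rewrite big1 // => i _; have /rowP/(_ i) := r0; rewrite !mxE => ->; rewrite scale0r.
have : r *m N_ t = 0.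
  apply/rowP => j; rewrite !mxE -[RHS](linear0 (coord X j)) -[in RHS](linear0 (projv B)).
  have <- : At t (\sum_i coord (vbasis U) i u *: (vbasis U)`_i) = 0 by rewrite -coord_vbasis // AtE.
  rewrite !linear_sum; apply: eq_bigr => i _.
  by rewrite !mxE !linearZ.
have uN : N_ t \in unitmx by rewrite unitmxE unitfE.
by move/(congr1 (mulmx^~ (invmx (N_ t)))); rewrite mul0mx mulmxK.
Qed.

(** Semicontinuity: a complement of the kernel at t0 is still mapped injectively at generic t, so it
    meets the kernel there trivially. *)
Lemma generic_ker (A : nat -> 'End(V)) (N : nat) (t0 : C) S :
  exists2 p : {poly C}, p.[t0] != 0 & forall t, p.[t] != 0 ->
    (\dim (S :&: lker (\sum_(k < N) t ^+ k *: A k)%R) <= \dim (S :&: lker (\sum_(k < N) t0 ^+ k *: A k)%R))%N.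
Proof.
pose At t : 'End(V) := \sum_(k < N) t ^+ k *: A k.
have AtE t u : At t u = \sum_(k < N) t ^+ k *: A k u.
  by rewrite sum_lfunE; apply: eq_bigr => k _; rewrite scale_lfunE.
have [|p p0 pinj] := @generic_injective A N t0 (S :\: lker (At t0))%VS.
  move=> u Du; rewrite -AtE => u0; apply/eqP; rewrite -memv0 -(capv_diff S (lker (At t0))).
  by rewrite memv_cap Du memv_ker u0 eqxx.
exists p => // t pt; rewrite -/(At t) -/(At t0).
rewrite -(leq_add2r (\dim (S :\: lker (At t0)))) dimv_cap_compl -dimv_disjoint_sum.
  by apply: dimvS; rewrite subv_add capvSl diffvSl.
apply/eqP; rewrite -subv0; apply/subvP => u /memv_capP[/memv_capP[_]]; rewrite memv_ker AtE => /eqP ut Du.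
by rewrite memv0 (pinj t pt u Du ut).
Qed.

Lemma iter_line (n : nat) x y : exists A : nat -> 'End(V),
  (forall (t : C) v, iter n (br (x + t *: y)) v = \sum_(k < n.+1) t ^+ k *: A k v) /\
  forall v, A n v = iter n (br y) v.
Proof.
elim: n => [|n [A [AE An]]].
  by exists (fun _ => \1%VF); split=> [t v|v]; rewrite ?big_ord1 ?expr0 ?scale1r id_lfunE.
pose A' k := if k is k'.+1 then (if (k <= n)%N then (ad br x \o A k)%VF + (ad br y \o A k')%VF
  else (ad br y \o A k')%VF) else (ad br x \o A 0%N)%VF.
exists A'; split=> [t v|v]; last by rewrite /= ltnn comp_lfunE adE An.
rewrite iterS AE brDl brZl !br_sumr scaler_sumr.
rewrite big_ord_recl [in X in _ + X = _]big_ord_recr /= [RHS]big_ord_recl [in RHS]big_ord_recr /=.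
rewrite ltnn !comp_lfunE !adE !brZr !expr0 !scale1r -!addrA; congr (_ + _).
rewrite addrA; congr (_ + _); last by rewrite scalerA -exprS.
rewrite -big_split /=; apply: eq_bigr => k _.
by rewrite /bump /= add1n ltn_ord add_lfunE !comp_lfunE !adE !brZr scalerDr scalerA exprS.
Qed.

Section Cartan.
Variable S : {vspace V}.
Hypotheses (algS : subalg S) (nS : ndg S).
Hypothesis nilS : forall x n, x \in S -> (forall y, y \in S -> iter n (br x) y = 0) -> adnil x.

Lemma G0_lker n x (A : 'End(V)) : (\dim {:V} <= n)%N -> (forall v, A v = iter n (br x) v) -> G x 0 = lker A.
Proof.
move=> Vn AE; apply/vspaceP => v; rewrite memv_ker AE; apply/idP/eqP => [|xv].
  rewrite mem_geig0 iter_ad => /eqP xv; rewrite -(subnK Vn) iterD xv.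
  exact: iter_br0.
by apply: (@geig0P _ _ _ n); rewrite iter_ad.
Qed.

(* Both dimensions are minimal at generic points, hence simultaneously on the line through two
   minimizers. *)
Lemma exists_regular : exists x0, [/\ x0 \in S,
  forall x, x \in S -> (\dim (S :&: G x0 0) <= \dim (S :&: G x 0))%N &
  forall x, x \in S -> (\dim (S :&: zc br x0) <= \dim (S :&: zc br x))%N].
Proof.
have [x1 Sx1 min1] := exists_min (P := fun x => x \in S) (fun x => \dim (S :&: zc br x)) (mem0v S).
have [x2 Sx2 min2] := exists_min (P := fun x => x \in S) (fun x => \dim (S :&: G x 0)) (mem0v S).
have [A [AE _]] := iter_line 1 x1 (x2 - x1).
have [B [BE _]] := iter_line (\dim {:V}) x1 (x2 - x1).
have [p p0 pE] := generic_ker A 2 0 S; have [q q1 qE] := generic_ker B (\dim {:V}).+1 1 S.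
have lA t : lker (\sum_(k < 2) t ^+ k *: A k) = zc br (x1 + t *: (x2 - x1)).
  apply/vspaceP => v; rewrite memv_ker mem_zc sum_lfunE.
  by rewrite (_ : br _ v = iter 1 (br (x1 + t *: (x2 - x1))) v) // AE; congr (_ == _); apply: eq_bigr => k _; rewrite scale_lfunE.
have lB t : lker (\sum_(k < (\dim {:V}).+1) t ^+ k *: B k) = G (x1 + t *: (x2 - x1)) 0.
  symmetry; apply: (G0_lker (leqnn _)) => v; rewrite sum_lfunE BE.
  by apply: eq_bigr => k _; rewrite scale_lfunE.
have [|n] := @exists_nonroot (p * q).
  by rewrite mulf_neq0 //; [apply: contraNneq p0 | apply: contraNneq q1] => ->; rewrite horner0.
rewrite hornerM mulf_eq0 negb_or => /andP[pn qn].
exists (x1 + n%:R *: (x2 - x1)); split.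
- by rewrite memvD ?memvZ ?memvB.
- move=> x Sx; apply: leq_trans (min2 x Sx).
  by have := qE _ qn; rewrite !lB scale1r [x1 + (x2 - x1)]addrC subrK.
- move=> x Sx; apply: leq_trans (min1 x Sx).
  by have := pE _ pn; rewrite !lA scale0r addr0.
Qed.

(** For generic t, x0 + t w is injective on the span [D] of the nonzero weights, so its zero space
    in [S] lies in that of x0 and equals it by minimality. Thus (x0 + t w)^n v = 0 for generic t,
    and the coefficient of t^n is w^n v. *)
Lemma regular_nilpotent x0 : x0 \in S ->
  (forall x, x \in S -> (\dim (S :&: G x0 0) <= \dim (S :&: G x 0))%N) ->
  forall w v, w \in S -> w \in G x0 0 -> v \in S -> v \in G x0 0 -> iter (\dim {:V}) (br w) v = 0.
Proof.
move=> Sx0 xmin w v Sw w0 Sv v0; set n := \dim {:V}.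
pose D := (S :&: Fil x0 (predC1 0%R))%VS.
have wD t u : u \in D -> br (x0 + t *: w) u \in D.
  move=> /memv_capP[Su uF]; rewrite memv_cap algS ?memvD ?memvZ //=.
  apply: (@Fil_br x0 (pred1 0) (predC1 0)) uF => [a b /eqP -> /=|]; first by rewrite add0r.
  by apply: (G_Fil (a := 0)) => [|_ /=]; rewrite ?eqxx // memvD ?memvZ // eigG0 ?brxx.
have [A [AE _]] := iter_line 1 x0 w.
have [|p p0 pinj] := @generic_injective A 2 0 D.
  move=> u /memv_capP[_ /mem_Fil uF]; rewrite -AE /= scale0r addr0 => /eigG0 u0.
  by rewrite -(pr_id u0) uF //= eqxx.
have [B [BE Bn]] := iter_line n x0 w.
have sub t : p.[t] != 0 -> (S :&: G (x0 + t *: w) 0 <= S :&: G x0 0)%VS.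
  move=> pt; apply/subvP => u /memv_capP[Su].
  rewrite mem_geig0 iter_ad -/n => /eqP ut; rewrite memv_cap Su /=.
  have [u1 [u2 [uE u1D u2D]]] : exists u1 u2, [/\ u = u1 + u2, u1 \in (S :&: Fil x0 (pred1 0%R))%VS & u2 \in D].
    apply: Fil_split Su => [z Sz|z a Sz _ /=]; first exact: algS.
    by case: (a == 0).
  have u1G : u1 \in G x0 0.
    case/memv_capP: u1D => _ /mem_Fil u1F; rewrite (pr_sum x0 u1) memv_suml // => a _.
    have [->|a0] := eqVneq a 0; first exact: memv_pr.
    by rewrite u1F ?mem0v //= a0.
  suff u20 : u2 = 0 by rewrite uE u20 addr0.
  have itD m s1 s2 : iter m (br (x0 + t *: w)) (s1 + s2) = iter m (br (x0 + t *: w)) s1 + iter m (br (x0 + t *: w)) s2.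
    by elim: m => //= m ->; rewrite brDr.
  have E1 : iter n (br (x0 + t *: w)) u2 = 0.
    have i1 : iter n (br (x0 + t *: w)) u1 \in G x0 0.
      elim: (n) => //= m IHm; rewrite -[0]addr0; apply: brG IHm.
      by rewrite memvD ?memvZ // eigG0 ?brxx.
    have i2 : iter n (br (x0 + t *: w)) u2 \in D by elim: (n) => //= m IHm; apply: wD.
    move: ut; rewrite uE itD => /eqP; rewrite addr_eq0 => /eqP i12.
    have : pr x0 0 (iter n (br (x0 + t *: w)) u2) = 0.
      by case/memv_capP: i2 => _ /mem_Fil -> //=; rewrite eqxx.
    have i2G : iter n (br (x0 + t *: w)) u2 \in G x0 0 by rewrite -memvN -i12.
    by rewrite (pr_id i2G).
  elim: (n) E1 => // m IHm E1; apply: IHm; apply: (pinj t pt).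
    by elim: (m) => //= l IHl; apply: wD.
  by rewrite -AE.
have E t : p.[t] != 0 -> \sum_(k < n.+1) t ^+ k *: B k v = 0.
  move=> pt; have Sxt : x0 + t *: w \in S by rewrite memvD ?memvZ.
  have /eqP E : (S :&: G (x0 + t *: w) 0 == S :&: G x0 0)%VS by rewrite eqEdim sub // xmin.
  have : v \in (S :&: G (x0 + t *: w) 0)%VS by rewrite E memv_cap Sv.
  by rewrite memv_cap mem_geig0 iter_ad -/n BE => /andP[_ /eqP].
have p00 : p != 0 by apply: contraNneq p0 => ->; rewrite horner0.
by rewrite -Bn; apply: (@vpoly_eq0 p n.+1 (fun k => B k v) p00 E).
Qed.

Lemma exists_cartan : exists x0 (c : {vspace V}), [/\ c = (S :&: G x0 0)%VS, x0 \in c,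
  forall u w, u \in c -> w \in c -> br u w = 0 & forall x, x \in S -> (\dim c <= \dim (S :&: zc br x))%N].
Proof.
have [x0 [Sx0 min0 minz]] := exists_regular.
pose c := (S :&: G x0 0)%VS; exists x0, c.
have cx0 : x0 \in c by rewrite memv_cap Sx0 eigG0 ?brxx.
have algc : subalg c.
  move=> u w /memv_capP[Su u0] /memv_capP[Sw w0]; rewrite memv_cap algS //=.
  by rewrite -[0]addr0; apply: brG.
have nc : ndg c.
  move=> u /memv_capP[Su u0] uc; apply: (pr_ndg algS nS Sx0 Su u0) => w Sw; rewrite oppr0 => w0.
  by apply: uc; rewrite memv_cap Sw.
have ab : forall u w, u \in c -> w \in c -> br u w = 0.
  apply: abelian_of_nilpotent => // u w /memv_capP[Su u0] /memv_capP[Sw w0].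
  by exists (\dim {:V}); apply: (regular_nilpotent Sx0 min0 Su u0 Sw w0).
split=> // x Sx; apply: leq_trans (minz x Sx); apply: dimvS.
apply/subvP => u cu; rewrite memv_cap mem_zc ab // eqxx andbT.
by case/memv_capP: cu.
Qed.

End Cartan.

(** * Integral elements of a Cartan subalgebra *)

Section SplitCartan.
Variable S : {vspace V}.
Hypotheses (algS : subalg S) (nS : ndg S).
Hypothesis nilS : forall x n, x \in S -> (forall y, y \in S -> iter n (br x) y = 0) -> adnil x.

(* For large [N] the eigenspaces of [N y + h] refine those of [y] and of [h]. *)
Lemma integral_refine y h : integral y -> integral h -> br y h = 0 -> exists N : int,
  integral (N%:~R *: y + h) /\ forall (m : int) v, v \in G (N%:~R *: y + h) m%:~R -> v != 0 ->
    exists j i : int, [/\ v \in G y j%:~R, v \in G h i%:~R, m = N * j + i & 2 * `|i| < N].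
Proof.
move=> iy ih yh; have [B hB] := spec_bound h; pose N : int := (2 * B + 1)%N; exists N.
have iyN := integral_scale (m := N) iy.
have iNh : integral (N%:~R *: y + h) by apply: integral_add => //; rewrite brZl yh scaler0.
split=> // m v vm vn0; have Nhv := integralE iNh vm.
have comp a : pr y a v != 0 -> exists j i : int, [/\ a = j%:~R, pr y a v \in G h i%:~R, (`|i| <= B)%N & m = N * j + i].
  move=> av; have [j aj] := integral_pr iy av; exists j, (m - N * j).
  have yv : br y (pr y a v) = j%:~R *: pr y a v by rewrite -aj; apply: integralE (memv_pr _ _ _).
  have hv : br h (pr y a v) = (m - N * j)%:~R *: pr y a v.
    have : br (N%:~R *: y + h) (pr y a v) = m%:~R *: pr y a v.
      rewrite -pr_comm ?Nhv ?linearZ //.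
      by rewrite brDr brZr brxx scaler0 add0r.
    rewrite brDl brZl yv scalerA => /(canRL (addKr _)) ->.
    by rewrite -scaleNr -scalerDl intrB intrM; congr (_ *: _); ring.
  split=> //; first exact: eigG.
    by apply: hB; apply: (@pr_spec h _ (pr y a v)); rewrite (pr_id (eigG hv)).
  by ring.
have [a av] : exists a, pr y a v != 0 by apply: gproj_neq0.
have [j [i [aj vi iB mE]]] := comp a av.
suff vE : v = pr y a v by exists j, i; rewrite vE -{1}aj memv_pr; split=> //; rewrite /N; lia.
have only b : pr y b v != 0 -> b = a.
  move=> bv; have [j' [i' [bj _ i'B mE']]] := comp b bv.
  suff jj : j = j' by rewrite bj aj jj.
  by move: mE mE' iB i'B; rewrite /N; clear; nia.
rewrite {1}(pr_sum y v).
have aS := pr_spec av.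
rewrite (bigD1_seq a) ?undup_uniq //= big1 ?addr0 // => b ba.
by apply/eqP/negPn/negP => /only bE; rewrite bE eqxx in ba.
Qed.

Lemma integral0 : integral 0.
Proof.
move=> a v va vn0; have a0 : a = 0 by symmetry; apply: (G_eigen va vn0); rewrite br0l scale0r.
by split; [exists 0 | rewrite a0 br0l scale0r].
Qed.

Variables (x0 : V) (c : {vspace V}).
Hypotheses (cE : c = (S :&: G x0 0)%VS) (cx0 : x0 \in c)
  (cC : forall u w, u \in c -> w \in c -> br u w = 0).

Lemma cartan_sub w : w \in c -> w \in S.
Proof. by rewrite cE => /memv_capP[]. Qed.

Lemma cartan_G0 u w : u \in c -> w \in c -> w \in G u 0.
Proof. by move=> cu cw; apply: eigG0; apply: cC. Qed.

Lemma cartan_ndg : ndg c.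
Proof.
have Sx0 := cartan_sub cx0.
move=> u; rewrite {1}cE => /memv_capP[Su u0] uc; apply: (pr_ndg algS nS Sx0 Su u0) => w Sw.
by rewrite oppr0 => w0; apply: uc; rewrite cE memv_cap Sw.
Qed.

(* If [h] is as regular as possible among the integral elements of [c] but its centralizer is
   larger than [c], a triple in this centralizer provides a more regular [N h + h']. *)
Lemma integral_regular : exists h, [/\ integral h, h \in c & c = (S :&: G h 0)%VS].
Proof.
have [h [ih ch] hmin] := @exists_min (fun h => integral h /\ h \in c) (fun h => \dim (S :&: G h 0)) 0
  (conj integral0 (mem0v c)).
exists h; split=> //; apply/eqP; rewrite eqEsubv; apply/andP; split.
  by apply/subvP => w cw; rewrite memv_cap cartan_sub // cartan_G0.
pose c' := (S :&: G h 0)%VS; rewrite -/c'; have Sh := cartan_sub ch.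
have Sc' u : u \in c' -> u \in S by case/memv_capP.
have algc' : subalg c'.
  move=> u w /memv_capP[Su u0] /memv_capP[Sw w0]; rewrite memv_cap algS //=.
  by rewrite -[0]addr0; apply: brG.
have nc' : ndg c'.
  move=> u /memv_capP[Su u0] uc; apply: (pr_ndg algS nS Sh Su u0) => w Sw; rewrite oppr0 => w0.
  by apply: uc; rewrite memv_cap Sw.
have c'x0 : x0 \in c' by rewrite memv_cap cartan_sub // cartan_G0.
apply/subvP => v c'v.
suff v0 : forall a, a != 0 -> pr x0 a v = 0.
  rewrite cE memv_cap Sc' //= (pr_sum x0 v) memv_suml // => a _.
  by have [->|/v0 ->] := eqVneq a 0; rewrite ?memv_pr ?mem0v.
move=> a a0; apply/eqP/negPn/negP => va.
have c'va : pr x0 a v \in c' by apply: pr_stable => // u; apply: algc'.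
have [h' [f' [T c'h' h'0 c'f' _]]] := jacobson_morozov algc' nc' c'x0 c'va (memv_pr _ _ _) (adnil_shift (memv_pr x0 a v) a0).
have ih' := sl2_integral T; have ch' : h' \in c by rewrite cE memv_cap Sc'.
have [N [iN ref]] := integral_refine ih ih' (cC ch ch').
have cN : N%:~R *: h + h' \in c by rewrite memvD ?memvZ.
suff lt : (\dim (S :&: G (N%:~R *: h + h') 0) < \dim c')%N.
  by have := leq_trans lt (hmin _ (conj iN cN)); rewrite ltnn.
have sub : (S :&: G (N%:~R *: h + h') 0 <= c' :&: G h' 0)%VS.
  apply/subvP => u /memv_capP[Su u0]; rewrite !memv_cap Su /=.
  have [->|un0] := eqVneq u 0; first by rewrite !mem0v.
  have [j [i [uj ui jE iN2]]] := ref 0 u u0 un0.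
  have j0 : j = 0 by move: jE iN2; clear; nia.
  have i0 : i = 0 by move: jE; rewrite j0; clear; lia.
  by move: uj ui; rewrite j0 i0 => -> ->.
apply: leq_ltn_trans (dimvS sub) _; rewrite ltn_neqAle dimvS ?capvSl // andbT.
apply/negP => /eqP dE.
have /eqP E : (c' :&: G h' 0 == c')%VS by rewrite eqEdim capvSl dE leqnn.
have : pr x0 a v \in (c' :&: G h' 0)%VS by rewrite E.
case/memv_capP => _ p0; have [he _ _] := T.
by have /eqP := G_eigen p0 va he; rewrite pnatr_eq0.
Qed.

Lemma span_pred (P : V -> Prop) :
  exists2 X : seq V, (forall x, x \in X -> P x) & forall x, P x -> x \in <<X>>%VS.
Proof.
suff main m (X : seq V) : (forall x, x \in X -> P x) -> (\dim {:V} <= m + \dim <<X>>)%N ->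
    exists2 X : seq V, (forall x, x \in X -> P x) & forall x, P x -> x \in <<X>>%VS.
  by apply: (main (\dim {:V}) [::]) => //; rewrite leq_addr.
elim: m X => [|m IHm] X PX mX.
  exists X => // x _; suff /eqP -> : (<<X>> == fullv)%VS by rewrite memvf.
  by rewrite eqEdim subvf.
have [[x [Px Xx]]|nx] := boolp.EM (exists x, P x /\ x \notin <<X>>%VS); last first.
  by exists X => // x Px; apply/negPn/negP => Xx; apply: nx; exists x.
apply: (IHm (x :: X)) => [u|]; first by rewrite inE => /orP[/eqP ->|/PX].
by rewrite span_cons addvC dim_addl // addnS.
Qed.

(* A root vector [x] on which [t] does not vanish has a triple with [h] in [c] and
   [kap t h = kap (br t x) f <> 0]. *)
Lemma integral_perp t : t \in c -> (forall h, integral h -> h \in c -> kap t h = 0) -> t = 0.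
Proof.
move=> ct t0; have [h0 [ih0 ch0 cE0]] := integral_regular.
have St := cartan_sub ct; have Sh0 := cartan_sub ch0.
have nil v : v \in S -> iter (\dim {:V}) (ad br t) v = 0.
  apply: nilpotent_in v => [v Sv|a v Sv vn0]; rewrite adE; first exact: algS.
  move=> tv; have [b vb] : exists b, pr h0 b v != 0 by apply: gproj_neq0.
  have tb : br t (pr h0 b v) = a *: pr h0 b v by rewrite -pr_comm ?tv ?linearZ //; apply: cC.
  have Sb : pr h0 b v \in S by apply: subalg_pr.
  have [b0|b0] := eqVneq b 0.
    have cb : pr h0 b v \in c by rewrite cE0 memv_cap Sb /= b0 memv_pr.
    by move/eqP: tb; rewrite cC // eq_sym scaler_eq0 (negPf vb) orbF => /eqP.
  have [h [f [T Sh h0h _ _]]] := jacobson_morozov algS nS Sh0 Sb (memv_pr _ _ _) (adnil_shift (memv_pr h0 b v) b0).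
  have ch : h \in c by rewrite cE0 memv_cap Sh.
  have := t0 h (sl2_integral T) ch; have [_ _ <-] := T.
  rewrite -kap_inv tb kapZl => /eqP; rewrite mulf_eq0 => /orP[/eqP //|/eqP k0].
  have [m m0 mE] := sl2_kap_pos T vb.
  by move: mE; rewrite k0 mulr0 => /esym /eqP; rewrite pnatr_eq0 eqn0Ngt m0.
have nt : adnil t by apply: (nilS St) => v Sv; rewrite -iter_ad; apply: nil.
by apply: cartan_ndg => // w cw; apply: kap_nilp => //; apply: cC.
Qed.

Lemma integral_span : exists2 X : seq V,
  (forall x, x \in X -> integral x /\ x \in c) & forall w, w \in c -> w \in <<X>>%VS.
Proof.
have [X PX XP] := span_pred (fun x => integral x /\ x \in c); exists X => // w cw.
apply: (double_perp cartan_ndg) cw _ => [|t ct tX]; first by apply/span_subvP => x /PX[].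
by rewrite (integral_perp ct) ?kap0l // => h ih ch; apply: tX; apply: XP.
Qed.

(** Start from 0 and adjoin the members x of an integral spanning family one at a time: N y + x
    separates whatever y or x separates. *)
Lemma exists_separating : exists y, [/\ integral y, y \in c, c = (S :&: G y 0)%VS &
  forall w (j : int), w \in c -> exists a, forall v, v \in G y j%:~R -> br w v = a *: v].
Proof.
have [X PX XP] := integral_span.
suff [y [iy cy sep]] : exists y, [/\ integral y, y \in c &
  forall w (j : int), w \in X -> exists a, forall v, v \in G y j%:~R -> br w v = a *: v].
  have sepc w (j : int) : w \in c -> exists a, forall v, v \in G y j%:~R -> br w v = a *: v.
    have [al alE] := boolp.choice (fun i : 'I_(size X) => sep X`_i j (mem_nth 0 (ltn_ord i))).
    move=> /XP wX; exists (\sum_(i < size X) coord (in_tuple X) i w * al i) => v vj.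
    rewrite {1}(coord_span (X := in_tuple X) wX) br_suml scaler_suml; apply: eq_bigr => i _.
    by rewrite brZl alE // scalerA.
  exists y; split=> //; have [h [ih ch cEh]] := integral_regular.
  apply/eqP; rewrite eqEsubv; apply/andP; split.
    by apply/subvP => w cw; rewrite memv_cap cartan_sub // cartan_G0.
  apply/subvP => v /memv_capP[Sv v0]; rewrite cEh memv_cap Sv /=; apply: eigG0.
  have [a aE] := sepc h 0 ch; rewrite aE //.
  (* The regular element [h] lies in [G y 0] and commutes with itself, so its scalar there is 0
     unless [h] is 0. *)
  have /eqP := aE h (cartan_G0 cy ch); rewrite brxx eq_sym scaler_eq0 => /orP[/eqP ->|/eqP h0].
    by rewrite scale0r.
  by rewrite -aE // h0 br0l.
move: PX {XP}; elim: X => [|x X IHX] PX.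
  by exists 0; split=> //; [apply: integral0 | apply: mem0v].
have [|y [iy cy sep]] := IHX; first by move=> u Xu; apply: PX; rewrite inE Xu orbT.
have [ix cx] := PX x (mem_head _ _).
have [N [iN ref]] := integral_refine iy ix (cC cy cx).
exists (N%:~R *: y + x); split=> //; first by rewrite memvD ?memvZ.
move=> w m Xw.
have [[v0 v0m v0n]|nv] := boolp.EM (exists2 v, v \in G (N%:~R *: y + x) m%:~R & v != 0); last first.
  exists 0 => v vm; have [->|vn0] := eqVneq v 0; first by rewrite br0r scaler0.
  by case: nv; exists v.
have [j [i [_ _ mE iN2]]] := ref _ _ v0m v0n.
have uniq v : v \in G (N%:~R *: y + x) m%:~R -> v \in G y j%:~R /\ v \in G x i%:~R.
  have [->|vn0] := eqVneq v 0; first by rewrite !mem0v.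
  move=> vm; have [j' [i' [vj vi mE' iN2']]] := ref _ _ vm vn0.
  have jj : j = j' by move: mE mE' iN2 iN2'; clear; nia.
  have ii : i = i' by move: mE mE'; rewrite jj; clear; lia.
  by rewrite jj ii.
move: Xw; rewrite inE => /orP[/eqP ->|Xw].
  by exists i%:~R => v /uniq[_ vi]; apply: integralE.
by have [a aE] := sep w j Xw; exists a => v /uniq[vj _]; apply: aE.
Qed.

End SplitCartan.

(** * Simple roots *)

Section SimpleRoots.
Variable S : {vspace V}.
Hypotheses (algS : subalg S) (nS : ndg S).
(* Since [c] acts on the eigenspaces of [y] by scalars, a root is encoded by its integer value
   at [y], and [al w j] is the value at [w] of the root [j]. *)
Variables (y : V) (c : {vspace V}) (al : V -> int -> C).
Hypotheses (iy : integral y) (cy : y \in c) (cE : c = (S :&: G y 0)%VS)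
  (cC : forall u w, u \in c -> w \in c -> br u w = 0)
  (alE : forall w (j : int) v, w \in c -> v \in G y j%:~R -> br w v = al w j *: v).

Let cS w : w \in c -> w \in S.
Proof. by rewrite cE => /memv_capP[]. Qed.

Let c_ndg : ndg c.
Proof.
have Sy := cS cy.
move=> u; rewrite {1}cE => /memv_capP[Su u0] uc; apply: (pr_ndg algS nS Sy Su u0) => w Sw.
by rewrite oppr0 => w0; apply: uc; rewrite cE memv_cap Sw.
Qed.

Let brZint u v (i j : int) : u \in G y i%:~R -> v \in G y j%:~R -> br u v \in G y (i + j)%:~R.
Proof. by rewrite intrD; apply: brG. Qed.

Definition root (j : int) := (S :&: G y j%:~R != 0)%VS.

Lemma rootP (j : int) v : v \in S -> v \in G y j%:~R -> v != 0 -> root j.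
Proof.
by move=> Sv vj; apply: contraNneq => j0; rewrite -memv0 -j0 memv_cap Sv.
Qed.

Lemma root_opp (j : int) : root j -> root (- j).
Proof.
move=> rj; apply/negP => /eqP j0; case/negP: rj; rewrite -subv0; apply/subvP => u /memv_capP[Su uj].
rewrite memv0; apply/eqP; apply: (pr_ndg algS nS (cS cy) Su uj) => v Sv vj.
suff -> : v = 0 by rewrite kap0r.
by apply/eqP; rewrite -memv0 -j0 memv_cap Sv intrN.
Qed.

Lemma root_triple (j : int) : exists p : V * V * V, (j != 0) && root j ->
  [/\ p.1.1 != 0, sl2_triple br p.1.1 p.1.2 p.2, p.1.1 \in (S :&: G y j%:~R)%VS, p.1.2 \in c &
    p.2 \in (S :&: G y (- j)%:~R)%VS].
Proof.
have [/andP[j0 rj]|_] := boolP ((j != 0) && root j); last first.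
  by exists (0, 0, 0).
pose x := vpick (S :&: G y j%:~R)%VS.
have xn0 : x != 0 by rewrite vpick0.
have /memv_capP[Sx xj] := memv_pick (S :&: G y j%:~R)%VS.
have j0' : j%:~R != 0 :> C by rewrite intr_eq0.
have [h [f [T Sh h0 Sf fj]]] := jacobson_morozov algS nS (cS cy) Sx xj (adnil_shift xj j0').
by exists (x, h, f) => _; split; rewrite //= ?cE ?memv_cap ?Sx ?Sh ?Sf ?intrN.
Qed.

Lemma exists_root_triples : exists xx hh ff : int -> V, forall j, j != 0 -> root j ->
  [/\ xx j != 0, sl2_triple br (xx j) (hh j) (ff j), xx j \in (S :&: G y j%:~R)%VS, hh j \in c &
    ff j \in (S :&: G y (- j)%:~R)%VS].
Proof.
have [p pE] := boolp.choice root_triple.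
exists (fun j => (p j).1.1), (fun j => (p j).1.2), (fun j => (p j).2) => j j0 rj.
by apply: pE; rewrite j0.
Qed.

Variables (xx hh ff : int -> V).
Hypothesis D : forall j, j != 0 -> root j ->
  [/\ xx j != 0, sl2_triple br (xx j) (hh j) (ff j), xx j \in (S :&: G y j%:~R)%VS, hh j \in c &
    ff j \in (S :&: G y (- j)%:~R)%VS].

(** The integer code does not give this by itself: invariance of the form, which is nonzero on the
    pair [xx j], [ff j], forces opposite scalars. *)
Lemma root_neg j w : j != 0 -> root j -> w \in c -> al w (- j) = - al w j.
Proof.
move=> j0 rj cw; have [x0 T /memv_capP[Sx xj] ch /memv_capP[Sf fj]] := D j0 rj.
have f0 : ff j != 0.
  apply: contraNneq x0 => f0; have [hx _ hE] := T.
  have /eqP : 2%:R *: xx j = 0 by rewrite -hx -hE f0 br0r br0l.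
  by rewrite scaler_eq0 pnatr_eq0.
have : kap (br w (xx j)) (ff j) = - kap (xx j) (br w (ff j)).
  by rewrite brC kapNl kap_inv.
rewrite (alE cw xj) (alE cw fj) kapZl kapZr => /eqP; rewrite -subr_eq0 opprK -mulrDl mulf_eq0.
case/orP => [|/eqP k0]; first by rewrite addrC addr_eq0 => /eqP.
have [m m0 mE] := sl2_kap_pos T x0.
by move: mE; rewrite k0 mulr0 => /esym /eqP; rewrite pnatr_eq0 eqn0Ngt m0.
Qed.

Lemma root_al_int h j : integral h -> h \in c -> forall v, v \in G y j%:~R -> v != 0 -> exists m : int, al h j = m%:~R.
Proof.
move=> ih ch v vj vn0; have hv := alE ch vj.
by have [] := ih _ _ (eigG hv) vn0.
Qed.

(** j = p + q only compares values at y, so additivity of the roots as functionals on [c] is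
    demanded separately. *)
Definition decomposable j := exists p q : int, [/\ (0 < p) && (0 < q), root p, root q, j = p + q &
  forall w, w \in c -> al w j = al w p + al w q].

Definition simple j := [/\ 0 < j, root j & ~ decomposable j].

(** A nonzero bracket would have root i - j, making the larger of i and j the sum of the smaller and
    a positive root. *)
Lemma simple_bracket i j : simple i -> simple j -> i != j -> br (xx i) (ff j) = 0.
Proof.
move=> [i0 ri ni] [j0 rj nj] ij; apply/eqP/negPn/negP => z0.
have in0 : i != 0 by rewrite gt_eqF. have jn0 : j != 0 by rewrite gt_eqF.
have [_ _ /memv_capP[Sx xi] _ _] := D in0 ri; have [_ _ _ _ /memv_capP[Sf fj]] := D jn0 rj.
have Sz := algS Sx Sf; have zij := brZint xi fj.
have rij := rootP Sz zij z0.
have alz w : w \in c -> al w (i - j) = al w i - al w j.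
  move=> cw; have := alE cw zij; rewrite brA (alE cw xi) (alE cw fj) brZl brZr -scalerDl root_neg //.
  by move/eqP; rewrite -subr_eq0 -scalerBl scaler_eq0 (negPf z0) orbF subr_eq0 => /eqP.
have [lt|gt|eq] := ltgtP i j; last by rewrite eq eqxx in ij.
  apply: nj; exists (j - i), i; split=> //; [by rewrite subr_gt0 lt i0 | | by rewrite subrK | ].
    by rewrite -opprB; apply: root_opp.
  move=> w cw; have dn0 : i - j != 0 by rewrite subr_eq0.
  by rewrite -opprB root_neg // alz // opprB subrK.
apply: ni; exists (i - j), j; split=> //; [by rewrite subr_gt0 gt j0 | by rewrite subrK | ].
by move=> w cw; rewrite alz // subrK.
Qed.

(** [xx j] is killed by [ff i], so it is a lowest weight vector of the i-th triple and its weight is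
    at most 0. *)
Lemma simple_kap i j : simple i -> simple j -> i != j -> kap (hh i) (hh j) <= 0.
Proof.
move=> si sj ij; have := simple_bracket sj si; rewrite eq_sym => /(_ ij) xf.
have [i0 ri _] := si; have [j0 rj _] := sj.
have in0 : i != 0 by rewrite gt_eqF. have jn0 : j != 0 by rewrite gt_eqF.
have [xi0 Ti _ chi _] := D in0 ri; have [xj0 Tj /memv_capP[Sx xj] chj _] := D jn0 rj.
have fx : br (ff i) (xx j) = 0 by rewrite brC xf oppr0.
have hx := alE chi xj.
have [m mE] : exists m : nat, - al (hh i) j = m%:R.
  by apply: (ker_e_nat (sl2_swap Ti) _ fx xj0); apply: eigG; rewrite brNl hx scaleNr.
have [n n0 nE] := sl2_kap_pos Tj xj0.
have [_ _ hE] := Tj; rewrite -hE -kap_inv hx kapZl -[al _ _]opprK mE mulNr oppr_le0.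
rewrite mulr_ge0 ?ler0n // -(pmulr_rge0 _ (ltr0n C 2)) nE ler0n.
by [].
Qed.

(** kap P P is the trace of (ad P)^2, whose eigenvalues are the squares of the real numbers
    [al P j]. *)
Lemma cartan_definite P : P \in c ->
  (forall (j : int) v, v \in G y j%:~R -> v != 0 -> al P j \is Num.real) -> kap P P <= 0 -> P = 0.
Proof.
move=> cP real k0.
have sq a v : v != 0 -> (ad br P \o ad br P)%VF v = a *: v ->
    forall b, pr y b v != 0 -> exists2 j : int, b = j%:~R & al P j \is Num.real /\ a = al P j ^+ 2.
  rewrite comp_lfunE !adE => vn0 av b vb; have [j bj] := integral_pr iy vb; exists j => //.
  have vj : pr y b v \in G y j%:~R by rewrite -bj memv_pr.
  split; first exact: real vj vb.
  have : br P (br P (pr y b v)) = a *: pr y b v by rewrite -!pr_comm ?av ?linearZ ?cC.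
  rewrite (alE cP vj) brZr (alE cP vj) scalerA => /eqP.
  by rewrite -subr_eq0 -scalerBl scaler_eq0 (negPf vb) orbF subr_eq0 -expr2 => /eqP.
have ge0 a v : v != 0 -> (ad br P \o ad br P)%VF v = a *: v -> 0 <= a.
  move=> vn0 av; have [b vb] : exists b, pr y b v != 0 by apply: gproj_neq0.
  by have [j _ [alr ->]] := sq a v vn0 av b vb; rewrite real_exprn_even_ge0.
have kP : kap P P = 0 by apply: le_anti; rewrite k0 etr_ge0.
have P0 v : br P v = 0.
  rewrite (pr_sum y v) br_sumr big1 // => b _.
  have [->|vb] := eqVneq (pr y b v) 0; first by rewrite br0r.
  have [j bj] := integral_pr iy vb.
  have vj : pr y b v \in G y j%:~R by rewrite -bj memv_pr.
  rewrite (alE cP vj); have : al P j ^+ 2 = 0.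
    apply: (etr_ge0_eq0 ge0 kP vb).
    by rewrite comp_lfunE !adE (alE cP vj) brZr (alE cP vj) scalerA.
  by move/eqP; rewrite sqrf_eq0 => /eqP ->; rewrite scale0r.
apply: c_ndg => // w cw; apply: kap_nilp => // a v vn0 /eqP.
by rewrite P0 eq_sym scaler_eq0 (negPf vn0) orbF => /eqP.
Qed.

Lemma kap_root_gt0 j : j != 0 -> root j -> 0 < kap (xx j) (ff j).
Proof.
move=> j0 rj; have [x0 T _ _ _] := D j0 rj; have [n n0 nE] := sl2_kap_pos T x0.
by rewrite -(pmulr_rgt0 _ (ltr0n C 2)) nE ltr0n.
Qed.

Lemma kap_coroot w j : j != 0 -> root j -> w \in c -> kap w (hh j) = al w j * kap (xx j) (ff j).
Proof.
move=> j0 rj cw; have [_ [_ _ <-] /memv_capP[_ xj] _ _] := D j0 rj.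
by rewrite -kap_inv (alE cw xj) kapZl.
Qed.

Lemma al_sum n (a : 'I_n -> C) (w : 'I_n -> V) j v : (forall i, w i \in c) -> v \in G y j%:~R -> v != 0 ->
  al (\sum_i a i *: w i) j = \sum_i a i * al (w i) j.
Proof.
move=> cw vj v0; have cs : \sum_i a i *: w i \in c by rewrite memv_suml // => i _; rewrite memvZ.
apply/eqP; rewrite -subr_eq0.
suff : (al (\sum_i a i *: w i) j - \sum_i a i * al (w i) j) *: v = 0.
  by move/eqP; rewrite scaler_eq0 (negPf v0) orbF.
rewrite scalerBl -(alE cs vj) br_suml scaler_suml -sumrB big1 // => i _.
by rewrite brZl (alE (cw i) vj) scalerA subrr.
Qed.

Lemma simple_finite : exists s : seq int, forall j, j \in s <-> simple j.
Proof.
have [B hB] := spec_bound y.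
exists [seq j <- [seq k%:Z | k <- iota 0 B.+1] | boolp.asbool (simple j)] => j.
rewrite mem_filter; split=> [/andP[/boolp.asboolP //]|sj]; apply/andP; split; first exact/boolp.asboolP.
have [j0 rj _] := sj; have [x0 _ /memv_capP[_ xj] _ _] := D (lt0r_neq0 j0) rj.
apply/mapP; exists `|j|%N; last by rewrite gtz0_abs.
by rewrite mem_iota ltnS hB //; apply: (@pr_spec y _ (xx j)); rewrite pr_id.
Qed.

Section System.
Variable s : seq int.
Hypotheses (s_uniq : uniq s) (sP : forall j, j \in s <-> simple j).
Let n := size s.
Let si (i : 'I_n) : simple s`_i.
Proof. by apply/sP; rewrite mem_nth. Qed.
Let s0 (i : 'I_n) : s`_i != 0.
Proof. by have [j0 _ _] := si i; rewrite gt_eqF. Qed.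
Let sr (i : 'I_n) : root s`_i.
Proof. by have [_ rj _] := si i. Qed.
Let sc (i : 'I_n) : hh s`_i \in c.
Proof. by have [_ _ _ ch _] := D (s0 i) (sr i). Qed.

Definition cartan_matrix := \matrix_(i < n, j < n) al (hh s`_i) s`_j.

(* If [l] is in the kernel, [Q = sum |l_i| hh_i] has [kap Q Q <= 0] since distinct simple coroots
   have nonpositive products; so [Q = 0], whereas every [kap hh_i y] is positive. *)
Lemma cartan_matrix_unit : cartan_matrix \in unitmx.
Proof.
rewrite -row_free_unit; apply: inj_row_free => l l0.
pose k (i j : 'I_n) := kap (hh s`_i) (hh s`_j).
have lk j : \sum_i l 0 i * k i j = 0.
  rewrite (eq_bigr (fun i => l 0 i * cartan_matrix i j * kap (xx s`_j) (ff s`_j))); last first.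
    by move=> i _; rewrite /k (kap_coroot (s0 j) (sr j) (sc i)) mxE mulrA.
  rewrite -mulr_suml; have /rowP/(_ j) := l0; rewrite !mxE => ->; exact: mul0r.
have kij i j : i != j -> k i j <= 0.
  by move=> ij; apply: simple_kap => //; rewrite nth_uniq.
have kii i : 0 <= k i i.
  have [x0 [hx _ _] /memv_capP[_ xj] _ _] := D (s0 i) (sr i).
  rewrite /k (kap_coroot (s0 i) (sr i) (sc i)) mulr_ge0 ?(ltW (kap_root_gt0 (s0 i) (sr i))) //.
  have := hx; rewrite (alE (sc i) xj) => /eqP; rewrite -subr_eq0 -scalerBl scaler_eq0 (negPf x0) orbF subr_eq0.
  by move=> /eqP ->; rewrite ler0n.
pose Q := \sum_i `|l 0 i| *: hh s`_i.
have cQ : Q \in c by rewrite memv_suml // => i _; rewrite memvZ.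
have colQ j : \sum_i `|l 0 i| * k i j <= 0.
  have := lk j; rewrite (bigD1 j) //= => /eqP; rewrite addr_eq0 => /eqP E.
  rewrite (bigD1 j) //= -[k j j]ger0_norm // -normrM E normrN.
  rewrite -lerBrDr sub0r -sumrN; apply: le_trans (ler_norm_sum _ _ _) _.
  by apply: ler_sum => i ij; rewrite normrM (ler0_norm (kij _ _ ij)) mulrN.
have Q0 : Q = 0.
  apply: cartan_definite => // [j v vj v0|].
    rewrite (al_sum _ sc vj v0) rpred_sum // => i _; rewrite rpredM ?normr_real //.
    have [_ T _ _ _] := D (s0 i) (sr i).
    by have [m ->] := root_al_int (sl2_integral T) (sc i) vj v0; rewrite realz.
  rewrite {2}/Q kap_sumr; apply: sumr_le0 => j _; rewrite kapZr.
  apply: mulr_ge0_le0 => //; apply: le_trans (colQ j); rewrite /Q kap_suml.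
  by apply: ler_sum => i _; rewrite kapZl.
have ky (i : 'I_n) : kap (hh s`_i) y = (s`_i)%:~R * kap (xx s`_i) (ff s`_i).
  rewrite kapC (kap_coroot (s0 i) (sr i) cy); congr (_ * _).
  have [x0 _ /memv_capP[_ xj] _ _] := D (s0 i) (sr i).
  have := integralE iy xj; rewrite (alE cy xj) => /eqP.
  by rewrite -subr_eq0 -scalerBl scaler_eq0 (negPf x0) orbF subr_eq0 => /eqP.
have ky_gt0 (i : 'I_n) : 0 < kap (hh s`_i) y.
  by rewrite ky mulr_gt0 ?kap_root_gt0 // ltr0z; have [] := si i.
have : \sum_i `|l 0 i| * kap (hh s`_i) y = 0.
  rewrite -[RHS](kap0l y) -Q0 /Q kap_suml; apply: eq_bigr => i _; exact/esym/kapZl.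
move/psumr_eq0P => l0'; apply/rowP => i; rewrite !mxE; apply/eqP; rewrite -normr_eq0.
have /eqP := l0' (fun i _ => mulr_ge0 (normr_ge0 _) (ltW (ky_gt0 i))) i isT.
by rewrite mulf_eq0 (gt_eqF (ky_gt0 i)) orbF.
Qed.

(** Inverting the Cartan matrix gives h, a combination of the simple coroots, on which all simple
    roots are 2. The same coefficients go on the [ff], and mixed brackets vanish by
    [simple_bracket]. *)
Lemma simple_triple : exists e h f, [/\ sl2_triple br e h f, e \in S, h \in c, f \in S &
  forall j, simple j -> al h j = 2%:R].
Proof.
have [r rE] : exists r : 'rV_n, r *m cartan_matrix = const_mx 2%:R.
  by exists (const_mx 2%:R *m invmx cartan_matrix); rewrite mulmxKV // cartan_matrix_unit.
pose h := \sum_i r 0 i *: hh s`_i.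
have ch : h \in c by rewrite memv_suml // => i _; rewrite memvZ.
have h2 j : simple j -> al h j = 2%:R.
  move=> /sP js; pose i := Ordinal (etrans (index_mem j s) js).
  have -> : j = s`_i by rewrite nth_index.
  have [x0 _ /memv_capP[_ xj] _ _] := D (s0 i) (sr i).
  rewrite (al_sum _ sc xj x0); have /rowP/(_ i) := rE; rewrite !mxE => <-.
  by apply: eq_bigr => k _; rewrite mxE.
exists (\sum_(i < n) xx s`_i), h, (\sum_(i < n) r 0 i *: ff s`_i); split=> //; first split.
- rewrite br_sumr scaler_sumr; apply: eq_bigr => i _.
  have [_ _ /memv_capP[_ xj] _ _] := D (s0 i) (sr i).
  by rewrite (alE ch xj) h2.
- rewrite br_sumr scaler_sumr -sumrN; apply: eq_bigr => i _.
  have [_ _ _ _ /memv_capP[_ fj]] := D (s0 i) (sr i).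
  by rewrite brZr (alE ch fj) root_neg // h2 // !scalerA mulrN scaleNr mulrC.
- rewrite br_suml; apply: eq_bigr => i _; rewrite br_sumr (bigD1 i) //= big1 ?addr0.
    by have [_ [_ _ <-] _ _ _] := D (s0 i) (sr i); rewrite brZr.
  by move=> j ji; rewrite brZr simple_bracket ?scaler0 // nth_uniq // eq_sym.
- by apply: memv_suml => i _; have [_ _ /memv_capP[]] := D (s0 i) (sr i).
- by apply: memv_suml => i _; have [_ _ _ _ /memv_capP[Sf _]] := D (s0 i) (sr i); rewrite memvZ.
Qed.

End System.

Lemma positive_root_even h : (forall j, simple j -> al h j = 2%:R) -> h \in c ->
  forall j : int, 0 < j -> root j -> exists m : nat, al h j = (2 * m.+1)%:R.
Proof.
move=> h2 ch j; have [n] := ubnP `|j|%N; elim: n j => // n IHn j jn j0 rj.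
have [[p [q [/andP[p0 q0] rp rq jE aE]]]|nd] := boolp.EM (decomposable j); last first.
  by exists 0%N; rewrite h2.
have [|m mE] := IHn p _ p0 rp; first by move: jn jE q0 p0; clear; lia.
have [|l lE] := IHn q _ q0 rq; first by move: jn jE q0 p0; clear; lia.
by exists (m + l).+1; rewrite aE // mE lE -natrD; congr _%:R; lia.
Qed.

Lemma root_weight h (j : int) v : (forall j, simple j -> al h j = 2%:R) -> h \in c -> v \in S -> v \in G y j%:~R ->
  j != 0 -> v != 0 -> exists2 m : int, m != 0 & br h v = (2 * m)%:~R *: v.
Proof.
move=> h2 ch Sv vj j0 v0; have rj := rootP Sv vj v0.
have [jp|jm|jz] := ltgtP 0 j; last by rewrite -jz eqxx in j0.
  have [m mE] := positive_root_even h2 ch jp rj.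
  by exists m.+1%:Z => //; rewrite (alE ch vj) mE; congr (_ *: _).
have jp : 0 < - j by rewrite oppr_gt0.
have [m mE] := positive_root_even h2 ch jp (root_opp rj).
exists (- m.+1%:Z); first by rewrite oppr_eq0.
rewrite (alE ch vj) -[al h j]opprK -root_neg // mE mulrN intrN; congr (- _ *: _).
Qed.

(** Nonzero roots take nonzero even values at h, so weight 1 is absent, the weight zero part of [S]
    is [c], and [sl2_dim] concludes. *)
Lemma exists_principal_triple : exists e h f, [/\ sl2_triple br e h f, e \in S, h \in S, f \in S &
  \dim (S :&: zc br e) = \dim c].
Proof.
have [s0 s0P] := simple_finite; pose s := undup s0.
have sP j : j \in s <-> simple j by rewrite mem_undup.
have [e [h [f [T Se ch Sf h2]]]] := simple_triple (undup_uniq s0) sP.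
have Sh := cS ch; exists e, h, f; split=> //.
rewrite (sl2_dim T (fun v Sv => algS Se Sv) (fun v Sv => algS Sh Sv) (fun v Sv => algS Sf Sv)).
have hw v : v \in S -> forall b, pr y b v != 0 -> b != 0 -> exists2 m : int, m != 0 & br h (pr y b v) = (2 * m)%:~R *: pr y b v.
  move=> Sv b vb b0; have [j bj] := integral_pr iy vb.
  apply: (@root_weight h j) => //; first by apply: subalg_pr => //; apply: cS.
    by rewrite -bj memv_pr.
  by apply: contraNneq b0 => j0; rewrite bj j0.
have yh : br y h = 0 by apply: cC.
have prG b a v : v \in G h a -> pr y b v \in G h a.
  by move=> va; apply: pr_stable => // u ua; apply: G0_stable ua; rewrite brC yh oppr0.
have -> : (S :&: G h 1 = 0)%VS.
  apply/eqP; rewrite -subv0; apply/subvP => v /memv_capP[Sv v1]; rewrite memv0 (pr_sum y v) big1 // => b _.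
  apply/eqP/negPn/negP => vb; have [b0|b0] := eqVneq b 0.
    have cb : pr y b v \in c.
      rewrite cE memv_cap; apply/andP; split; last by rewrite -b0 memv_pr.
      by apply: subalg_pr => //; apply: cS.
    have hb : br h (pr y b v) = 0 *: pr y b v by rewrite cC ?scale0r.
    by have /eqP := G_eigen (prG b 1 v v1) vb hb; rewrite eq_sym oner_eq0.
  have [m m0 mE] := hw v Sv b vb b0.
  have /eqP := G_eigen (prG b 1 v v1) vb mE; rewrite -[1]/(1%:~R) eqr_int => /eqP.
  by clear; lia.
rewrite dimv0 addn0; congr (\dim _); apply/eqP; rewrite eqEsubv; apply/andP; split.
  apply/subvP => v /memv_capP[Sv v1]; rewrite cE memv_cap Sv /= (pr_sum y v) memv_suml // => b _.
  have [->|b0] := eqVneq b 0; first exact: memv_pr.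
  have [->|vb] := eqVneq (pr y b v) 0; first exact: mem0v.
  have [m m0 mE] := hw v Sv b vb b0.
  have /eqP := G_eigen (prG b 0 v v1) vb mE; rewrite -[0]/(0%:~R) eqr_int => /eqP.
  by move: m0; clear; lia.
by apply/subvP => w cw; rewrite memv_cap cS // eigG0 // cC.
Qed.

End SimpleRoots.

Lemma exists_principal_nilpotent S : subalg S -> ndg S ->
  (forall x n, x \in S -> (forall y, y \in S -> iter n (br x) y = 0) -> adnil x) ->
  exists e, principal_nilpotent_in br S e.
Proof.
move=> algS nS nilS; have [x0 [c [cE cx0 cC cmin]]] := exists_cartan algS nS.
have [y [iy cy cEy sep]] := exists_separating algS nS nilS cE cx0 cC.
have [al alE] : exists al : V -> int -> C, forall w (j : int) v, w \in c -> v \in G y j%:~R -> br w v = al w j *: v.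
  have [|al alE] := @boolp.choice (V * int) C (fun p a => p.1 \in c -> forall v, v \in G y p.2%:~R -> br p.1 v = a *: v).
    move=> [w j] /=; have [cw|_] := boolP (w \in c); last by exists 0.
    by have [a aE] := sep w j cw; exists a.
  by exists (fun w j => al (w, j)) => w j v cw vj; apply: (alE (w, j)).
have [xx [hh [ff D]]] := exists_root_triples algS nS cy cEy.
have [e [h [f [T Se Sh Sf dE]]]] := exists_principal_triple algS nS iy cy cEy cC alE D.
exists e; split=> //; first by exists (\dim {:V}) => v _; apply: nilp_iter; apply: sl2_e_adnil T.
by split; [exists e | move=> x /cmin; rewrite dE].
Qed.

Lemma aut_dim U g M : aut U g -> \dim (g @: M) = \dim M.
Proof. by case=> _ /lker0P/eqP gi _ _; apply: limg_dim_eq; rewrite gi capv0. Qed.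

Lemma aut_zc U g x : aut U g -> (g @: zc br x)%VS = zc br (g x).
Proof.
move=> [gm gi _ _]; have g0 : lker g == 0%VS by apply/lker0P.
apply/vspaceP => v; rewrite mem_zc; apply/memv_imgP/eqP => [[u xu ->]|xv].
  by move: xu; rewrite mem_zc -gm => /eqP ->; rewrite linear0.
exists ((g^-1)%VF v); last by rewrite lker0_lfunVK.
by rewrite mem_zc; apply/eqP/gi; rewrite gm lker0_lfunVK // xv linear0.
Qed.

Lemma aut_cap U g M N : aut U g -> (g @: (M :&: N) = g @: M :&: g @: N)%VS.
Proof. by case=> _ gi _ _; apply: lker0_img_cap; apply/lker0P. Qed.

Lemma zc_stable x u v : br u x = 0 -> v \in zc br x -> br u v \in zc br x.
Proof. by rewrite !mem_zc brC => /eqP; rewrite oppr_eq0 => /eqP ux /eqP xv; rewrite brA ux xv br0r br0l addr0. Qed.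

(** * Rectangular pairs *)

Section Rectangular.
Variables (e h f : V).
Hypotheses (T : sl2_triple br e h f) (nV : ndg fullv).
Local Notation k := (zc br e :&: zc br h :&: zc br f)%VS.

Lemma exists_principal_derived : exists e', principal_nilpotent_in br (derived br k) e'.
Proof.
have algk := @k_subalg e h f; have nk := k_ndg T nV.
apply: exists_principal_nilpotent.
- exact: derived_subalg.
- exact: derived_ndg.
- by move=> x n; apply: adnil_of_derived.
Qed.

Lemma even_G1 : even_nilpotent br h <-> G h 1 = 0%VS.
Proof.
have ih := sl2_integral T; split=> [ev|h1 i oi]; last by rewrite grade_integral // (sl2_even T).
by have := ev 1 isT; rewrite grade_integral.
Qed.

Lemma derived_k x : x \in derived br k -> x \in k.
Proof. by move/(subvP (derived_sub (@k_subalg e h f))). Qed.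

Lemma G0_k_stable x v a : x \in k -> v \in G h a -> br x v \in G h a.
Proof. by case/mem_k => _ hx _; apply: G0_stable. Qed.

Lemma pair_of_principal e' : even_nilpotent br h -> principal_nilpotent_in br (derived br k) e' ->
  lie_rank_is br fullv (\dim (grade br h 0 :&: zc br e')) ->
  principal_nilpotent_pair br e e' /\ exists h' f', [/\ sl2_triple br e' h' f',
    e' \in k, h' \in k & f' \in k].
Proof.
move=> /even_G1 h1 pe rk; have algk := @k_subalg e h f; have nk := k_ndg T nV.
have [h' [f' [T' [Se Sh Sf] _ _]]] := principal_nilpotent_triple algk nk pe.
have ih := sl2_integral T; have ke := derived_k Se; have kh := derived_k Sh; have kf := derived_k Sf.
split; last by exists h', f'.
have /mem_k[ee he fe] := ke; have /mem_k[ef _ _] := kf.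
split=> // [|t1 t2 t10 t20].
  rewrite capvC (sl2_dim T (fun v => zc_stable ee) (fun v => zc_stable he) (fun v => zc_stable fe)).
  by rewrite h1 capv0 dimv0 addn0 capvC -[0]/(0%:~R) -(grade_integral _ ih).
have [g1 [G1 g1e g1fix]] := torus T t10; have [g2 [G2 g2e g2fix]] := torus T' t20.
have [g Gg gE] := adjoint_group_comp G1 G2; exists g => //; rewrite !gE /= g2e; split.
  by rewrite g2fix // brC ?ee ?ef oppr0.
by rewrite g1fix // brZr ?ee ?fe scaler0.
Qed.

Section Converse.
Variables (e2 h2 f2 : V).
Hypotheses (T2 : sl2_triple br e2 h2 f2) (ke : e2 \in k) (kh : h2 \in k) (kf : f2 \in k).
Hypothesis rk : lie_rank_is br fullv (\dim (zc br e :&: zc br e2)).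
Local Notation S := (derived br k).

Lemma rectangular_regular : [/\ G h 1 = 0%VS, principal_triple S e2 h2 f2 &
  (\dim (zc br e :&: zc br e2) = \dim (G h 0 :&: G h2 0) + \dim (G h 0 :&: G h2 1))%N].
Proof.
set r := \dim (zc br e :&: zc br e2); have rkr : lie_rank_is br fullv r by [].
have [_ rmin] := rkr; have ih := sl2_integral T; have ih2 := sl2_integral T2.
have /mem_k[ee he fe] := ke; have /mem_k[eh hh fh] := kh.
have d1 := sl2_dim T (fun v => zc_stable ee) (fun v => zc_stable he) (fun v => zc_stable fe).
have st a x : x \in k -> forall v, v \in G h a -> br x v \in G h a by move=> kx v; apply: G0_k_stable.
have d2 := sl2_dim T2 (st 0 _ ke) (st 0 _ kh) (st 0 _ kf).
have [N [iy ref]] := integral_refine ih ih2 hh; set y := _ + h2 in iy ref.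
have sub : (G y 0 <= G h 0 :&: G h2 0)%VS.
  apply/subvP => v v0; have [->|vn0] := eqVneq v 0; first exact: mem0v.
  have [j [i [vj vi jE iN2]]] := ref 0 v v0 vn0.
  have j0 : j = 0 by move: jE iN2; clear; nia.
  have i0 : i = 0 by move: jE; rewrite j0; clear; lia.
  by move: vj vi; rewrite j0 i0 memv_cap => -> ->.
have ra : (r <= \dim (G h 0 :&: G h2 0))%N.
  by have := rmin y (memvf y); rewrite capfv zc_G0 // => /leq_trans; apply; apply: dimvS.
rewrite capvC -/r in d1.
have [rE hz] : r = (\dim (G h 0 :&: G h2 0) + \dim (G h 0 :&: G h2 1))%N /\
    \dim (zc br e2 :&: G h 1) = 0%N /\ \dim (G h 0 :&: G h2 1) = 0%N.
  by rewrite [(zc br e2 :&: G h 0)%VS]capvC d2 in d1; move: d1 ra; clear; lia.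
have [z1 z2] := hz; split=> //.
  apply: (sl2_ker0 T2 (st 1 _ ke)) => v v1 ev.
  apply/eqP; rewrite -memv0; have /eqP <- : (zc br e2 :&: G h 1 == 0)%VS by rewrite -dimv_eq0 z1.
  by rewrite memv_cap mem_zc ev eqxx.
have [t1 t2 t3] := T2.
have two : 2%:R != 0 :> C by rewrite pnatr_eq0.
have Se : e2 \in S by rewrite -[e2](scalerK two) -t1 memvZ // mem_derived.
have Sf : f2 \in S by rewrite -[f2](scalerK two) -[_ *: f2]opprK -t2 memvZ // memvN mem_derived.
have Sh : h2 \in S by rewrite -t3 mem_derived.
have kG u : u \in S -> u \in G h 0 by case/derived_k/mem_k => _ hu _; apply: eigG0.
have G0y u : u \in S -> u \in G h2 0 -> u \in G y 0.
  move=> Su u2; apply: eigG0; rewrite /y brDl brZl (integralE ih (kG u Su)) (integralE ih2 u2).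
  by rewrite !scale0r scaler0 addr0.
split=> //.
  split=> // u w Su u0 Sw w0.
  have algV : subalg fullv by move=> ? ? _ _; apply: memvf.
  (* The centralizer of [y] has dimension at most [r], the rank, so [y] is regular in the whole
     algebra and its centralizer is abelian. *)
  apply: (abelian_of_minimal algV (memvf y) iy) => [x _||||]; rewrite ?memvf ?G0y //.
  apply: leq_trans (rmin x (memvf x)); rewrite capfv zc_G0 //.
  by apply: leq_trans (dimvS sub) _; rewrite rE leq_addr.
apply/eqP; rewrite -subv0; have /eqP <- : (G h 0 :&: G h2 1 == 0)%VS by rewrite -dimv_eq0 z2.
by apply/subvP => v /memv_capP[Sv v1]; rewrite memv_cap kG.
Qed.

(** The dimension of the centralizer of e' in [G h 0] depends only on the weights of h' there.
    Exponentials from [S] preserve the [k]-module [G h 0], so conjugacy of h' and h2 suffices. *)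
Lemma regular_of_rectangular e' : principal_nilpotent_in br S e' ->
  lie_rank_is br fullv (\dim (grade br h 0 :&: zc br e')).
Proof.
move=> pe; have algk := @k_subalg e h f; have nk := k_ndg T nV.
have [h' [f' P']] := principal_nilpotent_triple algk nk pe.
have [_ P2 rE] := rectangular_regular.
have [g1 [g2 [A1 A2 gE]]] := conj_principal (derived_subalg algk) (derived_ndg algk nk) P' P2.
have [T' [Se Sh Sf] _ _] := P'.
have st x : x \in S -> forall v, v \in G h 0 -> br x v \in G h 0 by move=> /derived_k kx v; apply: G0_k_stable.
have dimE g x a : aut S g -> integral x -> \dim (G h 0 :&: G (g x) a) = \dim (G h 0 :&: G x a).
  move=> Ag ix; have igx : integral (g x) by apply: aut_integral Ag ix.
  by rewrite -[RHS](aut_dim _ Ag) (aut_cap _ _ Ag) (aut_G a Ag ix igx) (aut_inv Ag) // => u m /st; apply.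
rewrite -[0]/(0%:~R) (grade_integral _ (sl2_integral T)) (sl2_dim T' (st _ Se) (st _ Sh) (st _ Sf)).
have i' := sl2_integral T'; have i2 := sl2_integral T2.
by rewrite -!(dimE g1 h' _ A1 i') gE !(dimE g2 h2 _ A2 i2) -rE.
Qed.

End Converse.

(** The triple of e in the pair may differ from {e, h, f}; [triple_conj] aligns them while fixing e,
    and carries the triple of e2 into [k]. *)
Lemma rectangular_ii e2 h1 f1 h2 f2 : sl2_triple br e h1 f1 -> sl2_triple br e2 h2 f2 ->
  (forall x y, x \in [:: e; h1; f1] -> y \in [:: e2; h2; f2] -> br x y = 0) ->
  lie_rank_is br fullv (\dim (zc br e :&: zc br e2)) ->
  even_nilpotent br h /\ forall e', principal_nilpotent_in br (derived br k) e' ->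
    lie_rank_is br fullv (\dim (grade br h 0 :&: zc br e')).
Proof.
move=> T1 T2 comm rk; have [g [Ag ge gh gf]] := triple_conj T T1.
have gk x : x \in [:: e2; h2; f2] -> g x \in k.
  move=> x2; have [gm _ _ _] := Ag; apply/mem_k; rewrite -{1}ge -{1}gh -{1}gf -!gm.
  by split; rewrite comm ?linear0 // !inE eqxx ?orbT.
have T2' := aut_triple Ag T2.
have rk' : lie_rank_is br fullv (\dim (zc br e :&: zc br (g e2))).
  by rewrite -{1}ge -!(aut_zc _ Ag) -(aut_cap _ _ Ag) (aut_dim _ Ag).
have [ke kh kf] : [/\ g e2 \in k, g h2 \in k & g f2 \in k].
  by split; apply: gk; rewrite !inE eqxx ?orbT.
have [h1E _ _] := rectangular_regular T2' ke kh kf rk'.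
split; first exact/even_G1.
exact: regular_of_rectangular T2' ke kh kf rk'.
Qed.

End Rectangular.

End LieAlgebra.

Theorem theorem8p1 (R : realType) (V : vectType R[i]) (br : V -> V -> V)
    (e h f : V) :
  lie_algebra br -> semisimple br ->
  ad_nilpotent br e -> sl2_triple br e h f ->
  let k := (zc br e :&: zc br h :&: zc br f)%VS in
  let g0 := grade br h 0 in
  let cond_ii :=
    even_nilpotent br h /\
    (forall e', principal_nilpotent_in br (derived br k) e' ->
       lie_rank_is br fullv (\dim (g0 :&: zc br e'))) in
  ((exists e2, rectangular_ppn br e e2 \/ rectangular_ppn br e2 e) <-> cond_ii)
  /\ (cond_ii -> forall e', principal_nilpotent_in br (derived br k) e' ->
        principal_nilpotent_pair br e e').
Proof.
move=> Lie ss _ T k g0 cond_ii.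
have nV : ndg br fullv.
  by move=> x _ x0; apply: (semisimple_ndg ss) => y; apply: x0; apply: memvf.
have pair e' : cond_ii -> principal_nilpotent_in br (derived br k) e' ->
    principal_nilpotent_pair br e e' /\
    exists h' f', [/\ sl2_triple br e' h' f', e' \in k, h' \in k & f' \in k].
  by move=> [ev rk] pe; exact: (pair_of_principal T nV ev pe (rk e' pe)).
split; last by move=> ii e' pe; have [] := pair e' ii pe.
split=> [[e2 [[[_ rk _] [h1 [f1 [h2 [f2 [T1 T2 cm]]]]]]|[[_ rk _] [h2 [f2 [h1 [f1 [T2 T1 cm]]]]]]]]|ii].
- exact: rectangular_ii T nV _ _ _ _ _ T1 T2 cm rk.
- rewrite capvC in rk; apply: rectangular_ii T nV _ _ _ _ _ T1 T2 _ rk => x y xe ye.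
  by rewrite brC cm ?oppr0.
have [e' pe] := exists_principal_derived T nV.
have [pp [h' [f' [T' ke kh kf]]]] := pair e' ii pe.
exists e'; left; split=> //; exists h, f, h', f'; split=> // x y xe ye.
have /mem_k[ey hy fy] : y \in k by move: ye; rewrite !inE => /or3P[] /eqP ->.
by move: xe; rewrite !inE => /or3P[] /eqP ->.
Qed.
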